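(* Let $G$ be a group such that $\gamma_5(G)$ has no element of order $2$. Then $R_3(G)$ is a subgroup of $G$.
   Context: For elements $a,b$ of a group, define the $n$-Engel commutators inductively by $[a,_0 b]:=a$, $[a,_1 b]=[a,b]:=a^{-1}b^{-1}ab$, and $[a,_n b]:=[[a,_{n-1}b],b]$ for all $n>0$. An element $x$ of a group $G$ is called right $n$-Engel if $[x,_n g]=1$ for all $g\in G$; $R_n(G)$ denotes the set of all right $n$-Engel elements of $G$. For a positive integer $k$, $\gamma_k(G)$ denotes the $k$th term of the lower central series of $G$, i.e. $\gamma_1(G)=G$ and $\gamma_{k+1}(G)=[\gamma_k(G),G]$. *)

(* Defs.v *)
From mathcomp Require Import all_boot monoid.
From mathcomp Require Import classical_sets.

Set Implicit Arguments.
Unset Strict Implicit.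
Unset Printing Implicit Defensive.

Local Open Scope classical_set_scope.
Local Open Scope group_scope.

(* [groupType] is not restricted to finite groups; subsets of a group are
   Prop-valued [set]s, since membership need not be decidable. *)

Definition is_subgroup (G : groupType) (H : set G) : Prop :=
  group_closed [in H].

Definition generated_subgroup (G : groupType) (A : set G) : set G :=
  smallest (@is_subgroup G) A.

Definition commutator_subgroup (G : groupType) (A B : set G) : set G :=
  generated_subgroup [set c | exists2 a, A a & exists2 b, B b & c = [~ a, b]].

(* The terms are numbered from 1; the value at k = 0 is also the whole group. *)
Definition lower_central_term (G : groupType) (k : nat) : set G :=
  iter k.-1 (fun H : set G => commutator_subgroup H [set: G]) [set: G].

Definition has_order (G : groupType) (x : G) (n : nat) : Prop :=
  [/\ (0 < n)%N, x ^+ n = 1 & forall m, (0 < m < n)%N -> x ^+ m <> 1].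

Definition engel_commutator (G : groupType) (n : nat) (a b : G) : G :=
  iter n (fun c => [~ c, b]) a.

Definition right_engel (G : groupType) (n : nat) : set G :=
  [set x | forall g : G, engel_commutator n x g = 1].

Arguments lower_central_term : clear implicits.
Arguments right_engel : clear implicits.

(* Main.v *)
(* Let p be right 3-Engel.  Comparing the Engel conditions for p at x and at x t,
   where t centralizes p, gives all relations between p^(x^-1), p and p^x up to
   elements of gamma_5 of 2-power order, which are trivial by hypothesis.  Hence
   p^-1 is right 3-Engel, and the normal closure of p has class 2 modulo the
   group Z of central elements of order dividing 4.  As Z meets gamma_5
   trivially, identities between elements of gamma_5 may be proved modulo Z.

   Let now a and b be right 3-Engel, c = [a, x] and d = [b, x].  If [c, x]
   commutes with d, [d, x] with c, and [d, c] with c and d, then <x, c, d> has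
   class at most 2, and [x^-a, x^b] = [c x^-1, x d^-1] commutes with x^b, which says that a b^-1 is right 3-Engel.

   These identities are linear in b up to a correction in the derived subgroup of
   its normal closure.  To remove it, one computes with the pair (b, b^-1) in
   G x G modulo the diagonal of the centralizer of the normal closure: its
   conjugates generate an abelian normal subgroup of right 3-Engel elements, on
   which the operators v |-> [v, g] satisfy (g - 1)^3 = 0 and the first order
   part of the Engel condition for a.  A consequence which holds for b up to the
   factor 2^k then holds for b and b^-1 with the same correction, while both
   sides are odd; so what remains is of 2-power order in gamma_5. *)

(* The weight 5 in the hypothesis comes from [[~ p, p ^ g] = [~ p, [~ p, g]]], which lies in
   gamma_3. One further commutator lies in gamma_4, where the hypothesis says nothing: this is why
   [[~ p, p ^ g, g]] is not shown to vanish, but only to be central of order dividing 4, so that it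
   can be divided out. The other defects that have to vanish have weight at least 5, and for them a
   trivial fourth or eighth power is enough.

   The obstacle in the second half is that u |-> [u, x] is not additive on the normal closure of b,
   which has class 2 even after that division. An abelian quotient of the closure would restore
   additivity but lose the derived subgroup, in which the corrections lie. The pair of b and b^-1
   keeps them: bilinearity gives two conjugates of b and the corresponding conjugates of b^-1 the
   same commutator, so commutators of conjugates of the pair fall on the diagonal; and an odd
   quantity on the diagonal equals its own inverse. *)
From HB Require Import structures.
Require Import Defs.
From mathcomp Require Import all_boot monoid.
From mathcomp Require Import boolp classical_sets.

Set Implicit Arguments.
Unset Strict Implicit.
Unset Printing Implicit Defensive.

Local Open Scope group_scope.

(** * Decision procedures for words in groups *)

Section WordReflection.

Inductive gexp := Gvar of nat | Gone | Gmul of gexp & gexp | Ginv of gexp.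

Variables (G : groupType) (env : nat -> G) (com : seq (nat * nat)).

Definition gcom (i j : nat) := ((i, j) \in com) || ((j, i) \in com).

(* Pushes a letter through the letters known to commute with it, looking for
   its inverse. *)
Fixpoint gpush (l : bool * nat) (s : seq (bool * nat)) :=
  if s is h :: s' then
    if (h.1 == ~~ l.1) && (h.2 == l.2) then s'
    else if gcom l.2 h.2 || (h.2 == l.2) then h :: gpush l s' else l :: s
  else [:: l].

Fixpoint gnf (e : gexp) (b : bool) (s : seq (bool * nat)) :=
  match e with
  | Gvar i => gpush (b, i) s
  | Gone => s
  | Gmul e1 e2 => if b then gnf e2 b (gnf e1 b s) else gnf e1 b (gnf e2 b s)
  | Ginv e1 => gnf e1 (~~ b) s
  end.

Fixpoint geval (e : gexp) : G :=
  match e with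
  | Gvar i => env i
  | Gone => 1
  | Gmul e1 e2 => geval e1 * geval e2
  | Ginv e1 => (geval e1)^-1
  end.

Definition glet (l : bool * nat) : G := if l.1 then (env l.2)^-1 else env l.2.

Fixpoint gword (s : seq (bool * nat)) : G :=
  if s is h :: s' then glet h * gword s' else 1.

Fixpoint gvalid (s : seq (nat * nat)) : Prop :=
  if s is h :: s' then commute (env h.1) (env h.2) /\ gvalid s' else True.

Hypothesis com_valid : gvalid com.

Lemma gcomP i j : gcom i j -> commute (env i) (env j).
Proof.
have h k l : (k, l) \in com -> commute (env k) (env l).
  elim: com com_valid => //= -[k' l'] s IH [h1 h2].
  by rewrite inE => /orP[/eqP[-> ->] //|]; apply: IH.
by case/orP => /h // /commute_sym.
Qed.

Lemma gpushE l s : gword (gpush l s) = glet l * gword s.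
Proof.
elim: s => [|[b i] s IH] //=; case: ifP => /= [/andP[/eqP/= -> /eqP/= ->]|_].
  by case: l {IH} => [[|] j]; rewrite /glet /= ?mulKg ?mulVKg.
case: ifP => //= h; rewrite IH !mulgA; congr (_ * _).
have {}h : commute (env i) (env l.2).
  by case/orP: h => [/gcomP/commute_sym //|/eqP ->]; apply: commute_refl.
rewrite /glet /=; case: b; case: l.1; rewrite -/(commute _ _) //.
- by apply/commute_sym/commuteV/commute_sym/commuteV.
- exact/commute_sym/commuteV/commute_sym.
- exact: commuteV.
Qed.

Lemma gnfE e b s :
  gword (gnf e b s) = (if b then (geval e)^-1 else geval e) * gword s.
Proof.
elim: e b s => [i||e1 IH1 e2 IH2|e1 IH1] b s /=.
- by rewrite gpushE; case: b.
- by rewrite invg1 if_same mul1g.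
- by case: b; rewrite ?IH2 ?IH1 ?IH2 ?invgM mulgA.
- by rewrite IH1; case: b; rewrite ?invgK.
Qed.

(** [gpush] cancels letters but does not sort them, so reduced words over partially commuting
    letters are not unique. Hence the quotient of the two sides is reduced to the empty word,
    instead of comparing two normal forms. *)
Lemma geval_eq e1 e2 :
  gnf (Gmul e1 (Ginv e2)) false [::] = [::] -> geval e1 = geval e2.
Proof.
move=> h; have := gnfE (Gmul e1 (Ginv e2)) false [::]; rewrite h /= mulg1.
by move/esym/divg1_eq.
Qed.

End WordReflection.

(** * Word equality up to conjugation and inversion *)

Section ConjugateSearch.

Definition flip_letter (l : bool * nat) := (~~ l.1, l.2).
Definition inv_word (s : seq (bool * nat)) := rev (map flip_letter s).

Fixpoint cyc_strip (n : nat) (p s : seq (bool * nat)) :=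
  if n is n'.+1 then
    if s is h :: t then
      if (t != [::]) && (last h t == flip_letter h)
      then cyc_strip n' (rcons p h) (behead (belast h t)) else (p, s)
    else (p, s)
  else (p, s).

Fixpoint find_rot (n k : nat) (w u : seq (bool * nat)) :=
  if n is n'.+1 then if rot k w == u then Some k else find_rot n' k.+1 w u
  else None.

(** With u = p u' p^-1 and w = q w' q^-1 for cyclically reduced u', w', and u' = t^-1 w' t a
    rotation of w', the conjugator from w to u is p t^-1 q^-1. *)
Definition find_conj (u w : seq (bool * nat)) :=
  let: (p, u') := cyc_strip (size u) [::] u in
  let: (q, w') := cyc_strip (size w) [::] w in
  if find_rot (size w').+1 0 w' u' is Some k
  then p ++ inv_word (take k w') ++ inv_word q else [::].

Definition gexp_of (s : seq (bool * nat)) : gexp :=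
  foldr (fun l e => Gmul (if l.1 then Ginv (Gvar l.2) else Gvar l.2) e) Gone s.

(** The conjugator found by the search is checked by normalizing again, so soundness does not rest
    on the search. The second alternative treats the inverse of [W]. *)
Definition conj_test (W U : gexp) :=
  let u := gnf [::] U false [::] in
  let g := gexp_of (find_conj u (gnf [::] W false [::])) in
  let h := gexp_of (find_conj u (gnf [::] W true [::])) in
  let P V k := nilp (gnf [::] (Gmul U (Ginv (Gmul k (Gmul V (Ginv k))))) false [::]) in
  P W g || P (Ginv W) h.

Lemma conj_testP (G : groupType) (env : nat -> G) l r L R :
  conj_test (Gmul l (Ginv r)) (Gmul L (Ginv R)) ->
  geval env l = geval env r -> geval env L = geval env R.
Proof.
rewrite /conj_test => /orP[] /nilP h elr.
  have := @geval_eq G env [::] I (Gmul L (Ginv R)) _ h.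
  by rewrite /= elr mulgV mul1g mulgV => /divg1_eq.
have := @geval_eq G env [::] I (Gmul L (Ginv R)) _ h.
by rewrite /= elr mulgV invg1 mul1g mulgV => /divg1_eq.
Qed.

End ConjugateSearch.

Ltac gmem x l :=
  match l with
  | nil => constr:(false)
  | cons x _ => constr:(true)
  | cons _ ?l' => gmem x l'
  end.
Ltac gidx x l :=
  match l with
  | cons x _ => constr:(O)
  | cons _ ?l' => let n := gidx x l' in constr:(S n)
  end.
Ltac gatoms l e :=
  lazymatch e with
  | @mul _ ?a ?b => let l1 := gatoms l a in gatoms l1 b
  | @inv _ ?a => gatoms l a
  | @monoid.one _ => l
  | _ => lazymatch gmem e l with true => l | false => constr:(cons e l) end
  end.
Ltac gpow x n :=
  lazymatch n with
  | O => constr:(Gone) | S O => x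
  | S ?m => let y := gpow x m in constr:(Gmul x y) end.
Ltac greify l e :=
  lazymatch gmem e l with
  | true => let n := gidx e l in constr:(Gvar n)
  | false =>
  lazymatch e with
  | @mul _ ?a ?b => let x := greify l a in let y := greify l b in constr:(Gmul x y)
  | @inv _ ?a => let x := greify l a in constr:(Ginv x)
  | @monoid.one _ => constr:(Gone)
  | @conjg _ ?a ?b => let x := greify l a in let y := greify l b in
      constr:(Gmul (Ginv y) (Gmul x y))
  | @commg _ ?a ?b => let x := greify l a in let y := greify l b in
      constr:(Gmul (Ginv x) (Gmul (Ginv y) (Gmul x y)))
  | @natexp _ ?a ?n => let x := greify l a in gpow x n
  end end.
Ltac gunfold := rewrite /commute /commg /conjg ?expgS ?expg0.

Ltac gcollect l acc :=
  match goal with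
  | H : commute ?a ?b |- _ =>
      lazymatch gmem a l with true =>
      lazymatch gmem b l with true =>
        let i := gidx a l in let j := gidx b l in
        lazymatch acc with
        | context [pair i j] => fail
        | _ => gcollect l constr:(cons (pair i j) acc)
        end end end
  | _ => acc
  end.

(* Only commutation hypotheses between variables (or opaque terms) are used. *)
Ltac fgroup :=
  gunfold;
  lazymatch goal with |- @eq ?T ?a ?b =>
    let l0 := gatoms (@nil T) a in
    let l := gatoms l0 b in
    let x := greify l a in let y := greify l b in
    let c := gcollect l (@nil (nat * nat)) in
    apply: (@geval_eq _ (nth 1 l) c _ x y);
      [repeat (first [exact: I | (split; [by [] |])]) | vm_compute; reflexivity]
  end.

(* Proves a word equality conjugate to the equality [H] or to its inverse. *)
Ltac gconj H :=
  move: (H); gunfold;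
  lazymatch goal with |- @eq ?T ?c ?d -> ?a = ?b =>
    let l0 := gatoms (@nil T) a in
    let l1 := gatoms l0 b in
    let l2 := gatoms l1 c in
    let l := gatoms l2 d in
    let x := greify l a in let y := greify l b in
    let z := greify l c in let t := greify l d in
    apply: (@conj_testP _ (nth 1 l) z t x y); vm_compute; reflexivity
  end.

(** * Commuting elements *)

Section Commute.

Variable G : groupType.
Implicit Types a b c : G.

Lemma commuteJ a b c : commute a b -> commute a c -> commute a (b ^ c).
Proof. by move=> ab ac; rewrite /conjg; apply: commuteM; [apply: commuteV|apply: commuteM]. Qed.

Lemma commuteR a b c : commute a b -> commute a c -> commute a [~ b, c].
Proof. by move=> ab ac; apply: commuteM; [apply: commuteV|apply: commuteJ]. Qed.

Lemma conj_fix a b : commute a b -> a ^ b = a.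
Proof. by move=> ab; rewrite /conjg ab mulKg. Qed.

Lemma commute_conj a b : a ^ b = a -> commute a b.
Proof. by move=> h; rewrite /commute conjgC h. Qed.

Lemma commute_comm a b : commute a b -> [~ a, b] = 1.
Proof. by move=> h; apply/eqP/commgP. Qed.

Lemma comm_commute a b : [~ a, b] = 1 -> commute a b.
Proof. by move=> h; apply/commgP/eqP. Qed.

Lemma commute_J2 a b c : commute a b -> commute (a ^ c) (b ^ c).
Proof. by rewrite /commute -!conjMg => ->. Qed.

Lemma commute_J2V a b c : commute (a ^ c) (b ^ c) -> commute a b.
Proof. by move/(commute_J2 c^-1); rewrite -!conjgM !mulgV !conjg1. Qed.

End Commute.

Ltac csolve :=
  lazymatch goal with
  | |- commute ?a ?a => exact: commute_refl
  | |- commute ?a ?b =>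
    first [ assumption | apply: commute_sym; assumption
    | lazymatch b with
      | @mul _ _ _ => apply: commuteM; csolve
      | @inv _ _ => apply: commuteV; csolve
      | conjg _ _ => apply: commuteJ; csolve
      | commg _ _ => apply: commuteR; csolve
      | natexp _ _ => apply: commuteX; csolve
      | @monoid.one _ => exact: commute1
      | _ => lazymatch a with
        | @mul _ _ _ => apply: commute_sym; csolve
        | @inv _ _ => apply: commute_sym; csolve
        | conjg _ _ => apply: commute_sym; csolve
        | commg _ _ => apply: commute_sym; csolve
        | natexp _ _ => apply: commute_sym; csolve
        | @monoid.one _ => apply: commute_sym; csolve
        end
      end ]
  end.

Ltac gsub u v H :=
  lazymatch type of H with ?c = ?d =>
  lazymatch goal with |- ?a = ?b =>
    transitivity (u * c * v); [fgroup | rewrite H; fgroup] end end.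

(** * The collection process *)

Section Collection.

Definition crule := (nat * (bool * nat) * gexp)%type.

Definition expand (e : gexp) (b : bool) := gnf [::] e b [::].

Fixpoint crule_find (rs : seq crule) (j : nat) (h : bool * nat) :=
  if rs is r :: rs' then if r.1 == (j, h) then Some r.2 else crule_find rs' j h
  else None.

(** A rule replaces the adjacent letters [l], [h] by [h] followed by the word for [l ^ h]. Arbitrary
    rules need not terminate, so [collect_word] runs on fuel; each step preserves the value, which
    is all that soundness needs. *)
Fixpoint collect_step com rs (s : seq (bool * nat)) : option (seq (bool * nat)) :=
  if s is l :: s1 then
    if s1 is h :: t then
      if (h.1 == ~~ l.1) && (h.2 == l.2) then Some t
      else if crule_find rs l.2 h is Some w then Some (h :: expand w l.1 ++ t)
      else if (h.2 < l.2)%N && gcom com h.2 l.2 then Some (h :: l :: t)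
      else if collect_step com rs s1 is Some s' then Some (l :: s') else None
    else None
  else None.

Fixpoint collect_word n com rs s :=
  if n is n'.+1 then
    if collect_step com rs s is Some s' then collect_word n' com rs s' else s
  else s.

Variables (G : groupType) (env : nat -> G) (com : seq (nat * nat)) (rs : seq crule).

Fixpoint crules_valid (s : seq crule) : Prop :=
  if s is r :: s' then
    conjg (env r.1.1) (glet env r.1.2) = geval env r.2 /\ crules_valid s'
  else True.

Hypotheses (comP : gvalid env com) (rsP : crules_valid rs).

Lemma crule_findP j h w : crule_find rs j h = Some w ->
  env j * glet env h = glet env h * geval env w.
Proof.
elim: rs rsP => //= -[[k l] e] s IH [h1 h2] /=.
by case: eqP => [[<- <-] [<-]|_ /(IH h2) //]; rewrite -h1 -conjgC.
Qed.

Lemma gword_cat s t : gword env (s ++ t) = gword env s * gword env t.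
Proof. by elim: s => [|h s IH] /=; rewrite ?mul1g // IH mulgA. Qed.

Lemma collect_stepP s s' : collect_step com rs s = Some s' -> gword env s' = gword env s.
Proof.
elim: s s' => [|[b j] [|h t] IH] // s'.
rewrite [collect_step _ _ _](_ : _ =
  if (h.1 == ~~ b) && (h.2 == j) then Some t
  else if crule_find rs j h is Some w then Some (h :: expand w b ++ t)
  else if (h.2 < j)%N && gcom com h.2 j then Some (h :: (b, j) :: t)
  else if collect_step com rs (h :: t) is Some s1 then Some ((b, j) :: s1) else None) //.
case: ifP => [/andP[/eqP e1 /eqP e2] [<-]|_].
  case: h e1 e2 {IH} => c i /= -> ->.
  by rewrite /glet /=; case: b; rewrite /= ?mulKg ?mulVKg.
case e: crule_find => [w|].
  case=> <-; rewrite /= gword_cat /expand gnfE //= mulg1 !mulgA.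
  congr (_ * _); rewrite /glet /=; have {e}/= e := crule_findP e.
  move: {IH} b e => [] e //.
  by apply: (mulgI (env j)); rewrite !mulgA mulgV mul1g [X in X / _]e mulgK.
case: ifP => [/andP[_ hc] [<-]|_].
  rewrite /= !mulgA; congr (_ * _).
  have {}hc : commute (env h.2) (env j) := gcomP comP hc.
  rewrite /glet /=; case: b {IH e}; case: h.1; rewrite -/(commute _ _) //.
  - by apply/commute_sym/commuteV/commute_sym/commuteV.
  - exact: commuteV.
  - exact/commute_sym/commuteV/commute_sym.
by case e': collect_step => [u|] // [<-]; rewrite -[LHS]/(glet env (b, j) * gword env u) (IH _ e').
Qed.

Lemma collect_wordP n s : gword env (collect_word n com rs s) = gword env s.
Proof.
elim: n s => //= n IH s; case e: collect_step => [s'|] //.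
by rewrite IH (collect_stepP e).
Qed.

Lemma collect_eq n e1 e2 :
  collect_word n com rs (expand e1 false) = collect_word n com rs (expand e2 false) ->
  geval env e1 = geval env e2.
Proof.
move=> h; have := congr1 (gword env) h.
by rewrite !collect_wordP /expand !gnfE //= !mulg1.
Qed.

End Collection.

Ltac gcollect_rules l acc :=
  match goal with
  | H : conjg ?a ?b = ?W |- _ =>
      lazymatch gmem a l with true =>
        let j := gidx a l in
        let h := lazymatch b with
          | @inv _ ?b' => let i := gidx b' l in constr:((true, i))
          | _ => let i := gidx b l in constr:((false, i)) end in
        lazymatch acc with
        | context [pair (pair j h) _] => fail
        | _ => let w := greify l W in
               gcollect_rules l constr:(cons (pair (pair j h) w) acc)
        end end
  | _ => acc
  end.

(* Decides word equalities by collection: an atom [a] is moved to the right of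
   [b] (or of [b^-1]) by the hypotheses [a ^ b = _] (or [a ^ b^-1 = _]) of the
   context, and commuting atoms are sorted in the order of the list [l]. *)
Ltac gcollection l :=
  gunfold;
  lazymatch goal with |- @eq ?T ?a ?b =>
    let x := greify l a in let y := greify l b in
    let c := gcollect l (@nil (nat * nat)) in
    let r := gcollect_rules l (@nil (nat * (bool * nat) * gexp)) in
    apply: (@collect_eq _ (nth 1 l) c r _ _ 5000 x y);
      [repeat (first [exact: I | (split; [by [] |])])
      |repeat (first [exact: I | (split; [by [] |])])
      | vm_compute; reflexivity]
  end.
Tactic Notation "gcol" constr(l) := gcollection l.

Tactic Notation "gsubc" constr(l) constr(u) constr(v) constr(H) :=
  lazymatch type of H with ?c = ?d =>
  lazymatch goal with |- ?a = ?b =>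
    transitivity (u * c * v); [gcol l | rewrite H; gcol l] end end.

Lemma conj_inv_tail (G : groupType) (a b c : G) :
  a ^ b = a * c -> commute c a -> commute c b -> a ^ b^-1 = a * c^-1.
Proof.
move=> h ca cb; have -> : a ^ b^-1 = (a * c) ^ b^-1 * c^-1 by clear h; fgroup.
by rewrite -h; fgroup.
Qed.

Definition abelian_normal (G : groupType) (V : G -> Prop) :=
  [/\ V 1, forall x y, V x -> V y -> V (x * y), forall x, V x -> V x^-1,
      forall x g, V x -> V (x ^ g) & forall x y, V x -> V y -> commute x y].

(** * Words in an abelian normal subgroup with operators *)

Section ModuleReflection.

Inductive vexp :=
  Vvar of nat | Vone | Vmul of vexp & vexp | Vinv of vexp | Vconj of vexp & gexp.

(** A signed monomial of the module: generator number, conjugating word, and [true] for the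
    inverse. *)
Definition vitem := (bool * (nat * seq (bool * nat)))%type.
Definition vrule := (nat * (bool * nat) * vexp)%type.

Fixpoint vflat (e : vexp) (b : bool) (w : seq (bool * nat)) : seq vitem :=
  match e with
  | Vvar i => [:: (b, (i, w))]
  | Vone => [::]
  | Vmul e1 e2 => vflat e1 b w ++ vflat e2 b w
  | Vinv e1 => vflat e1 (~~ b) w
  | Vconj e1 g => vflat e1 b (gnf [::] g false w)
  end.

Fixpoint vrule_find (rs : seq vrule) (i : nat) (h : bool * nat) :=
  if rs is r :: rs' then if r.1 == (i, h) then Some r.2 else vrule_find rs' i h
  else None.

(** Only the first letter of the collected operator word meets the generator. A module rule is
    applied there, and the remaining letters act on its result. *)
Fixpoint vreduce n k com rs vrs (it : vitem) : seq vitem :=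
  let: (b, (i, w)) := it in
  let w' := collect_word k com rs w in
  if n is n'.+1 then
    if w' is h :: t then
      if vrule_find vrs i h is Some e then
        flatten [seq vreduce n' k com rs vrs it' | it' <- vflat e b t]
      else [:: (b, (i, w'))]
    else [:: (b, (i, w'))]
  else [:: (b, (i, w'))].

Fixpoint vcancel (it : vitem) (s : seq vitem) : seq vitem :=
  if s is h :: t then
    if (h.1 == ~~ it.1) && (h.2 == it.2) then t else h :: vcancel it t
  else [:: it].

Variables (G : groupType) (V : G -> Prop) (env venv : nat -> G).
Variables (com : seq (nat * nat)) (rs : seq crule) (vrs : seq vrule).

Fixpoint veval (e : vexp) : G :=
  match e with
  | Vvar i => venv i
  | Vone => 1
  | Vmul e1 e2 => veval e1 * veval e2
  | Vinv e1 => (veval e1)^-1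
  | Vconj e1 g => veval e1 ^ geval env g
  end.

Fixpoint vrules_valid (s : seq vrule) : Prop :=
  if s is r :: s' then
    conjg (venv r.1.1) (glet env r.1.2) = veval r.2 /\ vrules_valid s'
  else True.

Hypotheses (VP : abelian_normal V) (comP : gvalid env com) (rsP : crules_valid env rs).
Hypotheses (vrsP : vrules_valid vrs) (venvP : forall i, V (venv i)).

Definition vival (it : vitem) : G :=
  let u := venv it.2.1 ^ gword env it.2.2 in if it.1 then u^-1 else u.

Fixpoint vprod (s : seq vitem) : G := if s is h :: t then vival h * vprod t else 1.

Let V1 : V 1. Proof. by case: VP. Qed.
Let VM x y : V x -> V y -> V (x * y). Proof. by case: VP => _ h _ _ _; apply: h. Qed.
Let VV x : V x -> V x^-1. Proof. by case: VP => _ _ h _ _; apply: h. Qed.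
Let VJ x g : V x -> V (x ^ g). Proof. by case: VP => _ _ _ h _; apply: h. Qed.
Let VC x y : V x -> V y -> commute x y. Proof. by case: VP => _ _ _ _; apply. Qed.

Lemma vivalP it : V (vival it).
Proof. by case: it => -[] [i w]; rewrite /vival /=; [apply: VV|]; apply: VJ. Qed.

Lemma vevalP e : V (veval e).
Proof.
by elim: e => [i||e1 IH1 e2 IH2|e IH|e IH g] //=; [apply: VM|apply: VV|apply: VJ].
Qed.

Lemma vprod_cat s t : vprod (s ++ t) = vprod s * vprod t.
Proof. by elim: s => [|h s IH] /=; rewrite ?mul1g // IH mulgA. Qed.

Lemma vflatE e b w :
  vprod (vflat e b w) = (if b then (veval e ^ gword env w)^-1 else veval e ^ gword env w).
Proof.
elim: e b w => [i||e1 IH1 e2 IH2|e IH|e IH g] b w /=.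
- by rewrite mulg1.
- by rewrite conj1g invg1 if_same.
- rewrite vprod_cat IH1 IH2 conjMg; case: b => //; rewrite [RHS]invgM.
  exact: (VC (VV (VJ _ (vevalP e1))) (VV (VJ _ (vevalP e2)))).
- by rewrite IH conjVg invgK; case: b.
- by rewrite IH gnfE // conjgM.
Qed.

Lemma vrule_findP i h e : vrule_find vrs i h = Some e -> venv i ^ glet env h = veval e.
Proof.
elim: vrs vrsP => //= -[[k l] f] s IH [h1 h2] /=.
by case: eqP => [[<- <-] [<-]|_ /(IH h2) //].
Qed.

Lemma vreduceE n k it : vprod (vreduce n k com rs vrs it) = vival it.
Proof.
elim: n it => [|n IH] [b [i w]] /=.
  by rewrite mulg1 /vival /= (collect_wordP comP rsP).
rewrite [in RHS]/vival /= -(collect_wordP comP rsP k w).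
case: collect_word => [|h t]; first by rewrite /= mulg1.
case e: vrule_find => [f|]; last by rewrite /= mulg1.
have {e}e := vrule_findP e.
have -> s : vprod (flatten [seq vreduce n k com rs vrs it | it <- s]) = vprod s.
  by elim: s => //= it s IHs; rewrite vprod_cat IH IHs.
by rewrite vflatE /= -e -conjgM.
Qed.

Lemma vcancelE it s : vprod (vcancel it s) = vival it * vprod s.
Proof.
elim: s => [|h s IH] //=; case: ifP => [/andP[/eqP h1 /eqP h2]|_] /=.
  case: it h h1 h2 {IH} => b p [b' p'] /= -> ->; rewrite mulgA.
  by case: b; rewrite /vival /= ?mulVg ?mulgV mul1g.
by rewrite IH !mulgA; congr (_ * _); exact: (VC (vivalP _) (vivalP _)).
Qed.

Lemma vexp_eq n k e1 e2 :
  foldr vcancel [::] (flatten [seq vreduce n k com rs vrs it | it <- vflat (Vmul e1 (Vinv e2)) false [::]])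
    = [::] -> veval e1 = veval e2.
Proof.
set s := vflat _ _ _ => h; have := congr1 vprod h.
have -> t : vprod (foldr vcancel [::] t) = vprod t.
  by elim: t => //= it t IH; rewrite vcancelE IH.
have -> : vprod (flatten [seq vreduce n k com rs vrs it | it <- s]) = vprod s.
  by elim: (s) => //= it t IH; rewrite vprod_cat vreduceE IH.
by rewrite /s vflatE /= conjg1 => /divg1_eq.
Qed.

End ModuleReflection.

Fixpoint vall (G : groupType) (V : G -> Prop) (l : seq G) : Prop :=
  if l is x :: l' then V x /\ vall V l' else True.

Lemma vall_nth (G : groupType) (V : G -> Prop) (l : seq G) i :
  abelian_normal V -> vall V l -> V (nth 1 l i).
Proof.
move=> [V1 _ _ _ _]; elim: l i => [|x l IH] [|i] //= [] // _; exact: IH.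
Qed.

Ltac vpow x n :=
  lazymatch n with
  | O => constr:(Vone) | S O => x
  | S ?m => let y := vpow x m in constr:(Vmul x y) end.
Ltac vreify vl l e :=
  lazymatch gmem e vl with
  | true => let n := gidx e vl in constr:(Vvar n)
  | false =>
  lazymatch e with
  | @mul _ ?a ?b => let x := vreify vl l a in let y := vreify vl l b in constr:(Vmul x y)
  | @inv _ ?a => let x := vreify vl l a in constr:(Vinv x)
  | @monoid.one _ => constr:(Vone)
  | @conjg _ ?a ?b => let x := vreify vl l a in let y := greify l b in constr:(Vconj x y)
  | @commg _ ?a ?b => let x := vreify vl l a in let y := greify l b in
      constr:(Vmul (Vinv x) (Vconj x y))
  | @natexp _ ?a ?n => let x := vreify vl l a in vpow x n
  end end.
Ltac vcollect_rules vl l acc :=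
  match goal with
  | H : conjg ?a ?b = ?W |- _ =>
      lazymatch gmem a vl with true =>
        let j := gidx a vl in
        let h := lazymatch b with
          | @inv _ ?b' => let i := gidx b' l in constr:((true, i))
          | _ => let i := gidx b l in constr:((false, i)) end in
        lazymatch acc with
        | context [pair (pair j h) _] => fail
        | _ => let w := vreify vl l W in
               vcollect_rules vl l constr:(cons (pair (pair j h) w) acc)
        end end
  | _ => acc
  end.

(* Decides word equalities between products of conjugates of the elements [vl]
   of an abelian normal subgroup by the other letters [l]. *)
Ltac gmodule vl l :=
  lazymatch goal with |- @eq ?T ?a ?b =>
    let x := vreify vl l a in let y := vreify vl l b in
    let c := gcollect l (@nil (nat * nat)) in
    let r := gcollect_rules l (@nil (nat * (bool * nat) * gexp)) in
    let vr := vcollect_rules vl l (@nil (nat * (bool * nat) * vexp)) in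
    match goal with HV : abelian_normal ?V |- _ =>
    apply: (@vexp_eq _ V (nth 1 l) (nth 1 vl) c r vr HV _ _ _ _ 100 1000 x y);
      [repeat (first [exact: I | (split; [by [] |])])
      |repeat (first [exact: I | (split; [by [] |])])
      |repeat (first [exact: I | (split; [by [] |])])
      |let i := fresh "i" in move=> i; apply: (vall_nth i HV); repeat (first [exact: I | (split; [by [] |])])
      |vm_compute; reflexivity] end
  end.
Tactic Notation "gmod" constr(vl) constr(l) := gmodule vl l.

(** * The lower central series *)

Section LowerCentral.

Local Open Scope classical_set_scope.

Variable G : groupType.
Implicit Types (a b g x y z : G) (H : set G).

Lemma is_subgroupP H :
  is_subgroup H <-> [/\ H 1, forall x y, H x -> H y -> H (x * y) & forall x, H x -> H x^-1].
Proof.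
have inH x : (x \in [in H]) = `[< H x >] by [].
split=> [[h1 hV]|[h1 hM hV]].
  have H1 : H 1 by move: h1; rewrite inH => /asboolP.
  have HV x : H x -> H x^-1.
    by move=> Hx; have := hV 1 x; rewrite !inH mul1g => h; apply/asboolP/h; apply/asboolP.
  split=> // x y Hx Hy; have := hV x y^-1.
  by rewrite !inH invgK => h; apply/asboolP/h; apply/asboolP => //; apply: HV.
split=> [|x y]; rewrite ?inH; first exact/asboolP.
by move=> /asboolP Hx /asboolP Hy; apply/asboolP/hM => //; apply: hV.
Qed.

Lemma generated_subgroupP (A : set G) x : generated_subgroup A x <->
  forall H, is_subgroup H -> A `<=` H -> H x.
Proof. by split=> [h H sH AH|h H [sH AH]]; [apply: h|apply: h]. Qed.

Lemma generated_subgroup_is_subgroup (A : set G) : is_subgroup (generated_subgroup A).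
Proof.
apply/is_subgroupP; split.
- by apply/generated_subgroupP => H /is_subgroupP[].
- move=> x y /generated_subgroupP hx /generated_subgroupP hy.
  apply/generated_subgroupP => H sH AH; have [_ hM _] := (is_subgroupP H).1 sH.
  by apply: hM; [apply: hx|apply: hy].
- move=> x /generated_subgroupP hx.
  apply/generated_subgroupP => H sH AH; have [_ _ hV] := (is_subgroupP H).1 sH.
  by apply: hV; apply: hx.
Qed.

Lemma sub_generated_subgroup (A : set G) : A `<=` generated_subgroup A.
Proof. by move=> x Ax; apply/generated_subgroupP => H _; apply. Qed.

Notation gam := (lower_central_term G).

Lemma lctS n x : gam n.+2 x -> forall H, is_subgroup H ->
  (forall a b, gam n.+1 a -> H [~ a, b]) -> H x.
Proof.
move=> /generated_subgroupP h H sH hH; apply: h => // _ [a ga [b _ ->]]; exact: hH.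
Qed.

Lemma lct_comm1 n a b : gam n.+1 a -> gam n.+2 [~ a, b].
Proof. by move=> ga; apply: sub_generated_subgroup; exists a => //; exists b. Qed.

Lemma lct_subgroup n : is_subgroup (gam n).
Proof.
by case: n => [|[|n]]; try exact: generated_subgroup_is_subgroup; apply/is_subgroupP.
Qed.

Lemma lct1 n : gam n 1.
Proof. by have [] := (is_subgroupP _).1 (lct_subgroup n). Qed.

Lemma lctM n x y : gam n x -> gam n y -> gam n (x * y).
Proof. by have [_ h _] := (is_subgroupP _).1 (lct_subgroup n); apply: h. Qed.

Lemma lctV n x : gam n x -> gam n x^-1.
Proof. by have [_ _ h] := (is_subgroupP _).1 (lct_subgroup n); apply: h. Qed.

Lemma lctJ n x g : gam n x -> gam n (x ^ g).
Proof.
elim: n x g => [|[|n] IH] x g // hx.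
pose H := [set z | gam n.+2 (z ^ g)].
suff: H x by [].
apply: (lctS hx) => [|a b ga].
  apply/is_subgroupP; split; rewrite /H /=.
  - by rewrite conj1g; apply: lct1.
  - by move=> u v hu hv; rewrite conjMg; apply: lctM.
  - by move=> u hu; rewrite conjVg; apply: lctV.
by rewrite /H; change (gam n.+2 ([~ a, b] ^ g)); rewrite conjRg; exact: (lct_comm1 _ (IH _ _ ga)).
Qed.

Lemma lct_decr n x : gam n.+1 x -> gam n x.
Proof.
case: n => [|n] //; elim: n x => [|n IH] x // hx.
apply: (lctS hx (@lct_subgroup _)) => a b ga; apply: lctM; first exact: lctV.
exact: lctJ.
Qed.

Lemma lct_le m n x : (m <= n)%N -> gam n x -> gam m x.
Proof. by move/subnK <-; elim: (n - m)%N => //= k IH /lct_decr. Qed.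

(** Induction on [j] by the Hall-Witt identity, which trades [[~ a, [~ b, g]]] for commutators whose
    last entry is [b] or [g^-1]; in one of them the weight of the first entry has grown, so [i] must
    stay general. *)
Lemma lct_commS i j a b : gam i.+1 a -> gam j.+1 b -> gam (i + j).+2 [~ a, b].
Proof.
elim: j i a b => [|j IH] i a b ga gb; first by rewrite addn0; apply: lct_comm1.
pose H := [set z | forall i a, gam i.+1 a -> gam (i + j.+1).+2 [~ a, z]].
suff hb: H b by apply: hb.
apply: (lctS gb) => [|{gb}{}b g gb {ga}{}i {}a ga].
  apply/is_subgroupP; split; rewrite /H /=.
  - by move=> k c _; rewrite commg1; apply: lct1.
  - move=> u v hu hv k c gc.
    have -> : [~ c, u * v] = [~ c, v] * [~ c, u] ^ v by fgroup.
    by apply: lctM; [apply: hv|apply: lctJ; apply: hu].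
  - move=> u hu k c gc.
    have -> : [~ c, u^-1] = ([~ c, u]^-1) ^ u^-1 by fgroup.
    by apply: lctJ; apply: lctV; apply: hu.
have -> : [~ a, [~ b, g]] =
    ([~ g^-1, a^-1, b] ^ a * [~ a, b^-1, g^-1] ^ b) ^ g by fgroup.
apply: lctJ; apply: lctM; apply: lctJ.
  rewrite addnS -addSn; apply: IH => //.
  have -> : [~ g^-1, a^-1] = ([~ a, g] ^ (a^-1 * g^-1))^-1 by fgroup.
  by apply: lctV; apply: lctJ; apply: lct_comm1.
by rewrite addnS; apply: lct_comm1; apply: IH => //; apply: lctV.
Qed.

Lemma lct_comm i j a b : (0 < i)%N -> (0 < j)%N ->
  gam i a -> gam j b -> gam (i + j) [~ a, b].
Proof. by case: i j => [|i] [|j] // _ _; rewrite addSn addnS; apply: lct_commS. Qed.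

End LowerCentral.

(** * Conjugates of a right 3-Engel element *)

Section RightEngel.

Variable G : groupType.
Implicit Types a b p r s t x y g h : G.

Definition R3 p := forall g, commute [~ p, g, g] g.

Lemma R3_conj p h : R3 p -> R3 (p ^ h).
Proof.
move=> Rp g; have := commute_J2 h (Rp (g ^ h^-1)).
by rewrite !conjRg -!conjgM mulVg !conjg1.
Qed.

Lemma R3_chain r g p y : R3 r -> p = r ^ g -> y = p ^ g ->
  y ^ g = y * p^-1 * y * p^-1 * r * p^-1 * y.
Proof. by move=> Rr -> ->; have h := Rr g; gconj h. Qed.

Lemma R3_twist p x t : R3 p -> commute p t ->
  (p^-1 * p ^ x * p^-1 * p ^ x^-1 * p^-1) ^ (t ^ x)
  = p^-1 * p ^ x * p^-1 * (p ^ x^-1) ^ t^-1 * p^-1.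
Proof.
move=> Rp pt; set r := p ^ x^-1; set y := p ^ x.
have Rr : R3 r by apply: R3_conj.
have erp : p = r ^ x by rewrite /r -conjgM mulVg conjg1.
have h1 : y ^ x = y * p^-1 * y * p^-1 * r * p^-1 * y := R3_chain Rr erp erefl.
have e2 : p = r ^ (x * t) by rewrite conjgM -erp conj_fix.
have e3 : y ^ t = p ^ (x * t) by rewrite conjgM.
have h2 := R3_chain Rr e2 e3.
have yt : commute y (t ^ x) by apply: commute_J2.
have h3 : (y ^ x) ^ (t ^ x) = y * p^-1 * y * p^-1 * r ^ t^-1 * p^-1 * y.
  have -> : (y ^ x) ^ (t ^ x) = ((y ^ t) ^ (x * t)) ^ t^-1 by fgroup.
  rewrite h2; clear -pt; fgroup.
rewrite h1 in h3.
have -> : p^-1 * y * p^-1 * r * p^-1 = y^-1 * (y * p^-1 * y * p^-1 * r * p^-1 * y) * y^-1.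
  by fgroup.
rewrite conjMg conjMg h3; move: (t ^ x) yt => T yt; fgroup.
Qed.

(* Comparing three instances of [R3_twist]. *)
Lemma R3_commute_twist p x s t : R3 p -> commute p s -> commute p t -> commute s t ->
  commute [~ p ^ x^-1 * p^-1, t^-1] (s ^ x * s).
Proof.
move=> Rp ps pt st.
have h1 := R3_twist x Rp ps; have h2 := R3_twist x Rp pt.
have pts : commute p (t * s) by csolve.
have h3 := R3_twist x Rp pts.
have h4 := congr1 (fun z => z ^ (s ^ x)) h2.
rewrite -conjgM -conjMg h3 in h4.
set M := p^-1 * p ^ x * p^-1 in h1 h2 h3 h4.
have e1 : M ^ (s ^ x) = M * (p ^ x^-1) ^ s^-1 * p^-1 * ((p ^ x^-1 * p^-1)^-1) ^ (s^x).
  rewrite -h1; clear; fgroup.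
have e2 : M ^ (s ^ x) = M * (p ^ x^-1) ^ (t * s)^-1 * p^-1 * (((p ^ x^-1) ^ t^-1 * p^-1)^-1) ^ (s ^ x).
  rewrite h4; clear; fgroup.
rewrite e1 in e2 => {e1 h1 h2 h3 h4}.
move: (M) e2 => M'; move: (s ^ x) => S; move: (p ^ x^-1) => r e2.
have e3 : p * (r ^ s^-1)^-1 * r ^ (t * s)^-1 * p^-1
   = ((r * p^-1)^-1) ^ S * (r ^ t^-1 * p^-1) ^ S.
  have -> : p * (r ^ s^-1)^-1 * r ^ (t * s)^-1 * p^-1 = 
    (M' * r ^ s^-1 * p^-1)^-1 * (M' * r ^ (t * s)^-1 * p^-1 * ((r ^ t^-1 * p^-1)^-1) ^ S) * (r ^ t^-1 * p^-1) ^ S by clear; fgroup.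
  rewrite -e2; clear; fgroup.
apply: commute_conj; rewrite conjgM.
have -> : [~ r * p^-1, t^-1] ^ S = ((r * p^-1)^-1) ^ S * (r ^ t^-1 * p^-1) ^ S.
  clear -pt; fgroup.
rewrite -e3; clear -ps pt st; fgroup.
Qed.

(** Replacing [x] by [x * p^-1] leaves [p ^ x^-1] unchanged; with [t = p^-1] the commutator of
    [R3_commute_twist] then becomes a conjugate of the one wanted. *)
Lemma R3_commute p x s : R3 p -> commute p s -> commute [~ p ^ x^-1, p] (s ^ x * s).
Proof.
move=> Rp ps.
have h := @R3_commute_twist p (x * p^-1) s p^-1 Rp ps.
have {}h := h (commuteV (commute_refl p)) (commuteV (commute_sym ps)).
have {h} := commute_J2 p h.
have -> : [~ p ^ (x * p^-1)^-1 * p^-1, p^-1^-1] ^ p = [~ p ^ x^-1, p] by fgroup.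
by have -> : (s ^ (x * p^-1) * s) ^ p = s ^ x * s by clear -ps; fgroup.
Qed.

(* The case [t = p] of [R3_twist], shifted by one conjugation by [p ^ x]. *)
Lemma R3_square p x t : R3 p -> commute p t ->
  ((p ^ x * p^-1) * (p ^ x^-1 * p^-1) ^ t * (p ^ x * p^-1)) ^ p
  = (p ^ x * p^-1) * (p ^ x * p^-1) * (p ^ x^-1 * p^-1) ^ (p^-1 * t).
Proof.
move=> Rp pt; have pt' : commute p (t^-1) by csolve.
have h1 := R3_twist x Rp pt'.
have pt2 : commute p (t^-1 * p) by csolve.
have := R3_twist x Rp pt2.
rewrite (conjMg t^-1 p x) conjgM h1 invgK (invgM t^-1) invgK.
have e u : commute p u -> (p ^ x^-1 * p^-1) ^ u = (p ^ x^-1) ^ u * p^-1.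
  by move=> pu; rewrite conjMg (conj_fix (a := p^-1)) //; csolve.
rewrite !e //; last by csolve.
move: (p ^ x^-1) (p ^ x) => r y h; gconj h.
Qed.

Lemma R3_pair1 p b : R3 b -> commute [~ p, p ^ b] p.
Proof. by move=> Rb; have h := Rb p^-1; gconj h. Qed.

Lemma R3_pair2 p b : R3 p -> R3 b -> commute [~ p, p ^ b] (p ^ b^-1).
Proof.
move=> Rp Rb; have tp := R3_pair1 p Rb.
have := @R3_commute p b^-1 p Rp (commute_refl p); rewrite invgK => h.
have -> : p ^ b^-1 = (p ^ b^-1 * p) * p^-1 by fgroup.
apply: commuteM; last by csolve.
have -> : [~ p, p ^ b] = [~ p ^ b, p]^-1 by fgroup.
exact/commute_sym/commuteV/commute_sym.
Qed.

Lemma R3_next p x : R3 p ->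
  (p ^ x * p^-1) ^ x = (p ^ x * p^-1) * (p ^ x * p^-1) * (p ^ x^-1 * p^-1).
Proof.
move=> Rp; have erp : p = (p ^ x^-1) ^ x by rewrite -conjgM mulVg conjg1.
have h : (p ^ x) ^ x = _ := R3_chain (R3_conj x^-1 Rp) erp erefl.
by rewrite conjMg conjVg h; fgroup.
Qed.

(** Conjugation by [b] trivially maps [[~ p ^ b^-1, p]] to [[~ p, p ^ b]]. The content is that it
    also maps back, so that [b] merely swaps the two. *)
Lemma R3_pair3 p b : R3 p -> R3 b ->
  [~ p, p ^ b] ^ b = [~ p ^ b^-1, p] /\ commute [~ p ^ b^-1, p] p.
Proof.
move=> Rp Rb; have tp := R3_pair1 p Rb.
have h1 := R3_square b Rp (commute1 p); rewrite mulg1 conjg1 in h1.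
have h2 := R3_next b Rp.
set P := p ^ b in tp h1 h2 *; set r := p ^ b^-1 in h1 h2 *.
(* This is the claim up to conjugation by [p * p]. Using [b * (p * p)] in [R3_commute] shows next
   that both sides commute with [p], which removes the discrepancy. *)
have e1 : [~ p, P] ^ b = [~ r, p] ^ (p^-1 * p^-1).
  have -> : [~ p, P] ^ b = (((P * p^-1) ^ p)^-1 * (P * p^-1)) ^ b.
    by rewrite -[[~ p, P]](conj_fix (commuteV tp)); fgroup.
  rewrite conjMg conjVg h2.
  have -> : ((P * p^-1) ^ p) ^ b = ((P * p^-1) ^ b) ^ P by rewrite /P; fgroup.
  rewrite h2.
  have -> : (P * p^-1 * (P * p^-1) * (r * p^-1)) ^ P = (P * p^-1 * (r * p^-1) * (P * p^-1)) ^ p by fgroup.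
  by rewrite h1; fgroup.
have h3 : commute [~ r, p] (P ^ (p * p) * p).
  have := R3_commute (b * (p * p)) Rp (commute_refl p).
  have -> : p ^ (b * (p * p))^-1 = r by rewrite /r; fgroup.
  by rewrite conjgM.
have h4 := commute_J2 (p^-1 * p^-1) h3; rewrite -e1 in h4.
have h5 : commute ([~ p, P] ^ b) P by apply: commute_J2.
have h6 : commute ([~ p, P] ^ b) p.
  have e : p = P^-1 * (P ^ (p * p) * p) ^ (p^-1 * p^-1) by clear; fgroup.
  by rewrite [X in commute _ X]e; apply: commuteM; [apply: commuteV|].
have h7 : commute [~ r, p] p.
  by apply: (@commute_J2V _ _ _ (p^-1 * p^-1)); rewrite -e1; have -> : p ^ (p^-1 * p^-1) = p by fgroup.
by split=> //; rewrite e1 conj_fix //; csolve.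
Qed.

(* [R3_square] for [b] and for [b^-1] computes the commutator of [p ^ b * p^-1]
   and [p ^ b^-1 * p^-1] in two ways. *)
Lemma R3_pair4 p b : R3 p -> R3 b ->
  let t := [~ p, p ^ b] in let D := [~ p ^ b^-1, p] in
  [/\ D = t ^ b, t = D ^ b, commute t p, commute D p & (t^-1 * D) ^+ 4 = 1].
Proof.
move=> Rp Rb t D; have tp : commute t p := R3_pair1 p Rb.
have tr : commute t (p ^ b^-1) := R3_pair2 Rp Rb.
have [eDt Dp] := R3_pair3 Rp Rb; rewrite -/t -/D in eDt Dp.
have etD : t = D ^ b by rewrite /D conjRg -conjgM mulVg conjg1.
have tP : commute t (p ^ b) by rewrite etD; apply: commute_J2.
have Dr : commute D (p ^ b^-1).
  by apply: (@commute_J2V _ _ _ b); rewrite -etD -conjgM mulVg conjg1.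
have DP : commute D (p ^ b) by rewrite -eDt; apply: commute_J2.
split=> //.
have h1 := R3_square b Rp (commute1 p).
have h2 := R3_square b^-1 Rp (commute1 p).
rewrite invgK in h2; rewrite !mulg1 !conjg1 in h1 h2.
have tD : commute t D by rewrite /D; csolve.
move: (erefl t) (erefl D); rewrite {2}/t {2}/D.
move: (p ^ b) (p ^ b^-1) t D {eDt etD} => P r t D in tp tr Dp Dr tP DP h1 h2 tD *.
move=> et eD.
have {}h1 : P * t^-1 * p^-1 * (r * D * p^-1) * (P * t^-1 * p^-1)
    = P * p^-1 * (P * p^-1) * (r * D^-1 * p^-1).
  transitivity ((P * p^-1 * (r * p^-1) * (P * p^-1)) ^ p).
    by rewrite et eD; clear; fgroup.
  rewrite h1; congr (_ * _); transitivity (r * D ^- 1 * p^-1) => //.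
  rewrite -[D](conj_fix (commuteV Dp)) eD; clear; fgroup.
have {}h2 : r * D * p^-1 * (P * t^-1 * p^-1) * (r * D * p^-1)
    = r * p^-1 * (r * p^-1) * (P * t * p^-1).
  transitivity ((r * p^-1 * (P * p^-1) * (r * p^-1)) ^ p).
    by rewrite et eD; clear; fgroup.
  rewrite h2; congr (_ * _).
  rewrite -[in RHS](conj_fix (commuteV tp)) et; clear; fgroup.
(* Multiplication by [D * D * t^-1 * t^-1] exchanges [r * p^-1 * P] and [P * p^-1 * r], so the
   square of that factor is trivial. *)
have g1 : r * p^-1 * P * D * D * t^-1 * t^-1 = P * p^-1 * r.
  clear h2 et eD; gsub ((P * p^-1)^-1) (p * D) h1.
have g2 : P * p^-1 * r * D * D * t^-1 * t^-1 = r * p^-1 * P.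
  clear h1 g1 et eD; gsub ((r * p^-1)^-1) (p * t^-1) h2.
clear h1 h2 et eD.
transitivity ((P * p^-1 * r)^-1 * (P * p^-1 * r * D * D * t^-1 * t^-1) * D * D * t^-1 * t^-1).
  by fgroup.
by rewrite g2; transitivity ((P * p^-1 * r)^-1 * (r * p^-1 * P * D * D * t^-1 * t^-1));
  [|rewrite g1]; fgroup.
Qed.

End RightEngel.

(** * Three consecutive conjugates of a right 3-Engel element *)

Section TorsionFree.

Variable G : groupType.
Implicit Types a b p r s t x y g h : G.
Notation gam := (lower_central_term G).
Hypothesis TF : forall x, gam 5 x -> x * x = 1 -> x = 1.

Lemma TF4 x : gam 5 x -> x ^+ 4 = 1 -> x = 1.
Proof.
move=> gx x4; apply: TF => //; apply: TF; first exact: lctM.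
by rewrite -x4; fgroup.
Qed.

Lemma TF8 x : gam 5 x -> x ^+ 8 = 1 -> x = 1.
Proof.
move=> gx x8; apply: TF4 => //; apply: TF.
  by rewrite !expgS expg0; do !apply: lctM => //; apply: lct1.
by rewrite -x8; fgroup.
Qed.

Lemma R3_pair_commute p b : R3 p -> R3 b -> gam 4 [~ p, p ^ b] ->
  commute [~ p, p ^ b] b.
Proof.
move=> Rp Rb g4; have [e1 e2 tp Dp h4] := R3_pair4 Rp Rb.
have h5 : [~ [~ p, p ^ b], b] = 1.
  apply: TF4; first exact: lct_comm1.
  by rewrite /commg -/([~ p, p^b]) -e1.
exact: comm_commute.
Qed.

Lemma lct_conj2 p g : gam 3 [~ p, p ^ g].
Proof.
have -> : [~ p, p ^ g] = [~ p, [~ p, g]] by fgroup.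
by apply: (@lct_comm G 1 2) => //; apply: lct_comm1.
Qed.

(** The conjugate [p ^ g] is itself right 3-Engel and can serve as [b] in [R3_pair_commute]: the
    commutator occurring there is the inverse of [[~ [~ p, p ^ g], p]], which has weight 4. *)
Lemma R3_conj_class3 p g : R3 p ->
  commute [~ [~ p, p ^ g], p] p /\ commute [~ [~ p, p ^ g], p] (p ^ g).
Proof.
move=> Rp; have Rq := R3_conj g Rp.
have e : [~ p, p ^ (p ^ g)] = [~ [~ p, p ^ g], p]^-1.
  by move: (p ^ g) => q; fgroup.
have h4 : gam 4 [~ p, p ^ (p ^ g)].
  by rewrite e; apply: lctV; apply: lct_comm1; apply: lct_conj2.
have h1 := R3_pair_commute Rp Rq h4; have h2 := R3_pair1 p Rq.
by rewrite e in h1 h2; split; rewrite -[[~ _, p]]invgK; apply/commute_sym/commuteV/commute_sym.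
Qed.

Lemma R3_triple p x (r := p ^ x^-1) (y := p ^ x) (D := [~ r, p]) : R3 p ->
  [/\ commute [~ D, p] r /\ commute [~ D, p] p, commute [~ D, p] y,
     commute [~ D, r] r /\ commute [~ D, r] p, commute D (y * p) & D ^ x = [~ p, y]].
Proof.
move=> Rp.
have erp : r ^ x = p by rewrite /r -conjgM mulVg conjg1.
have Dk s : commute p s -> commute D (s ^ x * s) by apply: R3_commute.
have [hp hr] := R3_conj_class3 x^-1 Rp; rewrite -/r in hp hr.
have [hr' hp'] := R3_conj_class3 x (R3_conj x^-1 Rp); rewrite -/r erp -/D in hr' hp'.
have eD : [~ D, p] = [~ p, r, p]^-1.
  have h : commute [~ p, r, p] [~ p, r] by csolve.
  have -> : D = [~ p, r]^-1 by rewrite /D; fgroup.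
  by move: [~ p, r] h => c h; rewrite -[RHS](conj_fix (b := c^-1)); [fgroup|csolve].
have Dr : commute [~ D, p] r by rewrite eD; csolve.
have Dp : commute [~ D, p] p by rewrite eD; csolve.
have Dyp := Dk p (commute_refl p); rewrite -/y in Dyp.
split=> //; last by rewrite /D conjRg erp.
(* Passing from [x] to [x * p] keeps [D] but changes [y] to [y ^ p]. Comparing the two commutation
   relations isolates [[~ D, p]]. *)
have := @R3_commute G p (x * p) p Rp (commute_refl p).
have -> : p ^ (x * p)^-1 = r by rewrite /r; fgroup.
rewrite conjgM -/y -/D => h.
have h2 := commute_J2 p^-1 h.
have e3 : D ^ p^-1 = D * [~ D, p]^-1.
  by rewrite -[[~ D, p]^-1](conj_fix (b := p^-1)); [move: (D); clear; move=> d; fgroup|csolve].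
have e4 : (y ^ p * p) ^ p^-1 = y * p by clear; fgroup.
rewrite e3 e4 in h2.
have h5 : commute [~ D, p] (y * p).
  have -> : [~ D, p] = (D * [~ D, p]^-1)^-1 * D by move: [~ D, p]; clear; move: (D) => d e; fgroup.
  apply: commute_sym; apply: commuteM; last exact: commute_sym.
  by apply: commuteV; apply: commute_sym.
have -> : y = y * p * p^-1 by fgroup.
by apply: commuteM => //; csolve.
Qed.

Lemma comm_flip_left p y : commute [~ y, p, p] y -> commute [~ y, p, p] p ->
  [~ [~ p, y], p] = [~ y, p, p]^-1.
Proof.
move=> h1 h2; have h : commute [~ y, p, p] [~ y, p] by csolve.
have -> : [~ p, y] = [~ y, p]^-1 by clear; fgroup.
move: [~ y, p] h => c h.
have {}h : commute [~ c, p]^-1 c^-1 by csolve.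
by rewrite -[RHS](conj_fix h); clear; fgroup.
Qed.

(** Up to inversion, [[~ D, r]] is the conjugate by [x^-1] of [[~ y, p, p]], which commutes with
    [r], [p] and [y] by [R3_triple] for [x^-1]. So it commutes with [r ^ x^-1], [r] and [p], and
    [R3_chain] makes [y] a word in these. *)
Lemma R3_triple_sym p x (r := p ^ x^-1) (y := p ^ x) (D := [~ r, p]) : R3 p ->
  commute [~ D, r] y.
Proof.
move=> Rp; have [_ _ _ _ ex] := R3_triple x Rp; rewrite -/r -/y -/D in ex.
have := R3_triple x^-1 Rp; rewrite invgK -/r -/y => -[[hy hp] hr _ _ _].
have e : [~ D, r] = [~ y, p, p]^-1 ^ x^-1.
  rewrite -(comm_flip_left hy hp) -ex.
  have -> : [~ D ^ x, p] = [~ D, p ^ x^-1] ^ x by move: (D); clear; move=> d; fgroup.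
  by rewrite -conjgM mulgV conjg1.
have hc : r ^ x^-1 = r * p^-1 * r * p^-1 * y * p^-1 * r.
  by apply: (@R3_chain G y x^-1 p r) => //; [exact: R3_conj|rewrite /y -conjgM mulgV conjg1].
have ey : y = (r * p^-1 * r * p^-1)^-1 * r ^ x^-1 * (p^-1 * r)^-1 by rewrite hc; fgroup.
have c q : commute [~ y, p, p] q -> commute [~ D, r] (q ^ x^-1).
  by move=> h1; rewrite e; apply: commute_J2; apply/commute_sym/commuteV/commute_sym.
have c1 := c _ hy; have c2 := c _ hp; have c3 := c _ hr.
rewrite /y -conjgM mulgV conjg1 -/y in c1.
by rewrite ey; move: ([~ D, r]) (r ^ x^-1) c1 c2 c3; clear; move=> d z c1 c2 c3; csolve.
Qed.

(* All relations of the subgroup generated by [p ^ x^-1 * p^-1], [p] and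
   [p ^ x * p^-1] but for the commutator of its first and last generator. *)
Definition triple_rels (p ze sg D E d d1 e e1 : G) :=
  [/\ [/\ p ^ ze = p * E^-1 * e, p ^ ze^-1 = p * E * e1^-1,
          p ^ sg = p * D^-1 * d & p ^ sg^-1 = p * D * d1^-1],
      [/\ D ^ p = D * d, D ^ p^-1 = D * d^-1, E ^ p = E * e & E ^ p^-1 = E * e^-1],
      [/\ D ^ ze = D * d^-1 * d^-1, D ^ ze^-1 = D * d * d,
          D ^ sg = D * d1 * d^-1 & D ^ sg^-1 = D * d1^-1 * d],
      [/\ E ^ sg = E * e^-1 * e^-1, E ^ sg^-1 = E * e * e,
          E ^ ze = E * e1 * e^-1 & E ^ ze^-1 = E * e1^-1 * e] & commute D E].

Definition central_in (p ze sg D E d : G) :=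
  [/\ commute d p, commute d ze, commute d sg, commute d D & commute d E].

Lemma conj_tail_swap a b c d : a ^ b = a * c -> c ^ a = c * d -> commute d a -> commute d c ->
  b ^ a = b * c^-1 /\ b ^ a^-1 = b * c * d^-1.
Proof.
move=> h h1 da dc; have e1 : b ^ a = b * c^-1.
  by have -> : c = a^-1 * a ^ b; [rewrite h|]; fgroup.
split=> //.
have -> : b * c * d^-1 = ((b * c * d^-1) ^ a) ^ a^-1 by clear; fgroup.
by congr (_ ^ _); rewrite !conjMg e1 h1 conjVg (conj_fix da); fgroup.
Qed.

Lemma triple_relsP r p y D E d d1 e e1 :
  [/\ r ^ p = r * D, D ^ p = D * d, D ^ r = D * d1 & commute D (y * p)] ->
  [/\ y ^ p = y * E, E ^ p = E * e, E ^ y = E * e1 & commute E (r * p)] ->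
  (forall u, u \in [:: d; d1; e; e1] ->
     [/\ commute u r, commute u p, commute u y, commute u D & commute u E]) ->
  triple_rels p (y * p^-1) (r * p^-1) D E d d1 e e1.
Proof.
move=> [eD eDp eDr Dyp] [eE eEp eEy Erp] H.
have [|dr dp dy dD dE] := H d; first by rewrite !inE eqxx.
have [|d1r d1p d1y d1D d1E] := H d1; first by rewrite !inE eqxx ?orbT.
have [|er ep ey eeD eeE] := H e; first by rewrite !inE eqxx ?orbT.
have [|e1r e1p e1y e1D e1E] := H e1; first by rewrite !inE eqxx ?orbT.
have iDp := conj_inv_tail eDp dD dp; have iDr := conj_inv_tail eDr d1D d1r.
have iEp := conj_inv_tail eEp eeE ep; have iEy := conj_inv_tail eEy e1E e1y.
have eDy : D ^ y = D * d^-1.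
  have -> : D ^ y = (D ^ (y * p)) ^ p^-1 by clear; fgroup.
  by rewrite (conj_fix Dyp).
have iDy : D ^ y^-1 = D * d^-1^-1 by apply: conj_inv_tail => //; csolve.
have eEr : E ^ r = E * e^-1.
  have -> : E ^ r = (E ^ (r * p)) ^ p^-1 by clear; fgroup.
  by rewrite (conj_fix Erp).
have iEr : E ^ r^-1 = E * e^-1^-1 by apply: conj_inv_tail => //; csolve.
(* Conjugating [commute D (y * p)] by [p] inserts [E] between [y] and [p]; dividing by [y * p]
   leaves [E ^ y^-1], which is [E] up to [e1]. *)
have DE : commute D E.
  have h1 := commute_J2 p Dyp; rewrite eDp conjMg eE (conj_fix (commute_refl p)) in h1.
  have h2 : commute D (y * E * p).
    have -> : D = D * d * d^-1 by fgroup.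
    by apply: commute_sym; apply: commuteM; [exact: commute_sym|csolve].
  have h3 : commute D (E ^ y^-1).
    have -> : E ^ y^-1 = y * E * p * (y * p)^-1 by clear; fgroup.
    by apply: commuteM => //; apply: commuteV.
  rewrite iEy in h3; have -> : E = E * e1^-1 * e1 by fgroup.
  by apply: commuteM => //; csolve.
have erD1 : p ^ r = p * D^-1 /\ p ^ r^-1 = p * D * d1^-1 by apply: conj_tail_swap.
have eyE1 : p ^ y = p * E^-1 /\ p ^ y^-1 = p * E * e1^-1 by apply: conj_tail_swap.
have {erD1 eyE1} [[p1 p2] [p3 p4]] := (erD1, eyE1).
have H' u v : u \in [:: d; d1; e; e1] -> v \in [:: d; d1; e; e1] -> commute u v.
  move=> /H [ur up uy uD uE]; rewrite !inE => /or4P[] /eqP ->.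
  - by have -> : d = D^-1 * D ^ p; [rewrite eDp; fgroup|csolve].
  - by have -> : d1 = D^-1 * D ^ r; [rewrite eDr; fgroup|csolve].
  - by have -> : e = E^-1 * E ^ p; [rewrite eEp; fgroup|csolve].
  - by have -> : e1 = E^-1 * E ^ y; [rewrite eEy; fgroup|csolve].
have dd1 : commute d d1 by apply: H'; rewrite !inE eqxx ?orbT.
have de : commute d e by apply: H'; rewrite !inE eqxx ?orbT.
have de1 : commute d e1 by apply: H'; rewrite !inE eqxx ?orbT.
have d1e : commute d1 e by apply: H'; rewrite !inE eqxx ?orbT.
have d1e1 : commute d1 e1 by apply: H'; rewrite !inE eqxx ?orbT.
have ee1 : commute e e1 by apply: H'; rewrite !inE eqxx ?orbT.
clear eD eE Dyp Erp H.
by split; [split|split|split|split|]; rewrite // ; gcol [:: r; y; p; D; E; d; d1; e; e1].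
Qed.

Lemma R3_triple_rels p x (ze := p ^ x * p^-1) (sg := p ^ x^-1 * p^-1)
    (D := [~ p ^ x^-1, p]) (E := [~ p ^ x, p]) 
    (d := [~ D, p]) (d1 := [~ D, p ^ x^-1]) (e := [~ E, p]) (e1 := [~ E, p ^ x]) : R3 p ->
  triple_rels p ze sg D E d d1 e e1 /\
  [/\ central_in p ze sg D E d, central_in p ze sg D E d1, 
      central_in p ze sg D E e & central_in p ze sg D E e1] /\
  [/\ commute d d1 /\ commute d e, commute d e1, commute d1 e, commute d1 e1 & commute e e1].
Proof.
move=> Rp.
have [[dr dp] dy [d1r d1p] Dyp _] := R3_triple x Rp.
have d1y := R3_triple_sym x Rp.
have := R3_triple x^-1 Rp; rewrite invgK => -[[ey ep] er [e1y e1p] Erp _].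
have e1r := R3_triple_sym x^-1 Rp; rewrite invgK in e1r.
rewrite -/D -/E -/d -/e -/d1 -/e1 in dr dp dy d1r d1p d1y Dyp ey ep er e1y e1p e1r Erp.
have dD : commute d D by rewrite /D; csolve.
have d1D : commute d1 D by rewrite /D; csolve.
have eeD : commute e D by rewrite /D; csolve.
have e1D : commute e1 D by rewrite /D; csolve.
have dE : commute d E by rewrite /E; csolve.
have d1E : commute d1 E by rewrite /E; csolve.
have eeE : commute e E by rewrite /E; csolve.
have e1E : commute e1 E by rewrite /E; csolve.
split; last split.
- apply: triple_relsP.

  + by split=> //; rewrite /d1 /d /D; fgroup.
  + by split=> //; rewrite /e1 /e /E; fgroup.
  + by move=> u; rewrite !inE => /or4P[] /eqP ->.
- by split; split; rewrite /ze /sg; csolve.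
have h u : commute u D -> commute u E -> commute u p -> commute u (p ^ x^-1) ->
    commute u (p ^ x) -> [/\ commute u d, commute u d1, commute u e & commute u e1].
  by move=> uD uE up ur uy; split; [rewrite /d|rewrite /d1|rewrite /e|rewrite /e1]; csolve.
have [_ ? ? ?] := h d dD dE dp dr dy; have [_ _ ? ?] := h d1 d1D d1E d1p d1r d1y.
by have [_ _ _ ?] := h e eeD eeE ep er ey; split.
Qed.

End TorsionFree.

(** Collecting the relation of [R3_square] gives the missing commutator of [ze] and [sg].
    Conjugating the result by [p] changes only the exponent of [e], from -5 to -1, whence the fourth
    power. *)
Lemma triple_comm (G : groupType) (p ze sg D E d d1 e e1 : G) :
  triple_rels p ze sg D E d d1 e e1 ->
  [/\ central_in p ze sg D E d, central_in p ze sg D E d1,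
      central_in p ze sg D E e & central_in p ze sg D E e1] ->
  [/\ commute d d1 /\ commute d e, commute d e1, commute d1 e, commute d1 e1 & commute e e1] ->
  (ze * sg * ze) ^ p = ze * ze * sg ^ p^-1 ->
  ze * sg = sg * ze * (D * D * E * E * d ^- 5 * e ^- 5 * e1) /\ e ^+ 4 = 1.
Proof.
move=> [[r1 r2 r3 r4] [r5 r6 r7 r8] [r9 r10 r11 r12] [r13 r14 r15 r16] DE].
move=> [[c1 c2 c3 c4 c5] [c6 c7 c8 c9 c10] [c11 c12 c13 c14 c15] [c16 c17 c18 c19 c20]].
move=> [[c21 c22] c23 c24 c25 c26] h.
have h1 : ze * sg = sg * ze * (D * D * E * E * d ^- 5 * e ^- 5 * e1).
  apply: esym; rewrite /conjg in h.
  gsubc [:: ze; sg; p; D; E; d; d1; e; e1] (ze^-1) (D * d^-1 * d^-1) h.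
split=> //; have h2 := congr1 (fun z => z ^ p) h1; rewrite /conjg /= in h2.
have h3 : ze * sg = sg * ze * (D * D * E * E * d ^- 5 * e ^- 1 * e1).
  gsubc [:: ze; sg; p; D; E; d; d1; e; e1] (1 : G) (E^-1 * D^-1 * d * e * e * e) h2.
rewrite h1 in h3.
gsubc [:: ze; sg; p; D; E; d; d1; e; e1] ((sg * ze * (D * D * E * E * d ^- 5 * e ^- 5 * e1))^-1) (1 : G) (esym h3).
Qed.

Lemma comm_invl (G : groupType) (a b : G) : commute [~ a, b] a -> [~ a^-1, b] = [~ a, b]^-1.
Proof.
move=> h; have {}h : commute [~ a, b]^-1 a^-1 by csolve.
by rewrite -[RHS](conj_fix h); clear; fgroup.
Qed.

(** In the application [D ^ x = E^-1], so that [D^-1 * E^-1] is [[~ D, x]]; the last two parameters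
    of [triple_rels] are already reduced to [d] and [e]. *)
Lemma triple_rels_base (G : groupType) (p ze sg D E d e : G) :
  triple_rels p ze sg D E d e^-1 e d^-1 -> central_in p ze sg D E d ->
  central_in p ze sg D E e -> commute d e ->
  [~ D^-1 * E^-1, p] = (d * e)^-1 /\ (e = d^-1 -> d * d = 1 ->
    [/\ commute (D^-1 * E^-1) ze, commute (D^-1 * E^-1) sg, commute (D^-1 * E^-1) p
      & commute ze sg -> [~ sg * ze, p] = E * D]).
Proof.
move=> [[r1 r2 r3 r4] [r5 r6 r7 r8] [r9 r10 r11 r12] [r13 r14 r15 r16] DE].
move=> [c1 c2 c3 c4 c5] [c11 c12 c13 c14 c15] c22.
have e1 : [~ D^-1 * E^-1, p] = (d * e)^-1 by gcol [:: ze; sg; p; D; E; d; e].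
split=> // ee dd; subst e; have dV : d^-1 = d by rewrite -[LHS]mulg1 -dd mulKg.
have e2 : commute (D^-1 * E^-1) ze.
  transitivity (ze * D^-1 * E^-1 * (d * d)); [gcol [:: ze; sg; p; D; E; d]|].
  by rewrite dd; clear; fgroup.
have e3 : commute (D^-1 * E^-1) sg.
  transitivity (sg * D^-1 * E^-1 * (d * d)^-1); [gcol [:: ze; sg; p; D; E; d]|].
  by rewrite dd; clear; fgroup.
have e4 : commute (D^-1 * E^-1) p.
  gcol [:: ze; sg; p; D; E; d].
split=> // hc.
transitivity (E * D * (d * d)^-1); last by rewrite dd invg1 mulg1.
gcol [:: ze; sg; p; D; E; d].
Qed.

Lemma comm_expg4 (G : groupType) (a b : G) : commute a (a ^ b) ->
  [~ a, b] ^+ 4 = (a ^+ 4)^-1 * (a ^+ 4) ^ b.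
Proof.
move=> h; have -> : (a ^+ 4) ^ b = (a ^ b) ^+ 4 by clear; fgroup.
by rewrite /commg; move: (a ^ b) h => c h; fgroup.
Qed.

(** * Removing the 2-torsion from the relations *)

Section TorsionFree.

Variable G : groupType.
Implicit Types a b p r s t x y g h : G.
Notation gam := (lower_central_term G).
Hypothesis TF : forall x, gam 5 x -> x * x = 1 -> x = 1.

Lemma R3_core p x (ze := p ^ x * p^-1) (sg := p ^ x^-1 * p^-1)
    (D := [~ p ^ x^-1, p]) (E := [~ p ^ x, p])
    (d := [~ D, p]) (d1 := [~ D, p ^ x^-1]) (e := [~ E, p]) (e1 := [~ E, p ^ x]) : R3 p ->
  [/\ commute ze sg, d ^+ 4 = 1 /\ e ^+ 4 = 1, D * D * E * E * d ^- 5 * e ^- 5 * e1 = 1,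
      D ^ x = E^-1 & d1 ^ x = e^-1 /\ d ^ x = e1^-1].
Proof.
move=> Rp.
have sq1 := R3_square x Rp (commute1 p).
have sq2 := R3_square x^-1 Rp (commute1 p); rewrite invgK in sq2.
rewrite -/ze -/sg !mulg1 !conjg1 in sq1 sq2.
have nx := R3_next x Rp; rewrite -/ze -/sg in nx.
have [rel [cen cc]] := R3_triple_rels TF x Rp.
have := R3_triple_rels TF x^-1 Rp; rewrite invgK => -[rel' [cen' cc']].
have [h1 e4] := triple_comm rel cen cc sq1.
have [h2 d4] := triple_comm rel' cen' cc' sq2.
rewrite -/ze -/sg -/D -/E -/d -/e -/d1 -/e1 in rel cen cc rel' cen' cc' h1 h2 e4 d4.
have Dx : D ^ x = E^-1.
  by have [_ _ _ _ ->] := R3_triple TF x Rp; rewrite /E; clear; fgroup.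
have d1x : d1 ^ x = e^-1.
  rewrite /d1 conjRg Dx -conjgM mulVg conjg1.
  have cE : commute e E by case: cen => _ _ [].
  exact: comm_invl.
have dx : d ^ x = e1^-1.
  rewrite /d conjRg Dx.
  have cE : commute e1 E by case: cen => _ _ _ [].
  exact: comm_invl.
set X := D * D * E * E * d ^- 5 * e ^- 5 * e1 in h1 *.
have eX : X = [~ ze, sg] by rewrite /commg /conjg h1; clear; fgroup.
(* By [R3_next], [sg] is [(ze * ze)^-1 * ze ^ x], so [[~ ze, sg]] equals [[~ ze, [~ ze, x]]], of
   weight 2 + 3. *)
have gX : gam 5 X.
  have -> : X = [~ ze, [~ ze, x]].
    have esg : sg = (ze * ze)^-1 * ze ^ x by rewrite nx; clear; fgroup.
    by rewrite eX [in LHS]esg; clear; fgroup.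
  have gz : gam 2 ze.
    have -> : ze = [~ x, p^-1] by rewrite /ze; clear; fgroup.
    exact: lct_comm1.
  by apply: (@lct_comm G 2 3) => //; apply: lct_comm1.
(* The formula for [x^-1] expresses the inverse of [X] with the letters for [D] and [E] exchanged.
   Together the two formulas give [X * X = e1 * d1^-1], a product of commuting elements of exponent
   4. *)
have X8 : X ^+ 8 = 1.
  have d14 : d1 ^+ 4 = 1.
    have -> : d1 = e^-1 ^ x^-1 by rewrite -d1x; clear; fgroup.
    by rewrite -conjXg expVgn e4 invg1 conj1g.
  have e14 : e1 ^+ 4 = 1.
    have -> : e1 = (d ^ x)^-1 by rewrite dx invgK.
    by rewrite expVgn -conjXg d4 conj1g invg1.
  have XX : X * (E * E * D * D * e ^- 5 * d ^- 5 * d1) = 1.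
    move: h2; rewrite h1; move: (X) (E * _ * _ * _ * _ * _ * _); clear => X Y h.
    by gsub ((sg * ze)^-1) (1 : G) (esym h).
  have [[dd1 de] de1 d1e d1e1 ee1] := cc.
  have [[_ _ _ dD dE] [_ _ _ d1D d1E] [_ _ _ eD eE] [_ _ _ e1D e1E]] := cen.
  have DE : commute D E by case: rel.
  have X2 : X * X = e1 * d1^-1.
    transitivity (X * (E * E * D * D * e ^- 5 * d ^- 5 * d1) * e1 * d1^-1).
      rewrite /X; clearbody d d1 e e1; clearbody D E; fgroup.
    by rewrite XX mul1g.
  transitivity ((X * X) ^+ 4); first by fgroup.
  rewrite X2; transitivity (e1 ^+ 4 * (d1 ^+ 4)^-1); last by rewrite e14 d14; fgroup.
  by clearbody d1 e1; fgroup.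
have X1 := TF8 TF gX X8.
split=> //; apply: comm_commute; rewrite -eX //.
Qed.

(** Here [[~ p^-1, x, x]] is [sg^-1 * ze^-1], while [x] maps [sg] to [ze^-1] and [ze] to
    [ze * ze * sg]. That [x] fixes it amounts to [ze] and [sg] commuting. *)
Lemma R3_inv p : R3 p -> R3 p^-1.
Proof.
move=> Rp x; have [h _ _ _ _] := R3_core x Rp; have nx := R3_next x Rp.
set ze := p ^ x * p^-1 in h nx; set sg := p ^ x^-1 * p^-1 in h nx.
have sx : sg ^ x = ze^-1 by rewrite /sg /ze; clear; fgroup.
have -> : [~ p^-1, x, x] = ze * (ze ^ x)^-1 by rewrite /ze; clear; fgroup.
clearbody ze sg; have e : ze * (ze ^ x)^-1 = sg^-1 * ze^-1 by rewrite nx; clear nx sx; fgroup.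
by apply: commute_conj; rewrite e conjMg !conjVg sx nx; clear nx sx e; fgroup.
Qed.

(** The parameters [d] and [d1] of [triple_rels] have weight 4, and their commutators with [x] have
    exponent 4, hence vanish. This identifies [e1] with [d^-1] and [d1] with [e^-1]; likewise
    [[~ D, x, p]] vanishes and gives [e = d^-1], and in the end all four parameters are powers of
    [w]. *)
Lemma R3_base p x (t := [~ p, p ^ x]) (w := [~ t, x]) (v := [~ t, p]) : R3 p ->
  [/\ w * w = v, v * v = 1, commute w p & commute w x] /\
  [/\ [~ t, p ^ x] = v, [~ p, p ^ x^-1] = w * t^-1 & [~ p, x, x, p] = w^-1].
Proof.
move=> Rp; have nx := R3_next x Rp.
have [h [d4 e4] hX Dx [d1x dx]] := R3_core x Rp.
have := R3_core x^-1 Rp; rewrite invgK => -[_ _ hX' _ _].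
have [rel [cen [[dd1 de] de1 d1e d1e1 ee1]]] := R3_triple_rels TF x Rp.
set ze := p ^ x * p^-1 in nx h rel cen.
set sg := p ^ x^-1 * p^-1 in nx h rel cen.
set D := [~ p ^ x^-1, p] in d4 hX Dx d1x dx hX' rel cen dd1 de de1 d1e d1e1.
set E := [~ p ^ x, p] in e4 hX Dx d1x dx hX' rel cen de de1 d1e d1e1 ee1.
set d := [~ D, p] in d4 hX dx hX' rel cen dd1 de de1.
set e := [~ E, p] in e4 hX d1x hX' rel cen de d1e ee1.
set d1 := [~ D, p ^ x^-1] in d1x hX' rel cen dd1 d1e d1e1.
set e1 := [~ E, p ^ x] in dx hX rel cen de1 d1e1 ee1.
have gD : gam 3 D.
  have -> : D = [~ p ^ x^-1, (p ^ x^-1) ^ x] by rewrite /D; clear; fgroup.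
  exact: lct_conj2.
have gd : gam 4 d by apply: lct_comm1.
have gd1 : gam 4 d1 by apply: lct_comm1.
have e14 : e1 ^+ 4 = 1.
  have -> : e1 = (d ^ x)^-1 by rewrite dx invgK.
  by rewrite expVgn -conjXg d4 conj1g invg1.
have d14 : d1 ^+ 4 = 1.
  have -> : d1 = e^-1 ^ x^-1 by rewrite -d1x; clear; fgroup.
  by rewrite -conjXg expVgn e4 invg1 conj1g.
have ee : e1 = d^-1.
  have : [~ d, x] = 1.
    apply: (TF4 TF); first exact: lct_comm1.
    rewrite /commg dx; transitivity (d ^+ 4 * e1 ^+ 4)^-1; last by rewrite d4 e14 mul1g invg1.
    by clear -de1; clearbody d e1; fgroup.
  rewrite /commg dx => hh.
  by transitivity (d^-1 * (d^-1 * e1^-1)^-1 * d * d^-1); [clear hh; clearbody d e1; fgroup|rewrite hh; clear; fgroup].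
have de_ : d1 = e^-1.
  have : [~ d1, x] = 1.
    apply: (TF4 TF); first exact: lct_comm1.
    rewrite /commg d1x; transitivity (d1 ^+ 4 * e ^+ 4)^-1; last by rewrite d14 e4 mul1g invg1.
    by clear -d1e; clearbody d1 e; fgroup.
  rewrite /commg d1x => hh.
  by transitivity (d1 * (d1^-1 * e^-1)); [rewrite hh mulg1|clear hh; clearbody d1 e; fgroup].
rewrite de_ ee in rel hX hX'.
have [cd _ ce _] := cen.
have [k1 k2] := triple_rels_base rel cd ce de.
have ew0 : [~ D, x] = D^-1 * E^-1 by rewrite /commg Dx.
have gw0 : gam 4 (D^-1 * E^-1) by rewrite -ew0; apply: lct_comm1.
have ede : e = d^-1.
  have hh : d * e = 1.
    apply: invg_inj; rewrite invg1 -k1; apply: (TF4 TF); first exact: lct_comm1.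
    rewrite k1; transitivity (d ^+ 4 * e ^+ 4)^-1; last by rewrite d4 e4 mul1g invg1.
    by clear -de; clearbody d e; fgroup.
  by transitivity (d^-1 * (d * e)); [clear hh; clearbody d e; fgroup|rewrite hh mulg1].
have DE : commute D E by case: rel.
have [_ _ _ dD dE] := cd.
have hw : (D^-1 * E^-1) * (D^-1 * E^-1) = d.
  move: hX' DE dD dE ede; clear; clearbody e d; clearbody D E => hX' DE dD dE ede.
  rewrite {}ede in hX'.
  by rewrite -[LHS]mulg1 -{1}hX'; clear hX'; fgroup.
have dd : d * d = 1.
  move: hX hw DE dD dE ede; clear; clearbody e d; clearbody D E => hX hw DE dD dE ede.
  rewrite {}ede in hX.
  transitivity ((D * D * E * E * d ^- 5 * d^-1 ^- 5 * d^-1)^-1 * (D^-1 * E^-1 * (D^-1 * E^-1))^-1 * d).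
    by fgroup.
  by rewrite hX hw; clear; fgroup.
have [wz ws wp hc] := k2 ede dd.
have {}hc := hc h.
have wx : commute (D^-1 * E^-1) x.
  have ey : p ^ x = ze * p by rewrite /ze; clear; fgroup.
  have eyx : (p ^ x) ^ x = ze * ze * sg * p ^ x by rewrite -nx /ze; clear; fgroup.
  have hy : commute (D^-1 * E^-1) (p ^ x) by rewrite ey; apply: commuteM.
  have hyx : commute (D^-1 * E^-1) ((p ^ x) ^ x).
    by rewrite eyx; apply: commuteM => //; apply: commuteM => //; apply: commuteM.
  have hE : commute (D^-1 * E^-1) E.
    by clear -DE; clearbody D E; csolve.
  have hw0 : commute (D^-1 * E^-1) ((D^-1 * E^-1) ^ x).
    rewrite [X in commute _ X](_ : _ = E * [~ (p ^ x) ^ x, p ^ x]^-1).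
      by apply: commuteM => //; apply: commuteV; apply: commuteR.
    by rewrite conjMg conjVg Dx /E; clear; fgroup.
  apply: comm_commute; apply: (TF4 TF); first exact: lct_comm1.
  rewrite comm_expg4 // [_ ^+ 4](_ : _ = D^-1 * E^-1 * (D^-1 * E^-1) * (D^-1 * E^-1 * (D^-1 * E^-1))).
    by rewrite hw dd conj1g invg1 mulg1.
  by clear; fgroup.
have et : t = E^-1 by rewrite /t /E; clear; fgroup.
have ew : w = D^-1 * E^-1.
  rewrite -[RHS](conj_fix wx) -ew0 /w et -Dx; clear; fgroup.
have ev : v = d.
  have h0 : [~ E^-1, p] = e^-1 by apply: comm_invl; case: ce.
  by rewrite /v et h0 ede invgK.
split; first by rewrite ew ev; split.
split.
- have h0 : [~ E^-1, p ^ x] = e1^-1 by apply: comm_invl; case: cen => _ _ _ [].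
  by rewrite ev et h0 ee invgK.
- rewrite ew et /D; clear; fgroup.
rewrite ew.
have -> : [~ p, x, x, p] = [~ sg * ze, p] ^ p.
  have -> : [~ p, x, x] = (sg * ze) ^ p; last by clear; fgroup.
  have -> : [~ p, x, x] = (p^-1 * p ^ x)^-1 * (ze ^ x) ^ (p ^ x) * (p ^ x)^-1 * p ^ x by rewrite /ze; clear; fgroup.
  by rewrite nx /ze; clear; fgroup.
rewrite hc -[RHS](conj_fix (b := p)); first by clear; fgroup.
by apply/commute_sym/commuteV/commute_sym.
Qed.
End TorsionFree.

(** * The commutator of two conjugates, and centrality of its defect *)

Section TorsionFree.

Variable G : groupType.
Implicit Types a b p r s t x y z g h k m : G.
Notation gam := (lower_central_term G).
Hypothesis TF : forall x, gam 5 x -> x * x = 1 -> x = 1.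

Definition cjc p g := [~ p, p ^ g].
Definition cjw p g := [~ cjc p g, g].
Definition central z := forall k, commute z k.

Lemma cj_facts p g (t := cjc p g) (w := cjw p g) : R3 p ->
  [/\ commute w p, commute w g, commute w (p ^ g), commute w t & w ^+ 4 = 1] /\
  [/\ t ^ p = t * w * w, t ^ (p ^ g) = t * w * w, t ^ g = t * w, t ^ g^-1 = t * w^-1 &
      cjc p g^-1 = w * t^-1] .
Proof.
move=> Rp; have [[h1 h2 h3 h4] [h5 h6 h7]] := R3_base TF g Rp.
rewrite -/(cjc p g) -/t -/(cjw p g) -/w in h1 h2 h3 h4 h5 h6.
have wy : commute w (p ^ g) by csolve.
have wt : commute w t by rewrite /t /cjc; csolve.
have tg : t ^ g = t * w by rewrite /w /cjw -/t; clear; fgroup.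
split; split=> //.
- by rewrite -h2 -h1; clear; fgroup.
- by rewrite -mulgA h1 /t /cjc; clear; fgroup.
- by rewrite -mulgA h1 -h5 /t /cjc; clear; fgroup.
- by apply: (conj_inv_tail tg) => //; csolve.
Qed.

Lemma cjc_gam3 p g : gam 3 (cjc p g). Proof. exact: lct_conj2. Qed.

Lemma cjw_gam4 p g : gam 4 (cjw p g). Proof. by apply: lct_comm1; apply: cjc_gam3. Qed.

(** The source of the commutation results below: one commutator belongs to the two conjugators [g]
    and [m * g], and [cj_facts] can be compared for both. *)
Lemma cjcM p m z g : p ^ m = p * z -> central z -> cjc p (m * g) = cjc p g.
Proof.
move=> pm cz; rewrite /cjc conjgM pm conjMg (conj_fix (cz g)).
have := cz p; have := cz (p ^ g); clear; move: (p ^ g) => y h1 h2; fgroup.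
Qed.

(** Let [t] be the common commutator, [w] and [W] its defects for [g] and [m * g]. Conjugating by
    [p] gives [w * w = W * W], so that [g] and [m * g] have the same effect on [t * t]. *)
Lemma cj_square_commute p m z g : R3 p -> p ^ m = p * z -> central z ->
  commute (cjc p g * cjc p g) m /\ commute (cjw p g * cjw p g) m.
Proof.
move=> Rp pm cz; have [[w1 w2 w3 w4 w5] [t1 t2 t3 t4 t5]] := cj_facts g Rp.
have [[w1' w2' w3' w4' _] [t1' _ t3' _ _]] := cj_facts (m * g) Rp.
rewrite (cjcM g pm cz) in t1' t3' w4'.
move: (cjc p g) (cjw p g) (cjw p (m * g)) w1 w2 w3 w4 w5 t1 t2 t3 t4 t5 w1' w2' w3' w4' t1' t3'
 => t w W w1 w2 w3 w4 w5 t1 t2 t3 t4 t5 w1' w2' w3' w4' t1' t3'.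
have e : w * w = W * W by apply: (mulgI t); rewrite !mulgA -t1 t1'.
split.
  apply: commute_conj.
  have -> : (t * t) ^ m = (t ^ (m * g) * t ^ (m * g)) ^ g^-1 by clear; fgroup.
  rewrite t3'; have -> : t * W * (t * W) = t * t * (W * W) by clear -w4'; fgroup.
  rewrite -e; have -> : t * t * (w * w) = t ^ g * t ^ g by rewrite t3; clear -w4; fgroup.
  by clear; fgroup.
have -> : m = m * g * g^-1 by clear; fgroup.
apply: commuteM; last by csolve.
by rewrite e; apply: commute_sym; apply: commuteM; exact: commute_sym.
Qed.

(** The element [j = [~ t, m]] has weight 5. It is inverted by [t], because [t * t] commutes with
    [m]. It also commutes with [t * w^-1] and, by [R3_commute] with [s = j], with [w]; so [t] fixes
    it and [j * j = 1]. *)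
Lemma cj_commute p m z g : R3 p -> p ^ m = p * z -> central z -> gam 2 m ->
  commute (cjc p g) m.
Proof.
move=> Rp pm cz gm; have [[w1 w2 w3 w4 w5] [t1 t2 t3 t4 t5]] := cj_facts g Rp.
have [[w1' w2' w3' w4' _] [t1' _ t3' _ _]] := cj_facts (m * g) Rp.
have [ttm wwm] := cj_square_commute g Rp pm cz.
rewrite (cjcM g pm cz) in t1' t3' w4'.
have pj s := @R3_commute G p g s Rp.
have g5 : gam 5 [~ cjc p g, m].
  by apply: (@lct_comm G 3 2) => //; exact: cjc_gam3.
have e6 : [~ p ^ g^-1, p]^-1 = cjc p g^-1 by rewrite /cjc; clear; fgroup.
rewrite t5 in e6.
apply: comm_commute.
move: (cjc p g) (cjw p g) (cjw p (m * g)) w1 w2 w3 w4 w5 t1 t2 t3 t4 t5 w1' w2' w3' w4' t1' t3' ttm wwm e6 g5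
 => t w W w1 w2 w3 w4 w5 t1 t2 t3 t4 t5 w1' w2' w3' w4' t1' t3' ttm wwm e6 g5.
set j := [~ t, m] in g5 *.
have jg : j ^ g = w^-1 * W.
  have -> : j ^ g = (t ^ g)^-1 * t ^ (m * g) by rewrite /j; clear; fgroup.
  by rewrite t3 t3'; clear; fgroup.
have jtw : commute j (t * w^-1).
  apply: (@commute_J2V _ _ _ g); rewrite jg -t4 -conjgM mulVg conjg1.
  by csolve.
have jt : j ^ t = j^-1.
  have -> : j ^ t = [~ t * t, m] * j^-1 by rewrite /j; clear; fgroup.
  by rewrite commute_comm ?mul1g.
have jp : commute p j.
  apply/commute_sym/commute_conj.
  have -> : j ^ p = (t ^ p)^-1 * (t ^ (p ^ m^-1)) ^ m by rewrite /j; clear; fgroup.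
  have -> : p ^ m^-1 = p * z^-1.
    have -> : p ^ m^-1 = (p * z) ^ m^-1 * (z ^ m^-1)^-1 by clear; fgroup.
    by rewrite -pm (conj_fix (cz _)); clear; fgroup.
  have -> : t ^ (p * z^-1) = t ^ p by rewrite conjgM (conj_fix (commuteV (commute_sym (cz _)))).
  rewrite t1 -mulgA conjMg (conj_fix wwm) (_ : t ^ m = t * j); last by rewrite /j; clear; fgroup.
  have wwj : commute (w * w) j.
    by rewrite /j; apply: commuteR => //; apply: commute_sym; csolve.
  by move: (w * w) wwj => ww h; clear -h; clearbody j; fgroup.
have mj : commute (t * w^-1) j by [].
have h1 : commute (t * w^-1) (j ^ g).
  have := pj j jp; rewrite -[[~ _, p]]invgK e6 => h.
  have h' : commute (t * w^-1) (j ^ g * j).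
    by have -> : t * w^-1 = (w * t^-1)^-1 by clear; fgroup.
  have -> : j ^ g = j ^ g * j * j^-1 by clear; fgroup.
  by apply: commuteM => //; apply: commuteV.
have jw : j ^ w = j.
  have h2 := commute_J2 g^-1 h1; rewrite conjMg t4 conjVg (conj_fix (commuteV w2)) in h2.
  rewrite -[(j ^ g) ^ g^-1]conjgM mulgV conjg1 in h2.
  have -> : w = (t * w^-1 * w^-1)^-1 * (t * w^-1) by clear; fgroup.
  by apply: conj_fix; apply: commuteM => //; apply: commuteV.
apply: TF => //; rewrite -{1}jw.
have -> : j ^ w = j ^ t.
  by rewrite -[in LHS](conj_fix jtw); clear; fgroup.
by rewrite jt mulVg.
Qed.

(** The exponent 4 kills [cjw p g], the obstruction to commuting with [g], and leaves
    [[~ p ^+ 4, p ^ g]] ([cjtE]). *)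
Definition cjt p g := cjc p g ^+ 4.

Lemma conj_id p m : commute p m -> p ^ m = p * 1.
Proof. by move=> h; rewrite mulg1 conj_fix. Qed.

Lemma central_1 : central 1. Proof. by move=> k; apply: commute_sym; apply: commute1. Qed.

Lemma cjt_cent p g m : R3 p -> commute p m -> commute (cjt p g) m.
Proof.
move=> Rp pm; have [h _] := cj_square_commute g Rp (conj_id pm) central_1.
have -> : cjt p g = cjc p g * cjc p g * (cjc p g * cjc p g) by rewrite /cjt; clear; fgroup.
by apply: commute_sym; apply: commuteM; exact: commute_sym.
Qed.

Lemma cjtE p g : R3 p -> cjt p g = [~ p ^+ 4, p ^ g].
Proof.
move=> Rp; have [[w1 w2 w3 w4 w5] [t1 t2 t3 t4 t5]] := cj_facts g Rp.
have -> : [~ p ^+ 4, p ^ g] =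
    ((cjc p g ^ p) ^ p) ^ p * (cjc p g ^ p) ^ p * cjc p g ^ p * cjc p g.
  by rewrite /cjc; clear; fgroup.
rewrite /cjt; clear t2 t3 t4 t5; move: (cjc p g) (cjw p g) w1 w2 w3 w4 w5 t1 => t w w1 w2 w3 w4 w5 t1.
transitivity (t ^+ 4 * (w ^+ 4) ^+ 3); first by rewrite w5; clear; fgroup.
by clear w5; gcol [:: p; t; w].
Qed.

Lemma cjt_conj p g : R3 p -> commute (cjt p g) g.
Proof.
move=> Rp; have [[w1 w2 w3 w4 w5] [t1 t2 t3 t4 t5]] := cj_facts g Rp.
apply: commute_conj; rewrite /cjt conjXg t3.
by transitivity (cjc p g ^+ 4 * cjw p g ^+ 4); [clear -w4; fgroup|rewrite w5 mulg1].
Qed.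

Lemma cjt_cent_r p g m : R3 p -> commute (p ^ g) m -> commute (cjt p g) m.
Proof.
move=> Rp h; have tg := cjt_conj g Rp.
rewrite -[m](conjgKV g) -(conj_fix tg); apply: commute_J2; apply: cjt_cent => //.
by apply: (@commute_J2V _ _ _ g); rewrite conjgKV.
Qed.

Lemma cjtV p g : R3 p -> cjt p g^-1 = (cjt p g)^-1.
Proof.
move=> Rp; have [[w1 w2 w3 w4 w5] [t1 t2 t3 t4 t5]] := cj_facts g Rp.
rewrite /cjt t5; transitivity (cjw p g ^+ 4 * (cjc p g ^+ 4)^-1); last by rewrite w5 mul1g.
by clear -w4; fgroup.
Qed.

Lemma cjt_flip p h : R3 p -> cjt (p ^ h) h^-1 = (cjt p h)^-1.
Proof. by move=> Rp; rewrite /cjt /cjc; clear; fgroup. Qed.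

(** The failure of [cjt p h] to centralize another conjugate of [p]; [cjt_commute] makes it
    trivial. *)
Definition cjl p h g := [~ (cjt p h)^-1, p ^ g].

(** With [z = p ^ h], this is [cjt_conj] for the element [p ^ z^-1] and the conjugator [z * g],
    chosen so that the second conjugate is again [p ^ g]. *)
Lemma cjl_commute p h g : R3 p -> commute (cjt p g * cjl p h g) (p ^ h * g).
Proof.
move=> Rp; set z := p ^ h.
have ez : commute (cjt p h) z by apply: cjt_cent_r => //; apply: commute_refl.
have ep : commute (cjt p h) p by apply: cjt_cent => //; apply: commute_refl.
have ee : commute (cjt p g) (cjt p h) by apply: cjt_cent => //; apply: commute_sym.
have Rp' := R3_conj z^-1 Rp.
have := cjt_conj (z * g) Rp'; rewrite cjtE // [(p ^ z^-1) ^ (z * g)](_ : _ = p ^ g); last by clear; fgroup.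
have -> : (p ^ z^-1) ^+ 4 = p ^+ 4 * (cjt p h)^-1.
  have -> : (p ^ z^-1) ^+ 4 = p ^+ 4 * ([~ p ^+ 4, z]^-1) ^ z^-1 by clear; fgroup.
  by rewrite -cjtE // conj_fix //; apply: commuteV; apply/commute_sym/commuteV/commute_sym.
have -> : [~ p ^+ 4 * (cjt p h)^-1, p ^ g] = [~ p ^+ 4, p ^ g] ^ (cjt p h)^-1 * cjl p h g.
  by rewrite /cjl; clear; fgroup.
by rewrite -cjtE // conj_fix //; apply: commuteV.
Qed.

Lemma cjl_rel p h g : R3 p ->
  [~ cjt p g, p ^ h] ^ g = cjl p h g * (cjl p h g)^-1 ^ (p ^ h * g).
Proof.
move=> Rp; have := conj_fix (cjl_commute h g Rp); have tg := conj_fix (cjt_conj g Rp).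
have -> : [~ cjt p g, p ^ h] ^ g = (cjt p g ^ g)^-1 * (cjt p g) ^ (p ^ h * g) by clear; fgroup.
rewrite tg conjMg => e.
transitivity ((cjt p g)^-1 * (cjt p g ^ (p ^ h * g) * cjl p h g ^ (p ^ h * g)) * (cjl p h g ^ (p ^ h * g))^-1).
  by clear; fgroup.
by rewrite e conjVg; clear; fgroup.
Qed.

(** Replacing [g] by [g * c] changes nothing in [cjl_rel] but the outer conjugations, and the
    comparison shows that [c] fixes [cjl p h g]. The proof of [cjl_cent] uses [c * g] and [h * c] in
    the same way. *)
Lemma cjl_cent_r p h g c : R3 p -> commute (p ^ g) c -> commute (cjl p h g) c.
Proof.
move=> Rp hc.
have ey : p ^ (g * c) = p ^ g by rewrite conjgM conj_fix.
have et : cjt p (g * c) = cjt p g by rewrite /cjt /cjc ey.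
have el : cjl p h (g * c) = cjl p h g by rewrite /cjl ey.
have h1 := cjl_rel h g Rp; have := cjl_rel h (g * c) Rp; rewrite et el.
rewrite conjgM h1 (mulgA (p ^ h) g c); move: (cjl p h g) (p ^ h * g) => L k e.
apply: commute_conj.
transitivity ((L * L^-1 ^ k) ^ c * (L^-1 ^ (k * c))^-1); first by clear; fgroup.
by rewrite e; clear; fgroup.
Qed.

Lemma cjl_cent p h g c : R3 p -> commute p c -> commute (cjl p h g) c.
Proof.
move=> Rp hc.
have ey : p ^ (c * g) = p ^ g by rewrite conjgM [p ^ c]conj_fix.
have et : cjt p (c * g) = cjt p g by rewrite /cjt /cjc ey.
have el : cjl p h (c * g) = cjl p h g by rewrite /cjl ey.
have et' : cjt p (h * c) = cjt p h.
  rewrite -[RHS](conj_fix (cjt_cent h Rp hc)) /cjt /cjc.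
  transitivity ([~ p ^ c, p ^ (h * c)] ^+ 4); first by rewrite (conj_fix hc).
  by clear; fgroup.
have el' : cjl p (h * c) g = cjl p h g by rewrite /cjl et'.
have := cjl_rel h (c * g) Rp; have := cjl_rel (h * c) g Rp; rewrite et el el'.
have -> : [~ cjt p g, p ^ (h * c)] ^ g = [~ cjt p g, p ^ h] ^ (c * g).
  by rewrite -{1}(conj_fix (cjt_cent g Rp hc)); clear; fgroup.
move=> -> /mulgI; rewrite conjgM; move: (cjl p h g) => L e.
apply/commute_conj.
have -> : L ^ c = (L^-1 ^ (p ^ h * (c * g)))^-1 ^ (p ^ (h * c) * g)^-1 by clear; fgroup.
by rewrite -e conjgM; clear; fgroup.
Qed.

Lemma cjl_cent_m p h g c : R3 p -> commute (p ^ h) c -> commute (cjl p h g) c.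
Proof.
move=> Rp hc; have Rz := R3_conj h Rp.
have e : (p ^ h) ^ (h^-1 * g) = p ^ g by clear; fgroup.
have h1 := cjl_cent h^-1 (h^-1 * g) Rz hc; rewrite /cjl e cjt_flip // invgK in h1.
have h2 : commute (cjl p h g) (cjt p h).
  by apply: cjl_cent => //; apply: commute_sym; apply: cjt_cent.
have h3 : commute [~ (cjt p h)^-1, p ^ g] (cjt p h)^-1 by apply: commuteV.
have := comm_invl h3; rewrite invgK => h4.
by rewrite -[cjl p h g]invgK /cjl -h4; apply/commute_sym/commuteV/commute_sym.
Qed.

(** The relation [nrel] expresses [n ^ g] by [L = cjl p h g]. Passing from [g] to [g * g] squares
    [n], and replaces [L] by an element whose fourth power is [L ^+ 8]. The two relations for
    [n ^+ 8] are compatible only if [g] fixes [L ^+ 8], and then [n ^+ 8] is trivial. *)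
Lemma cjt_commute p h g : R3 p -> commute (cjt p g) (p ^ h).
Proof.
move=> Rp; apply: comm_commute.
set n := [~ cjt p g, p ^ h].
have gn : gam 5 n.
  have tp : commute (cjt p g) p by apply: cjt_cent.
  have -> : n = [~ cjt p g, [~ p, h]].
    transitivity ([~ cjt p g, [~ p, h]] * [~ cjt p g, p] ^ [~ p, h]); first by rewrite /n; clear; fgroup.
    by rewrite (commute_comm tp); clear; fgroup.
  apply: (@lct_comm G 3 2) => //; last exact: lct_comm1.
  have -> : cjt p g = cjc p g * cjc p g * (cjc p g * cjc p g) by rewrite /cjt; clear; fgroup.
  by apply: lctM; apply: lctM; exact: cjc_gam3.
apply: (TF8 TF gn).
have lz k : commute (cjl p h k) (p ^ h) by apply: cjl_cent_m.
have lp k : commute (cjl p h k) p by apply: cjl_cent.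
have ly k : commute (cjl p h k) (p ^ k) by apply: cjl_cent_r.
have nrel k : [~ cjt p k, p ^ h] ^ k = cjl p h k * (cjl p h k)^-1 ^ k.
  by rewrite cjl_rel // [(_)^-1 ^ (_ * _)]conjgM (conj_fix (commute_sym (commuteV (commute_sym (lz k))))).
have [sz _ _ _ _] := R3_core TF g Rp.
have nx := R3_next g Rp.
have [[w1 w2 w3 w4 w5] _] := cj_facts g Rp; have [_ [_ _ hxi]] := R3_base TF g Rp.
have ep : commute (cjt p h)^-1 p by apply: commute_sym; apply: commuteV; apply: commute_sym; apply: cjt_cent.
have ecent c : commute p c -> commute (cjt p h)^-1 c.
  by move=> hc; apply: commute_sym; apply: commuteV; apply: commute_sym; apply: cjt_cent.
rewrite -/(cjc p g) -/(cjw p g) in hxi.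
set ze := p ^ g * p^-1 in sz nx; set sg := p ^ g^-1 * p^-1 in sz nx.
have xi : [~ p, g, g] = (sg * ze) ^ p.
  have -> : [~ p, g, g] = (p^-1 * p ^ g)^-1 * (ze ^ g) ^ (p ^ g) * (p ^ g)^-1 * p ^ g
    by rewrite /ze; clear; fgroup.
  by rewrite nx /ze; clear; fgroup.
have xi4 : commute p ([~ p, g, g] ^+ 4).
  have wx : commute (cjw p g) [~ p, g, g] by csolve.
  apply/commute_sym/commute_conj; rewrite conjXg.
  have -> : [~ p, g, g] ^ p = [~ p, g, g] * (cjw p g)^-1.
    by rewrite -hxi; clear; fgroup.
  transitivity ([~ p, g, g] ^+ 4 * (cjw p g ^+ 4)^-1); last by rewrite w5 invg1 mulg1.
  by move: [~ p, g, g] (cjw p g) wx; clear => a b c; fgroup.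
have sz4 : commute p (sg ^+ 4 * ze ^+ 4).
  apply: (@commute_J2V _ _ _ p); rewrite (conj_fix (commute_refl p)).
  by have -> : (sg ^+ 4 * ze ^+ 4) ^ p = [~ p, g, g] ^+ 4; [rewrite xi; clear -sz; clearbody ze sg; fgroup|].
have ey : (p ^ g) ^ g = ze * ze * sg * (ze * p) by rewrite -nx /ze; clear; fgroup.
set e := (cjt p h)^-1 in ep ecent.
have eze : e ^ ze = e * cjl p h g.
  have -> : e ^ ze = (e * [~ e, p ^ g]) ^ p^-1 by rewrite /ze; clear; fgroup.
  by rewrite conj_fix //; apply: commute_sym; apply: commuteM; apply: commute_sym; apply: commuteV => //; exact: lp.
have esg : e ^ sg = e * cjl p h g^-1.
  have -> : e ^ sg = (e * [~ e, p ^ g^-1]) ^ p^-1 by rewrite /sg; clear; fgroup.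
  by rewrite conj_fix //; apply: commute_sym; apply: commuteM; apply: commute_sym; apply: commuteV => //; exact: lp.
have lze : commute (cjl p h g) ze by apply: commuteM; [exact: ly|apply: commuteV; exact: lp].
have lsg : commute (cjl p h g^-1) sg by apply: commuteM; [exact: ly|apply: commuteV; exact: lp].
have eM : e ^ (ze * ze * sg * ze) = e * cjl p h (g * g).
  have -> : e ^ (ze * ze * sg * ze) = (e * [~ e, p ^ (g * g)]) ^ p^-1.
    by rewrite conjgM ey; clear; fgroup.
  by rewrite conj_fix //; apply: commute_sym; apply: commuteM; apply: commute_sym; apply: commuteV => //; exact: lp.
have lM : commute (cjl p h (g * g)) (ze * ze * sg * ze).
  have -> : ze * ze * sg * ze = (p ^ g) ^ g * p^-1 by rewrite ey; clear; fgroup.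
  by apply: commuteM; [rewrite -conjgM; exact: ly|apply: commuteV; exact: lp].
have eL : cjl p h (g * g) ^+ 4 = cjl p h g ^+ 8.
  have e4 := ecent _ sz4.
  move: (cjl p h (g * g)) (cjl p h g^-1) (cjl p h g) lM lsg lze eM esg eze e4 sz.
  clear; clearbody e ze sg => M L' L lM lsg lze eM esg eze e4 sz.
  have a1 : L' ^+ 4 = (L ^+ 4)^-1.
    have e5 : e ^ (sg ^+ 4 * ze ^+ 4) = e by exact: conj_fix.
    have e6 : e ^ (sg ^+ 4 * ze ^+ 4) = e * L ^+ 4 * (L' ^+ 4) ^ (ze ^+ 4).
      rewrite conjgM; have -> : e ^ (sg ^+ 4) = e * L' ^+ 4 by gcol [:: sg; e; L'].
      by rewrite conjMg; congr (_ * _); gcol [:: ze; e; L].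
    rewrite e6 in e5.
    have -> : L' ^+ 4 = ((e * L ^+ 4)^-1 * (e * L ^+ 4 * (L' ^+ 4) ^ (ze ^+ 4))) ^ (ze ^- 4).
      by clear; fgroup.
    by rewrite e5; clear -lze; fgroup.
  have e6 : e ^ (sg ^+ 4 * ze ^+ 12) = e * L ^+ 8.
    rewrite conjgM; have -> : e ^ (sg ^+ 4) = e * (L ^+ 4)^-1 by rewrite -a1; gcol [:: sg; e; L'].
    by clear a1 e4; gcol [:: ze; e; L].
  have e7 : e ^ (sg ^+ 4 * ze ^+ 12) = e * M ^+ 4.
    have -> : sg ^+ 4 * ze ^+ 12 = (ze * ze * sg * ze) ^+ 4 by clear -sz; fgroup.
    by move: (ze * ze * sg * ze) lM eM; clear => u lM eM; gcol [:: u; e; M].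
  by apply: (mulgI e); rewrite -e6 -e7.
have et2 : cjt p (g * g) = cjt p g * cjt p g.
  have tp : commute (cjt p g) p by apply: cjt_cent.
  have tg := cjt_conj g Rp.
  have tze : commute (cjt p g) ze by rewrite /ze; csolve.
  have tsg : commute (cjt p g) sg by rewrite /sg; csolve.
  rewrite cjtE // conjgM ey.
  have a1 : (p ^+ 4) ^ ze = p ^+ 4 * cjt p g.
    have -> : (p ^+ 4) ^ ze = (p ^+ 4 * [~ p ^+ 4, p ^ g]) ^ p^-1 by rewrite /ze; clear; fgroup.
    by rewrite -cjtE // conj_fix //; csolve.
  have a2 : (p ^+ 4) ^ sg = p ^+ 4 * (cjt p g)^-1.
    have -> : (p ^+ 4) ^ sg = (p ^+ 4 * [~ p ^+ 4, p ^ g^-1]) ^ p^-1 by rewrite /sg; clear; fgroup.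
    by rewrite -cjtE // cjtV // conj_fix //; csolve.
  have p4 : commute (p ^+ 4) p by csolve.
  move: (p ^+ 4) (cjt p g) a1 a2 p4 tp tze tsg; clear; clearbody ze sg => q t a1 a2 p4 tp tze tsg.
  by gcol [:: ze; sg; p; q; t].
have tp : commute (cjt p g) p by apply: cjt_cent.
have tg := cjt_conj g Rp.
have nt : commute n (cjt p g).
  apply: (@commute_J2V _ _ _ g); rewrite nrel (conj_fix tg).
  apply/commute_sym; apply: commuteM.
    by apply/commute_sym; apply: cjl_cent => //; apply: commute_sym.
  rewrite -{1}(conj_fix tg); apply: commute_J2; apply: commuteV.
  by apply/commute_sym; apply: cjl_cent => //; apply: commute_sym.
have ll k : commute (cjl p h k) (cjl p h k ^ k).
  apply: commute_sym; rewrite -{2}[cjl p h k](conjgKV k); apply: commute_J2.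
  by apply: cjl_cent => //; apply: (@commute_J2V _ _ _ k); rewrite conjgKV; apply: commute_sym; exact: ly.
have n2 : [~ cjt p (g * g), p ^ h] = n * n.
  have -> : [~ cjt p (g * g), p ^ h] = n ^ cjt p g * n by rewrite et2 /n; clear; fgroup.
  by rewrite (conj_fix nt).
have r1 := nrel g; have r2 := nrel (g * g); rewrite n2 in r2; rewrite -/n in r1.
have l1 := ll g; have l2 := ll (g * g).
move: (cjl p h (g * g)) (cjl p h g) eL r1 r2 l1 l2; clear; clearbody n => M L eL r1 r2 l1 l2.
have r3 : (n ^+ 8) ^ g = L ^+ 8 * ((L ^+ 8)^-1) ^ g.
  rewrite conjXg r1; have -> : (L ^+ 8)^-1 ^ g = (L ^ g) ^- 8 by clear; fgroup.
  have -> : L^-1 ^ g = (L ^ g)^-1 by clear; fgroup.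
  by move: (L ^ g) l1; clear => Lg h; fgroup.
have r4 : (n ^+ 8) ^ (g * g) = L ^+ 8 * ((L ^+ 8)^-1) ^ (g * g).
  have -> : n ^+ 8 = (n * n) ^+ 4 by clear; fgroup.
  rewrite conjXg r2 -eL; have -> : (M ^+ 4)^-1 ^ (g * g) = (M ^ (g * g)) ^- 4 by clear; fgroup.
  have -> : M^-1 ^ (g * g) = (M ^ (g * g))^-1 by clear; fgroup.
  by move: (M ^ (g * g)) l2; clear => Lg h; fgroup.
have e : L ^+ 8 = (L ^+ 8) ^ g.
  move: r4; rewrite conjgM r3; move: (L ^+ 8); clear => K e.
  transitivity ((K * K^-1 ^ (g * g)) * K ^ (g * g)); first by clear; fgroup.
  by rewrite -e; clear; fgroup.
apply: (conjg_inj g); rewrite r3 conjVg -e; clear; fgroup.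
Qed.

(* This is [[~ p ^+ 2, p ^ g]]. *)
Definition cjs p g := cjc p g * cjc p g * (cjw p g * cjw p g).

Lemma cjs_gam p g : gam 3 (cjs p g).
Proof.
have h := lct_decr (cjw_gam4 p g); have h' := cjc_gam3 p g.
by apply: lctM; apply: lctM.
Qed.

Lemma lct_comm_conj t p g : gam 3 t -> commute t p -> gam 5 [~ t, p ^ g].
Proof.
move=> gt tp; have -> : [~ t, p ^ g] = [~ t, [~ p, g]].
  transitivity ([~ t, [~ p, g]] * [~ t, p] ^ [~ p, g]); first by clear; fgroup.
  by rewrite (commute_comm tp); clear; fgroup.
by apply: (@lct_comm G 3 2) => //; apply: lct_comm1.
Qed.

Lemma cjs_cent p h m : R3 p -> commute p m -> commute (cjs p h) m.
Proof.
move=> Rp pm; have [h1 h2] := cj_square_commute h Rp (conj_id pm) central_1.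
by apply: commute_sym; apply: commuteM; apply: commute_sym.
Qed.

Lemma cjs_conj p h : R3 p -> p ^ ((p ^ h) * (p ^ h)) = p * cjs p h.
Proof.
move=> Rp; have [[w1 w2 w3 w4 w5] [t1 t2 t3 t4 t5]] := cj_facts h Rp.
transitivity (p * (cjc p h * cjc p h ^ (p ^ h))); first by rewrite /cjc; clear; fgroup.
by rewrite t2 /cjs !mulgA.
Qed.

(** The square of [s] is [cjt p h], already known to commute with [p ^ g]. So [[~ s, p ^ g]], of
    weight 5, has trivial square once it commutes with [s]; this follows from [cj_commute] applied
    to [p] and to its conjugate [p * s]. *)
Lemma cjs_commute p h g : R3 p -> commute (cjs p h) (p ^ g).
Proof.
move=> Rp; set s := cjs p h; set z := p ^ h.
have sp : commute s p by apply: cjs_cent.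
have gs : gam 2 s by apply: lct_decr; exact: cjs_gam.
have ts : commute (cjc p g) s.
  by apply: cj_commute (conj_id _) central_1 gs => //; apply: commute_sym.
have ep : p ^ (z * z) = p * s := cjs_conj h Rp.
have Rp' := R3_conj (z * z) Rp.
have ts' : commute (cjc (p ^ (z * z)) ((z * z)^-1 * g)) s.
  apply: cj_commute (conj_id _) central_1 gs => //.
  by rewrite ep; apply: commute_sym; apply: commuteM; [|exact: commute_refl].
have e : cjc (p ^ (z * z)) ((z * z)^-1 * g) = cjc p g * [~ s, p ^ g].
  transitivity ([~ p * s, p ^ g]); first by rewrite -ep /cjc; clear; fgroup.
  by rewrite -[in RHS](conj_fix ts) /cjc; clear; fgroup.
rewrite e in ts'.
have ss : commute [~ s, p ^ g] s.
  rewrite -[[~ s, p ^ g]](mulKg (cjc p g)); apply: commute_sym.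
  by apply: commuteM; [apply: commuteV|]; exact: commute_sym.
apply: comm_commute; apply: TF.
  by apply: lct_comm_conj => //; exact: cjs_gam.
have [[w1 w2 w3 w4 w5] _] := cj_facts h Rp.
have s2 : s * s = cjt p h.
  rewrite /s /cjs /cjt; transitivity (cjc p h ^+ 4 * cjw p h ^+ 4); last by rewrite w5 mulg1.
  by clear -w4; fgroup.
have <- : [~ s * s, p ^ g] = [~ s, p ^ g] * [~ s, p ^ g].
  by rewrite -{1}(conj_fix ss); clear; fgroup.
by rewrite s2 commute_comm //; exact: cjt_commute.
Qed.

Lemma commute_torsion x k : gam 4 x -> x ^+ 4 = 1 -> commute x (x ^ k) -> commute x k.
Proof.
move=> gx x4 xk; apply: comm_commute; apply: (TF4 TF); first exact: lct_comm1.
by rewrite comm_expg4 // x4 conj1g invg1 mulg1.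
Qed.

(** It commutes with every conjugate of [p]; being a word in such conjugates, it commutes with its
    own conjugates, and [commute_torsion] applies. The proof of [cjw_central] has the same
    pattern. *)
Lemma cjw2_central p h : R3 p -> central (cjw p h * cjw p h).
Proof.
move=> Rp k; have [[w1 w2 w3 w4 w5] [t1 t2 t3 t4 t5]] := cj_facts h Rp.
have e : cjw p h * cjw p h = (cjs p h)^-1 * cjs p h ^ h.
  have -> : cjs p h ^ h = cjc p h ^ h * cjc p h ^ h * (cjw p h ^ h * cjw p h ^ h).
    by rewrite /cjs; clear; fgroup.
  rewrite /cjs t3 (conj_fix w2); clear -w4.
  by move: (cjc p h) (cjw p h) w4 => t w w4; fgroup.
have vc g : commute (cjw p h * cjw p h) (p ^ g).
  have h1 := cjs_commute h g Rp; have h2 := commute_J2 h (cjs_commute h (g * h^-1) Rp).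
  rewrite -[(p ^ (_ * _)) ^ _]conjgM -mulgA mulVg mulg1 in h2.
  rewrite e; apply: commute_sym; apply: commuteM; first apply: commuteV; exact: commute_sym.
have vc1 := vc 1; rewrite conjg1 in vc1.
apply: commute_torsion.
- by apply: lctM; exact: cjw_gam4.
- transitivity ((cjw p h ^+ 4) * (cjw p h ^+ 4)); first by clear; fgroup.
  by rewrite w5 mulg1.
have [[h1 _ _ _] _] := R3_base TF h Rp.
rewrite -/(cjc p h) -/(cjw p h) in h1; rewrite {2}h1 /cjc !conjRg -conjgM.
have := vc k; have := vc (h * k); move: (cjw p h * cjw p h) (p ^ k) (p ^ (h * k)).
by clear => v a b v1 v2; csolve.
Qed.

(** The value is independent of [g]: replacing [p] by [p ^ g] costs the factor [[~ t, [~ p, g]]], of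
    weight 5, and its square turns out to be trivial. *)
Lemma cjc_comm p h g : R3 p -> [~ cjc p h, p ^ g] = cjw p h * cjw p h.
Proof.
move=> Rp; set t := cjc p h; set z := p ^ h; set v := cjw p h * cjw p h.
have [[w1 w2 w3 w4 w5] [t1 t2 t3 t4 t5]] := cj_facts h Rp; rewrite -!(mulgA (cjc p h) (cjw p h)) -/v -/t in t1 t2.
have cv : central v by exact: cjw2_central.
have cV : central v^-1 by move=> k; apply/commute_sym/commuteV/commute_sym.
have pt : p ^ t = p * v^-1.
  transitivity (p * (t ^ p)^-1 * t); first by clear; clearbody t; fgroup.
  by rewrite t1; have := cv t; clear; clearbody v t => hc; fgroup.
have gt : gam 2 t by apply: lct_decr; exact: cjc_gam3.
have tt : commute (cjc p g) t by apply: (cj_commute g Rp pt cV gt).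
have ep : p ^ z = p * t by rewrite /t /cjc -/z; clear; fgroup.
have Rp' := R3_conj z Rp.
have tt' : commute (cjc (p ^ z) (z^-1 * g)) t.
  apply: (cj_commute _ Rp' _ cV gt); rewrite ep conjMg pt (conj_fix (commute_refl t)).
  by have := cv t; clear; clearbody t v => hc; fgroup.
have e : cjc (p ^ z) (z^-1 * g) = cjc p g * [~ t, p ^ g].
  transitivity ([~ p * t, p ^ g]); first by rewrite -ep /cjc; clear; fgroup.
  by rewrite -[in RHS](conj_fix tt) /cjc; clear; fgroup.
rewrite e in tt'.
have ss : commute [~ t, p ^ g] t.
  rewrite -[[~ t, p ^ g]](mulKg (cjc p g)); apply: commute_sym.
  by apply: commuteM; [apply: commuteV|]; exact: commute_sym.
have tty : [~ t * t, p ^ g] = 1.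
  apply: commute_comm; have -> : t * t = cjs p h * v^-1 by rewrite /cjs -/v -/t; clear; clearbody v t; fgroup.
  by apply: commute_sym; apply: commuteM; apply: commute_sym => //; exact: cjs_commute.
have u2 : [~ t, p ^ g] * [~ t, p ^ g] = 1.
  by rewrite -tty -{1}(conj_fix ss); clear; fgroup.
have tp : [~ t, p] = v by rewrite /commg t1 mulKg.
have e2 : [~ t, p ^ g] = [~ t, [~ p, g]] * v.
  transitivity ([~ t, [~ p, g]] * [~ t, p] ^ [~ p, g]); first by clear; fgroup.
  by rewrite tp (conj_fix (cv _)).
rewrite e2; suff -> : [~ t, [~ p, g]] = 1 by rewrite mul1g.
apply: TF.
  by apply: (@lct_comm G 3 2) => //; [exact: cjc_gam3|exact: lct_comm1].
have vv : v * v = 1 by rewrite -w5 /v; clear; fgroup.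
rewrite -u2 e2 -[LHS]mulg1 -vv; have := cv [~ t, [~ p, g]].
by move: [~ t, _]; clear; clearbody v => u hc; fgroup.
Qed.

Lemma cjw_central p h : R3 p -> central (cjw p h).
Proof.
move=> Rp k; have [[w1 w2 w3 w4 w5] [t1 t2 t3 t4 t5]] := cj_facts h Rp.
have cv := cjw2_central h Rp.
have vc g : commute (cjw p h) (p ^ g).
  have h1 := cjc_comm h g Rp; have h2 := congr1 (fun z => z ^ h) (cjc_comm h (g * h^-1) Rp).
  rewrite /= (conj_fix (cv h)) conjRg -conjgM -mulgA mulVg mulg1 t3 in h2.
  have e := congr1 (fun z => (cjw p h * cjw p h)^-1 * z) h2.
  apply: comm_commute; transitivity (([~ cjc p h, p ^ g] ^ cjw p h)^-1 * [~ cjc p h * cjw p h, p ^ g]).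
    by clear; fgroup.
  by rewrite h1 h2 (conj_fix (cv _)) mulVg.
have vc1 := vc 1; rewrite conjg1 in vc1.
apply: commute_torsion => //; first exact: cjw_gam4.
have ew : cjw p h = [~ p, p ^ h]^-1 * [~ p ^ h, p ^ (h * h)] by rewrite /cjw /cjc; clear; fgroup.
rewrite [X in commute _ (X ^ k)]ew.
rewrite conjMg conjVg !conjRg -!conjgM.
have := vc k; have := vc (h * k); have := vc (h * h * k).
move: (cjw p h) (p ^ k) (p ^ (h * k)) (p ^ (h * h * k)).
by clear => v a b c v1 v2 v3; csolve.
Qed.

End TorsionFree.

(** * Linearization *)

(* [rep x q] means that [x] lies in the subgroup [K] and has image [q] in [K / N]. *)
Lemma subquotient (H : groupType) (K N : H -> Prop) :
  (forall x, N x -> K x) ->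
  [/\ K 1, forall x y, K x -> K y -> K (x * y) & forall x, K x -> K x^-1] ->
  [/\ N 1, forall x y, N x -> N y -> N (x * y) & forall x, N x -> N x^-1] ->
  (forall x k, N x -> K k -> N (x ^ k)) ->
  exists (Q : groupType) (rep : H -> Q -> Prop),
  [/\ forall x, K x -> exists q, rep x q, forall q, exists x, rep x q,
     forall x q q', rep x q -> rep x q' -> q = q' &
     forall x, rep x 1 <-> N x] /\
  [/\ forall x y p q, rep x p -> rep y q -> rep (x * y) (p * q),
     forall x q, rep x q -> rep x^-1 q^-1 & forall x q, rep x q -> K x].
Proof.
move=> NK [K1 KM KV] [N1 NM NV] NJ.
pose cls x := [set y | N (x^-1 * y)]%classic.
(* A chosen representative of each coset of [N]. The default 1 never occurs, as the coset contains
   [x]; the carrier of the quotient consists of the chosen elements of [K]. *)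
pose can (x : H) : H := xget 1 (cls x).
have canP x : N (x^-1 * can x).
  have : cls x (can x) by apply: xgetPex; exists x; rewrite /cls /= mulVg.
  by [].
have can_eq x y : N (x^-1 * y) -> can x = can y.
  move=> h; rewrite /can; congr (xget 1 _); apply/seteqP; split=> z; rewrite /cls /=.
    move=> hz; have -> : y^-1 * z = (x^-1 * y)^-1 * (x^-1 * z) by fgroup.
    exact: (NM _ _ (NV _ h) hz).
  move=> hz; have -> : x^-1 * z = (x^-1 * y) * (y^-1 * z) by fgroup.
  exact: (NM _ _ h hz).
have canK x : K x -> K (can x).
  move=> Kx; have -> : can x = x * (x^-1 * can x) by fgroup.
  by apply: (KM) => //; apply: (NK); exact: canP.
pose T := {x : H | `[< K x >] && (can x == x)}.
have TP x : K x -> `[< K (can x) >] && (can (can x) == can x).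
  move=> Kx; apply/andP; split; first by apply/asboolP; apply: canK.
  apply/eqP; apply: can_eq; have -> : (can x)^-1 * x = (x^-1 * can x)^-1 by fgroup.
  by apply: (NV).
have TK (t : T) : K (val t) by case: t => x /= /andP[/asboolP].
have Tc (t : T) : can (val t) = val t by case: t => x /= /andP[_ /eqP].
pose mk x (Kx : K x) : T := exist _ (can x) (TP x Kx).
have eqT (s t : T) : N ((val s)^-1 * val t) -> s = t.
  by move=> h; apply: val_inj; rewrite -[LHS]Tc -[RHS]Tc; apply: can_eq.
pose tmul (s t : T) := mk _ (KM _ _ (TK s) (TK t)).
pose tinv (s : T) := mk _ (KV _ (TK s)).
pose tone := mk _ K1.
have valM s t : N ((val s * val t)^-1 * val (tmul s t)) by apply: canP.
have valV s : N ((val s)^-1^-1 * val (tinv s)) by apply: canP.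
have val1 : N (val tone) by have := canP 1; rewrite invg1 mul1g.
have NJ' x k : K k -> N x -> N (k^-1 * x * k).
  by move=> Kk Nx; rewrite -mulgA; apply: (NJ).
have tA : associative tmul.
  move=> s t u; apply: eqT.
  have -> : (val (tmul s (tmul t u)))^-1 * val (tmul (tmul s t) u) =
    ((val s * val (tmul t u))^-1 * val (tmul s (tmul t u)))^-1 *
    ((val t * val u)^-1 * val (tmul t u))^-1 *
    (((val u)^-1 * ((val s * val t)^-1 * val (tmul s t)) * val u) *
    ((val (tmul s t) * val u)^-1 * val (tmul (tmul s t) u))) by fgroup.
  by apply: (NM); apply: (NM); try apply: (NV); try apply: (valM); apply: (NJ') => //; apply: (valM).
have t1g : left_id tone tmul.
  move=> s; apply: eqT.
  have -> : (val (tmul tone s))^-1 * val s =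
    ((val tone * val s)^-1 * val (tmul tone s))^-1 * ((val s)^-1 * (val tone)^-1 * val s) by fgroup.
  by apply: (NM); [apply: (NV)|apply: (NJ') => //; apply: (NV)].
have tg1 : right_id tone tmul.
  move=> s; apply: eqT.
  have -> : (val (tmul s tone))^-1 * val s =
    ((val s * val tone)^-1 * val (tmul s tone))^-1 * (val tone)^-1 by fgroup.
  by apply: (NM); apply: (NV).
have tVg : left_inverse tone tinv tmul.
  move=> s; apply: eqT.
  have -> : (val (tmul (tinv s) s))^-1 * val tone =
    ((val (tinv s) * val s)^-1 * val (tmul (tinv s) s))^-1 *
    ((val s)^-1 * ((val s)^-1^-1 * val (tinv s))^-1 * val s) * val tone by fgroup.
  by apply: (NM) => //; apply: (NM); [apply: (NV)|apply: (NJ') => //; apply: (NV)].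
have tgV : right_inverse tone tinv tmul.
  move=> s; apply: eqT.
  have -> : (val (tmul s (tinv s)))^-1 * val tone =
    ((val s * val (tinv s))^-1 * val (tmul s (tinv s)))^-1 *
    ((val s)^-1^-1 * val (tinv s))^-1 * val tone by fgroup.
  by apply: (NM) => //; apply: (NM); apply: (NV).
pose Q : groupType := HB.pack_for groupType T (isGroup.Build T tA t1g tg1 tVg tgV).
exists Q, (fun x (q : Q) => K x /\ N (x^-1 * val (q : T))).
split; split.
- by move=> x Kx; exists (mk x Kx); split => //; apply: canP.
- by move=> q; exists (val (q : T)); split; rewrite ?mulVg //; exact: (TK q).
- move=> x q q' [_ h] [_ h']; apply: eqT.
  have -> : (val (q : T))^-1 * val (q' : T) = (x^-1 * val (q : T))^-1 * (x^-1 * val (q' : T)) by fgroup.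
  by apply: (NM) => //; apply: (NV).
- move=> x; split=> [[Kx h]|Nx].
    have -> : x = val tone * (x^-1 * val tone)^-1 by fgroup.
    by apply: (NM) => //; apply: (NV).
  by split; [exact: (NK)|apply: (NM) => //; apply: (NV)].
- move=> x y p q [Kx hx] [Ky hy]; split; first exact: (KM).
  have -> : (x * y)^-1 * val (tmul p q) = (y^-1 * (x^-1 * val (p : T)) * y) * (y^-1 * val (q : T))
     * ((val (p : T) * val (q : T))^-1 * val (tmul p q)) by fgroup.
  by apply: (NM); [apply: (NM) => //; apply: (NJ')|apply: (valM)].
- move=> x q [Kx hx]; split; first exact: (KV).
  have -> : x^-1^-1 * val (tinv q) = (x^-1^-1 * (x^-1 * val (q : T))^-1 * x^-1) * ((val (q : T))^-1^-1 * val (tinv q)) by fgroup.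
  by apply: (NM) => //; apply: (NJ'); [exact: (KV)|exact: (NV)].
- by move=> x q [].
Qed.

(** * Abelian normal subgroups of right 3-Engel elements *)

Section Module.

Variables (G : groupType) (V : G -> Prop).
Implicit Types a b c e u v x y g h : G.
Hypotheses (VP : abelian_normal V) (VR : forall v, V v -> R3 v).

Let VM u v : V u -> V v -> V (u * v). Proof. by case: VP => _ h _ _ _; apply: h. Qed.
Let VV v : V v -> V v^-1. Proof. by case: VP => _ _ h _ _; apply: h. Qed.
Let VJ v g : V v -> V (v ^ g). Proof. by case: VP => _ _ _ h _; apply: h. Qed.
Let VC u v : V u -> V v -> commute u v. Proof. by case: VP => _ _ _ _; apply. Qed.
Let VR' v g : V v -> V [~ v, g].
Proof. by move=> Vv; rewrite /commg; apply: VM; [apply: VV|apply: VJ]. Qed.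

Lemma engel_cube v h : V v -> [~ v, h, h, h] = 1.
Proof. by move=> Vv; apply: commute_comm; apply: VR. Qed.

(* The condition that [b] be right 3-Engel at [v * x], to first order in [v]. *)
Lemma engel_linear b x (c := [~ b, x]) (e := [~ c, x]) v : R3 b -> V v ->
  [~ v, e] * [~ v, c, x] * [~ v, b, e, x]^-1 * [~ v, b, x, x] = 1.
Proof.
move=> Rb Vv; have ex : commute e x := Rb x.
have h := Rb (v * x).
set Y := ((v^-1) ^ b * v) ^ x.
have VY : V Y by apply: VJ; apply: VM => //; apply: VJ; apply: VV.
have es : [~ b, v * x, v * x] = e * (Y^-1 ^ e * ((v^-1) ^ c * v) ^ x * Y ^ x).
  have -> : Y ^ x = Y ^ (v * x) by rewrite conjgM [Y ^ v]conj_fix //; apply: VC.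
  by rewrite /Y /e /c; clear; fgroup.
have VZ : V (Y^-1 ^ e * ((v^-1) ^ c * v) ^ x * Y ^ x).
  apply: VM; last exact: VJ; apply: VM; apply: VJ; first exact: VV.
  by apply: VM => //; apply: VJ; apply: VV.
have h2 : (Y^-1 ^ e * ((v^-1) ^ c * v) ^ x * Y ^ x) =
   ((v^-1) ^ e * v) ^ x * (Y^-1 ^ e * ((v^-1) ^ c * v) ^ x * Y ^ x) ^ x.
  apply: (mulgI e); rewrite -es -[LHS](conj_fix h) es (conjMg e) conjgM.
  move: (_ * Y ^ x) VZ => Z VZ.
  rewrite [Z ^ (v * x)]conjgM (conj_fix (VC VZ Vv)) (mulgA e); congr (_ * _).
  by clear -ex; clearbody e; fgroup.
clearbody c e; clear es VZ.
transitivity ((((v^-1) ^ e * v) ^ x * (Y^-1 ^ e * ((v^-1) ^ c * v) ^ x * Y ^ x) ^ x *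
   (Y^-1 ^ e * ((v^-1) ^ c * v) ^ x * Y ^ x)^-1) ^ x^-1)^-1; last first.
  by rewrite -h2 mulgV conj1g invg1.
by rewrite /Y; clear h h2; gmod [:: v] [:: x; b; c; e].
Qed.

Section Relations.

Variables (b x c e : G).
Hypotheses (ex : commute e x) (ec : commute e c) (cx : c ^ x = c * e).
Hypothesis lin : forall v, V v ->
  [~ v, e] * [~ v, c, x] * [~ v, b, e, x]^-1 * [~ v, b, x, x] = 1.

Let cube := engel_cube.

(** Additively, with g - 1 for the operator v |-> [v, g] acting on the right, [lin] is multiplied by
    (x - 1)^2; every term but the first then ends in (x - 1)^3 = 0. *)
Lemma lin_exx v : V v -> [~ v, e, x, x] = 1.
Proof.
move=> Vv; have h := lin Vv.
transitivity ([~ [~ v, e] * [~ v, c, x] * [~ v, b, e, x]^-1 * [~ v, b, x, x], x, x]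
  * [~ [~ v, c], x, x, x]^-1 * [~ [~ v, b, e], x, x, x] * [~ [~ v, b, x], x, x, x]^-1).
  clear h; gmod [:: v] [:: x; b; c; e].
by rewrite h !cube ?comm1g; [clear; fgroup| | |]; do !apply: VR'.
Qed.

Lemma lin_cxx v : V v -> [~ v, c, x, x] * [~ v, e, x] = 1.
Proof.
move=> Vv; have h := lin Vv.
transitivity ([~ [~ v, e] * [~ v, c, x] * [~ v, b, e, x]^-1 * [~ v, b, x, x], x]
  * [~ [~ v, b], e, x, x] * [~ [~ v, b], x, x, x]^-1).
  clear h; gmod [:: v] [:: x; b; c; e].
by rewrite h cube ?lin_exx ?comm1g; [clear; fgroup| |]; do !apply: VR'.
Qed.

End Relations.

Section Quotients.

Variables (b x c e : G).
Hypotheses (ex : commute e x) (ec : commute e c) (cx : c ^ x = c * e).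
Hypothesis lin : forall v, V v ->
  [~ v, e] * [~ v, c, x] * [~ v, b, e, x]^-1 * [~ v, b, x, x] = 1.
Hypothesis linV : forall v, V v ->
  [~ v, e] * [~ v, c^-1 * e, x^-1] * [~ v, b, e, x^-1]^-1 * [~ v, b, x^-1, x^-1] = 1.

Let cube := engel_cube.
Let cxV : c ^ x^-1 = c * e^-1.
Proof. by apply: (conj_inv_tail cx); csolve. Qed.
Let exx := lin_exx ex ec cx lin.
Let cxx := lin_cxx ex ec cx lin.
Let exV : commute e x^-1. Proof. by csolve. Qed.
Let ecV : commute e (c^-1 * e). Proof. by csolve. Qed.
Let cxVV : (c^-1 * e) ^ x^-1 = c^-1 * e * e.
Proof. by rewrite conjMg conjVg cxV (conj_fix exV); fgroup. Qed.
Let cxxV := lin_cxx exV ecV cxVV linV.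

(** The hypothesis [linV] is [lin] for [x^-1], which keeps [e] and turns [c] into [c^-1 * e] (see
    [comm_inv_engel]). The relations of [lin_cxx] for [x] and for [x^-1] are compared. *)
Lemma lin_cex v : V v -> [~ v, c, e, x] = 1.
Proof.
move=> Vv; have h1 := exx Vv; have h2 := cxx Vv.
have h3 := exx (VJ c Vv); have h4 := cxxV (VJ c Vv).
transitivity ([~ v, e, x, x] * ([~ v, c, x, x] * [~ v, e, x])^-1 * [~ v ^ c, e, x, x]^-1 *
  (([~ v ^ c, c^-1 * e, x^-1, x^-1] * [~ v ^ c, e, x^-1]) ^ (x * x))^-1).
  by clear h1 h2 h3 h4; gmod [:: v] [:: x; c; e].
by rewrite h1 h2 h3 h4; clear; fgroup.
Qed.

Lemma lin_eex v : V v -> [~ v, e, e, x] = 1.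
Proof.
move=> Vv; have h1 := cxx (VR' e Vv); have h2 := exx (VR' c Vv).
transitivity (([~ [~ v, e], c, x, x] * [~ [~ v, e], e, x]) * [~ [~ v, c], e, x, x]^-1).
  by clear h1 h2; gmod [:: v] [:: x; c; e].
by rewrite h1 h2; clear; fgroup.
Qed.

Let cee v : V v -> [~ v, c, e, e] * [~ v, e, e]^-1 = 1.
Proof.
move=> Vv; have h1 := cxx (VJ (c^-1 * e * e) Vv); have h2 := cxx Vv.
have h3 := lin_cex Vv; have h4 := lin_eex Vv; have h5 := cube e Vv.
transitivity (([~ v ^ (c^-1 * e * e), c, x, x] * [~ v ^ (c^-1 * e * e), e, x]) ^ c *
  ([~ v, c, x, x] * [~ v, e, x])^-1 * [~ v, c, e, x] ^+ 2 * [~ v, e, e, x]^-1 * [~ v, e, e, e]).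
  by clear h1 h2 h3 h4 h5; gmod [:: v] [:: x; c; e].
by rewrite h1 h2 h3 h4 h5; clear; fgroup.
Qed.

(** By [cee], putting c - 1 in front of (e - 1)^2 does not change it; doing so three times meets (c
    - 1)^3 = 0. *)
Lemma lin_ee v : V v -> [~ v, e, e] = 1.
Proof.
move=> Vv; have h1 := cube c Vv; have h2 := cee Vv.
have h3 := cee (VR' c Vv); have h4 := cee (VR' c (VR' c Vv)).
transitivity ([~ [~ v, c, c, c], e, e] * ([~ v, c, e, e] * [~ v, e, e]^-1)^-1 *
   ([~ [~ v, c], c, e, e] * [~ [~ v, c], e, e]^-1)^-1 *
   ([~ [~ v, c, c], c, e, e] * [~ [~ v, c, c], e, e]^-1)^-1).
  by clear h1 h2 h3 h4; gmod [:: v] [:: x; c; e].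
by rewrite h2 h3 h4 h1; clear; fgroup.
Qed.

Lemma lin_xxc v : V v -> [~ v, x, x, c] * [~ v, e, x] ^+ 3 = 1.
Proof.
move=> Vv; pose u := v ^ (e^-1 * e^-1); have Vu : V u by apply: VJ.
have h1 := cxx Vu; have h2 := lin_cex Vu; have h3 := lin_ee (VJ c Vu).
have h4 := exx (VJ e^-1 Vv); have h5 := exx Vu.
have h6 := lin_eex (VJ e^-1 Vv); have h7 := lin_eex Vu.
transitivity (([~ u, c, x, x] * [~ u, e, x]) * [~ u, c, e, x] ^- 2 * [~ u ^ c, e, e] *
  [~ v ^ e^-1, e, x, x]^-1 * [~ u, e, x, x]^-1 * [~ v ^ e^-1, e, e, x] ^+ 3 * [~ u, e, e, x] ^+ 3).
  by clear h1 h2 h3 h4 h5 h6 h7; rewrite /u; gmod [:: v] [:: x; c; e].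
by rewrite h1 h2 h3 h4 h5 h6 h7; clear; fgroup.
Qed.

Lemma lin_fix u g : [~ u, g] = 1 -> u ^ g = u /\ u ^ g^-1 = u.
Proof.
move/comm_commute => h; split; apply: conj_fix => //; exact: commuteV.
Qed.

Lemma lin_unip u g w : w = [~ u, g] -> V u -> w ^ g = w -> u ^ g = u * w /\ u ^ g^-1 = u * w^-1.
Proof.
move=> ew Vu /commute_conj h; have e1 : u ^ g = u * w by rewrite ew; clear; fgroup.
by split=> //; apply: (conj_inv_tail e1) => //; apply: VC => //; rewrite ew; apply: VR'.
Qed.

Lemma lin_unip2 u g w z : w = [~ u, g] -> V u -> V z -> w ^ g = w * z -> z ^ g = z ->
  [/\ u ^ g = u * w, u ^ g^-1 = u * w^-1 * z, w ^ g^-1 = w * z^-1 & z ^ g^-1 = z].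
Proof.
move=> ew Vu Vz h hz; have Vw : V w by rewrite ew; apply: VR'.
have e0 : z ^ g^-1 = z by apply: conj_fix; apply: commuteV; exact: commute_conj.
have e1 : u ^ g = u * w by rewrite ew; clear; fgroup.
have e2 : w ^ g^-1 = w * z^-1.
  by apply: (conj_inv_tail h); [apply: VC|exact: commute_conj].
split=> //; have -> : u ^ g^-1 = (u * w) ^ g^-1 * (w ^ g^-1)^-1 by clear; fgroup.
rewrite -e1 e2; have := VC Vw Vz; clear; move=> h; fgroup.
Qed.

(** The cubes of c x - 1 and c x^-1 - 1 vanish, and modulo the previous relations their sum is -12
    (e - 1)(x - 1). *)
Lemma lin_ex12 v : V v -> [~ v, e, x] ^+ 12 = 1.
Proof.
move=> Vv; have h1 := cube (c * x) Vv; have h2 := cube (c * x^-1) Vv.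
have Vk := VR' c Vv; have Vk2 := VR' c Vk; have Ve := VR' e Vv; have Vp := VR' x Ve.
have Vv1 := VR' x Vv; have Vv2 := VR' x Vv1.
have [r1 _] := lin_fix (cube c Vv).
have [r2 r3] := lin_fix (cube x Vv).
have [r4 r5] := lin_fix (exx Vv).
have [r6 r7] := lin_fix (lin_cex Vv).
have [r8 r9] := lin_fix (lin_cex Vk).
have [s1 s4] := lin_fix (lin_ee Vv).
have [s2 s5] := lin_fix (lin_ee Vk).
have [s3 s6] := lin_fix (lin_ee Vk2).
have kx : [~ v, c, x] ^ x = [~ v, c, x] * [~ v, e, x]^-1.
  have -> : [~ v, c, x] ^ x = [~ v, c, x] * ([~ v, c, x, x] * [~ v, e, x]) * [~ v, e, x]^-1 by clear; fgroup.
  by rewrite cxx // mulg1.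
have k2x : [~ v, c, c, x] ^ x = [~ v, c, c, x].
  have := cxx Vk; rewrite lin_cex // mulg1; by case/lin_fix.
have t0 : [~ v, x] ^ x = [~ v, x] * [~ v, x, x] by clear; fgroup.
have [t1 t2 t3 t4] := lin_unip2 erefl Vv Vv2 t0 r2.
have r4' : [~ v, e, x]^-1 ^ x = [~ v, e, x]^-1 by rewrite conjVg r4.
have [t5 t6 t7 t8] := lin_unip2 erefl Vk (VV Vp) kx r4'.
have [t9 t10] := lin_unip erefl Vk2 k2x.
have [t11 t12] := lin_unip erefl Ve r4.
have t13 : v ^ c = v * [~ v, c] by clear; fgroup.
have t14 : [~ v, c] ^ c = [~ v, c] * [~ v, c, c] by clear; fgroup.
have [u1 u2] := lin_unip erefl Vv s1.
have [u3 u4] := lin_unip erefl Vk s2.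
have [u5 u6] := lin_unip erefl Vk2 s3.
have V1 := VR' e Vk; have V2 := VR' e Vk2; have V3 := VR' x Vk; have V4 := VR' x Vk2.
have xc : x ^ c = x * e^-1.
  have -> : x ^ c = x * ((c ^ x)^-1 * c) by clear; fgroup.
  by rewrite cx; clear -ec; fgroup.
have xcV : x ^ c^-1 = x * e^-1^-1 by apply: (conj_inv_tail xc); csolve.
have [y1 y2] := lin_fix (commute_comm (commute_conj k2x)).
have VP' := VP; have ex' := ex; have ec' := ec.
transitivity ([~ v, c * x, c * x, c * x] * [~ v, c * x^-1, c * x^-1, c * x^-1])^-1; last first.
  by rewrite h1 h2; clear; fgroup.
clear -VP' ex' ec' Vv Vk Vk2 Ve Vp Vv1 Vv2 V1 V2 V3 V4 r1 r2 r4 r5 r6 r7 r8 r9 s1 s2 s3 s4 s5 s6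
  kx t0 t1 t2 t3 t4 t5 t6 t7 t9 t10 t11 t12 t13 t14 u1 u2 u3 u4 u5 u6 xc xcV y1 y2.
gmod [:: v; [~ v, c]; [~ v, c, c]; [~ v, e]; [~ v, e, x]; [~ v, x]; [~ v, x, x]; [~ v, c, e];
  [~ v, c, c, e]; [~ v, c, x]; [~ v, c, c, x]] [:: c; e; x].
Qed.

End Quotients.
Lemma comm_inv_engel b x (c := [~ b, x]) (e := [~ c, x]) : R3 b -> commute e c ->
  [~ b, x^-1] = c^-1 * e /\ [~ c^-1 * e, x^-1] = e.
Proof.
move=> Rb ec; have ex : commute e x := Rb x.
have cx : c ^ x = c * e by rewrite /e; clear; fgroup.
have cxV : c ^ x^-1 = c * e^-1 by apply: (conj_inv_tail cx); csolve.
split.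
  have -> : [~ b, x^-1] = (c ^ x^-1)^-1 by rewrite /c; clear; fgroup.
  by rewrite cxV; clear -ec; clearbody e; clearbody c; fgroup.
by clear cx; clearbody e; clearbody c; rewrite /commg conjMg conjVg cxV (conj_fix (commuteV ex)); fgroup.
Qed.

Lemma module_comm b x (c := [~ b, x]) (e := [~ c, x]) v : R3 b -> commute e c -> V v ->
  [/\ [~ v, x, x, c] ^+ 4 = 1, [~ v, x, x, c] * [~ v, e, x] ^+ 3 = 1,
      [~ v, e, x, x] = 1 & [~ v, c, x, x] * [~ v, e, x] = 1].
Proof.
move=> Rb ec Vv; have ex : commute e x := Rb x.
have cx : c ^ x = c * e by rewrite /e; clear; fgroup.
have lin u : V u -> _ := @engel_linear b x u Rb; rewrite -/c -/e in lin.
have linV u : V u -> _ := @engel_linear b x^-1 u Rb.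
have [e1 e2] := comm_inv_engel Rb ec; rewrite -/c -/e in e1 e2.
rewrite e1 e2 in linV.
have h1 := lin_xxc ex ec cx lin linV Vv; have h2 := lin_ex12 ex ec cx lin linV Vv.
split=> //; [|exact: (lin_exx ex ec cx lin)|exact: (lin_cxx ex ec cx lin)].
(* Minus three times an element of exponent 12, hence of exponent 4. *)
have -> : [~ v, x, x, c] = [~ v, e, x] ^- 3.
  by rewrite -[RHS]mul1g -h1; clear; fgroup.
by rewrite -[RHS]invg1 -h2; clear; fgroup.
Qed.

(** * Consequences of the first commutation on an abelian normal subgroup *)

Section Second.

Variables (a x : G).
Let c := [~ a, x].
Let e := [~ c, x].
Hypotheses (Ra : R3 a) (ec : commute e c).
Hypothesis xe0 : forall v, V v -> [~ v, x, e] = 1.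
Hypothesis xxc0 : forall v, V v -> [~ v, x, x, c] = 1.
Hypothesis ce0 : forall v, V v -> [~ v, c, e] = 1.

Let ex : commute e x. Proof. exact: Ra. Qed.
Let cx : c ^ x = c * e. Proof. by rewrite /e; clear; fgroup. Qed.
Let xc : x ^ c = x * e^-1.
Proof.
have -> : x ^ c = x * ((c ^ x)^-1 * c) by clear; fgroup.
by rewrite cx; clear -ec; clearbody e; fgroup.
Qed.
Let xcV : x ^ c^-1 = x * e^-1^-1.
Proof. by apply: (conj_inv_tail xc); csolve. Qed.

Let ex0 v : V v -> [~ v, e, x] = 1.
Proof.
move=> Vv; rewrite -(xe0 Vv); move: ex; clear -VP Vv; clearbody e => ex'.
by gmod [:: v] [:: e; x].
Qed.

Let ec0 v : V v -> [~ v, e, c] = 1.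
Proof.
move=> Vv; rewrite -(ce0 Vv); move: ec; clear -VP Vv; clearbody e; clearbody c => ec'.
by gmod [:: v] [:: e; c].
Qed.

Lemma second_cxx v : V v -> [~ v, c, x, x] = 1.
Proof.
move=> Vv; have [_ _ _] := module_comm Ra ec Vv.
by rewrite -/c -/e ex0 // mulg1.
Qed.

Lemma second_lin v : V v -> [~ v, e] * [~ v, c, x] * [~ v, a, x, x] = 1.
Proof.
move=> Vv; have := engel_linear x Ra Vv; rewrite -/c -/e ex0 ?invg1 ?mulg1 //.
exact: VR'.
Qed.

Lemma second_ee v : V v -> [~ v, e, e] = 1.
Proof.
have lin u : V u -> _ := @engel_linear a x u Ra; rewrite -/c -/e in lin.
have linV u : V u -> _ := @engel_linear a x^-1 u Ra.
have [e1 e2] := comm_inv_engel Ra ec; rewrite -/c -/e in e1 e2.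
by rewrite e1 e2 in linV => Vv; apply: (lin_ee ex ec cx lin linV).
Qed.

Lemma second_xc v : V v -> [~ v, x, c] = [~ v, c, x] * [~ v, e]^-1.
Proof.
move=> Vv; have h1 := ex0 (VJ (c * e^-1) Vv); have h2 := ce0 (VJ e^-1 Vv).
have h3 := second_ee (VJ e^-1 Vv).
transitivity ([~ v ^ (c * e^-1), e, x]^-1 * [~ v ^ e^-1, c, e]^-1 * [~ v ^ e^-1, e, e] *
  ([~ v, c, x] * [~ v, e]^-1)); last by rewrite h1 h2 h3; clear; fgroup.
clear h1 h2 h3; move: ex ec xc xcV; clear -VP Vv; clearbody e; clearbody c => ex' ec' xc' xcV'.
by gmod [:: v] [:: c; e; x].
Qed.

Lemma second_cxc v : V v -> [~ v, c, x, c] = 1.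
Proof.
move=> Vv; have h1 := second_lin Vv; have h2 := ec0 Vv; have h3 := xxc0 (VR' a Vv).
transitivity ([~ [~ v, e] * [~ v, c, x] * [~ v, a, x, x], c] * [~ v, e, c]^-1 *
  [~ [~ v, a], x, x, c]^-1); last by rewrite h1 h2 h3; clear; fgroup.
clear h1 h2 h3; move: ex ec xc xcV; clear -VP Vv; clearbody e; clearbody c => ex' ec' xc' xcV'.
by gmod [:: v] [:: c; e; x; a].
Qed.

Lemma second_ccx v : V v -> [~ v, c, c, x] = 1.
Proof.
move=> Vv; have h1 := second_xc (VR' c Vv); rewrite second_cxc // ce0 // invg1 mulg1 in h1.
by [].
Qed.

Lemma second_xcc v : V v -> [~ v, x, c, c] = 1.
Proof.
move=> Vv; have h1 := second_xc Vv; have h2 := second_cxc Vv; have h3 := ec0 Vv.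
rewrite h1; transitivity ([~ v, c, x, c] * [~ v, e, c]^-1); last by rewrite h2 h3 mul1g invg1.
clear h1 h2 h3; clear -VP Vv; clearbody e; clearbody c.
by gmod [:: v] [:: c; e; x].
Qed.

(** Commutators of [v] with elements of [A] lie in [A], so [a], [c] and [e] fix them. In (a x - 1)^3
    = 0 this leaves few terms, and three times [second_lin] minus that cube is the relation
    claimed. *)
Lemma second_cube v (A : G -> Prop) : abelian_normal A -> A a -> V v ->
  [~ v, e] ^+ 2 * [~ v, c, x] ^+ 6 = 1.
Proof.
move=> [_ AM AV AJ AC] Aa Vv.
have AR u g : A u -> A [~ u, g] by move=> Au; apply: AM; [apply: AV|apply: AJ].
have AR' u g : A u -> A [~ g, u].
  by move=> Au; have -> : [~ g, u] = [~ u, g]^-1; [fgroup|apply/AV/AR].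
have Ac : A c by apply: AR. have Ae : A e by apply: AR.
have h1 := engel_cube (a * x) Vv; have h2 := second_lin Vv.
have Vn := VR' e Vv; have Vk := VR' c Vv; have Vd := VR' a Vv.
have Vk1 := VR' x Vk; have Vd1 := VR' x Vd; have Vd2 := VR' x Vd1.
have V1 := VR' x Vv; have V2 := VR' x V1.
have fx u w : A u -> A w -> w ^ u = w /\ w ^ u^-1 = w.
  by move=> Au Aw; split; apply: conj_fix; [|apply: commuteV]; exact: AC.
have [f1 f2] := fx a _ Aa (AR' _ v Aa); have [f3 f4] := fx c _ Ac (AR' _ v Aa).
have [f5 f6] := fx e _ Ae (AR' _ v Aa).
have [g1 g2] := fx a _ Aa (AR' _ v Ac); have [g3 g4] := fx c _ Ac (AR' _ v Ac).
have [g5 g6] := fx e _ Ae (AR' _ v Ac).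
have [i1 i2] := fx a _ Aa (AR' _ v Ae); have [i3 i4] := fx c _ Ac (AR' _ v Ae).
have [i5 i6] := fx e _ Ae (AR' _ v Ae).
have ac : commute a c by apply: AC.
have ae : commute a e by apply: AC.
have [l1 _] := lin_fix (engel_cube x Vv).
have [l2 _] := lin_fix (engel_cube x Vd).
have [l3 _] := lin_fix (second_cxx Vv).
have [l4 _] := lin_fix (ex0 Vv).
have k1 : v ^ a = v * [~ v, a] by clear; fgroup.
have [k2 k3] := lin_unip erefl Vv g3.
have [k4 k5] := lin_unip erefl Vv i5.
have k6 : v ^ x = v * [~ v, x] by clear; fgroup.
have k7 : [~ v, x] ^ x = [~ v, x] * [~ v, x, x] by clear; fgroup.
have k8 : [~ v, a] ^ x = [~ v, a] * [~ v, a, x] by clear; fgroup.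
have k9 : [~ v, a, x] ^ x = [~ v, a, x] * [~ v, a, x, x] by clear; fgroup.
have k10 : [~ v, c] ^ x = [~ v, c] * [~ v, c, x] by clear; fgroup.
have xa : x ^ a = x * c^-1 by rewrite /c; clear; fgroup.
transitivity ([~ v, a * x, a * x, a * x]^-1 * ([~ v, e] * [~ v, c, x] * [~ v, a, x, x]) ^+ 3).
  clear h1 h2 AR AR' fx AM AV AJ AC; move: ex ec xc xcV xa; clear cx; clearbody e; clearbody c => ex' ec' xc' xcV' xa'.
  by gmod [:: v; [~ v, a]; [~ v, c]; [~ v, e]; [~ v, x]; [~ v, x, x]; [~ v, a, x];
    [~ v, a, x, x]; [~ v, c, x]] [:: a; c; e; x].
by rewrite h1 h2; clear; fgroup.
Qed.

End Second.
End Module.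

(** * Normal closures *)

Section NormalClosure.

Variables (G : groupType) (v : G).

Definition nclosure : G -> Prop :=
  generated_subgroup [set u | exists h, u = v ^ h]%classic.

Lemma nclosure_conj h : nclosure (v ^ h).
Proof. by apply: sub_generated_subgroup; exists h. Qed.

Lemma nclosure_id : nclosure v.
Proof. by rewrite -[v]conjg1; apply: nclosure_conj. Qed.

Lemma nclosure1 : nclosure 1.
Proof. by have [] := (is_subgroupP _).1 (generated_subgroup_is_subgroup [set u | exists h, u = v ^ h]%classic). Qed.

Lemma nclosureM x y : nclosure x -> nclosure y -> nclosure (x * y).
Proof. by have [_ h _] := (is_subgroupP _).1 (generated_subgroup_is_subgroup [set u | exists h, u = v ^ h]%classic); apply: h. Qed.

Lemma nclosureV x : nclosure x -> nclosure x^-1.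
Proof. by have [_ _ h] := (is_subgroupP _).1 (generated_subgroup_is_subgroup [set u | exists h, u = v ^ h]%classic); apply: h. Qed.

Lemma nclosure_ind (P : G -> Prop) : P 1 -> (forall h, P (v ^ h)) ->
  (forall x y, nclosure x -> nclosure y -> P x -> P y -> P (x * y)) ->
  (forall x, nclosure x -> P x -> P x^-1) -> forall x, nclosure x -> P x.
Proof.
move=> P1 Pv PM PV x hx; suff [] : (nclosure x /\ P x) by [].
move/generated_subgroupP: (hx) => /(_ [set x | nclosure x /\ P x]%classic); apply.
  apply/is_subgroupP; split=> /=; first by split=> //; exact: nclosure1.
    by move=> y z [hy Py] [hz Pz]; split; [exact: nclosureM|exact: PM].
  by move=> y [hy Py]; split; [exact: nclosureV|exact: PV].
by move=> _ [h ->]; split; [exact: nclosure_conj|exact: Pv].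
Qed.

Lemma nclosureJ x g : nclosure x -> nclosure (x ^ g).
Proof.
move: x; apply: nclosure_ind => [|h|x y _ _|x _].
- by rewrite conj1g; exact: nclosure1.
- by rewrite -conjgM; exact: nclosure_conj.
- by rewrite conjMg; exact: nclosureM.
- by rewrite conjVg; exact: nclosureV.
Qed.

Lemma nclosureR x g : nclosure x -> nclosure [~ x, g].
Proof. by move=> h; apply: nclosureM; [apply: nclosureV|apply: nclosureJ]. Qed.

Lemma nclosure_commute z x : (forall h, commute z (v ^ h)) -> nclosure x -> commute z x.
Proof.
move=> hz; move: x; apply: nclosure_ind => [|//|x y _ _ h1 h2|x _ h1].
- exact: commute1.
- exact: commuteM.
- exact: commuteV.
Qed.

Hypothesis vC : forall g h, commute (v ^ g) (v ^ h).

Lemma nclosure_abelian : abelian_normal nclosure.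
Proof.
split; [exact: nclosure1|exact: nclosureM|exact: nclosureV|by move=> x g; apply: nclosureJ|].
move=> x y hx; apply: nclosure_commute => h; apply: commute_sym.
by apply: nclosure_commute hx => k; apply: vC.
Qed.

Hypothesis Rv : R3 v.

Lemma nclosure_R3 x : nclosure x -> R3 x.
Proof.
have VP := nclosure_abelian.
have hM y z g : nclosure y -> nclosure z -> [~ y, g, g, g] = 1 -> [~ z, g, g, g] = 1 ->
    [~ y * z, g, g, g] = 1.
  move=> Vy Vz h1 h2; transitivity ([~ y, g, g, g] * [~ z, g, g, g]); last by rewrite h1 h2 mul1g.
  by clear h1 h2; gmod [:: y; z] [:: g].
have hV y g : nclosure y -> [~ y, g, g, g] = 1 -> [~ y^-1, g, g, g] = 1.
  move=> Vy h1; transitivity [~ y, g, g, g]^-1; last by rewrite h1 invg1.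
  by clear h1; gmod [:: y] [:: g].
move=> hx g; apply: comm_commute; move: x hx; apply: nclosure_ind => [|h|x y|x].
- by rewrite !comm1g.
- exact/commute_comm/R3_conj.
- exact: hM.
- exact: hV.
Qed.

End NormalClosure.

(** * The pair of an element and its inverse *)

Section Linearization.

Variable G : groupType.
Implicit Types a b p x y z g h : G.

(** The relations that hold for a right 3-Engel element after passing to [R3_quotient]. The third
    one says that the normal closure has class at most 2. *)
Definition good p := [/\ R3 p, forall g, commute [~ p, p ^ g] g,
  forall g h, commute [~ p, p ^ g] (p ^ h) & forall x, commute [~ p, x, x] p].

Lemma good_conj p h : good p -> good (p ^ h).
Proof.
have e (g : G) : g = (g ^ h^-1) ^ h by clear; fgroup.
have e2 (g : G) : (p ^ h) ^ g = (p ^ (g ^ h^-1)) ^ h by clear; fgroup.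
move=> [h1 h2 h3 h4]; split.
- exact: R3_conj.
- by move=> g; rewrite e2 [X in commute _ X]e -conjRg; apply: commute_J2.
- by move=> g k; rewrite !e2 -conjRg; apply: commute_J2.
- by move=> g; rewrite [g]e -!conjRg; apply: commute_J2.
Qed.

Definition ncent p z := forall g, commute z (p ^ g).

Lemma ncent_nclosure p z x : ncent p z -> nclosure p x -> commute z x.
Proof. exact: nclosure_commute. Qed.

Lemma ncent1 p : ncent p 1. Proof. by move=> g; apply/commute_sym/commute1. Qed.

Lemma ncentM p x y : ncent p x -> ncent p y -> ncent p (x * y).
Proof. by move=> hx hy g; apply/commute_sym/commuteM; apply: commute_sym. Qed.

Lemma ncentV p x : ncent p x -> ncent p x^-1.
Proof. by move=> hx g; apply/commute_sym/commuteV/commute_sym. Qed.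

Lemma ncentJ p x h : ncent p x -> ncent p (x ^ h).
Proof.
move=> hx g; have -> : p ^ g = (p ^ (g * h^-1)) ^ h by clear; fgroup.
exact: commute_J2.
Qed.

Lemma good_ncent p g h : good p -> ncent p [~ p ^ g, p ^ h].
Proof.
move=> [_ _ h3 _]; have -> : [~ p ^ g, p ^ h] = [~ p, p ^ (h * g^-1)] ^ g by clear; fgroup.
by apply: ncentJ => k; apply: h3.
Qed.

Lemma good_nclosure_comm p x y : good p -> nclosure p x -> nclosure p y -> ncent p [~ x, y].
Proof.
move=> gp hx hy.
have P1 g : ncent p [~ p ^ g, y].
  move: y hy; apply: nclosure_ind => [|h|y z _ _ h1 h2|y _ h1].
  - by rewrite commg1; apply: ncent1.
  - exact: good_ncent.
  - have -> : [~ p ^ g, y * z] = [~ p ^ g, z] * [~ p ^ g, y] ^ z by clear; fgroup.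
    by apply: ncentM => //; apply: ncentJ.
  - have -> : [~ p ^ g, y^-1] = [~ p ^ g, y]^-1 ^ y^-1 by clear; fgroup.
    by apply: ncentJ; apply: ncentV.
move: x hx; apply: nclosure_ind => [|h|x z _ _ h1 h2|x _ h1].
- by rewrite comm1g; apply: ncent1.
- exact: P1.
- have -> : [~ x * z, y] = [~ x, y] ^ z * [~ z, y] by clear; fgroup.
  by apply: ncentM => //; apply: ncentJ.
- have -> : [~ x^-1, y] = [~ x, y]^-1 ^ x^-1 by clear; fgroup.
  by apply: ncentJ; apply: ncentV.
Qed.

Lemma comm_central_mod z w x y : commute z x -> commute z y -> commute w x ->
  commute w y -> commute z w -> commute [~ x, y] x -> commute [~ x, y] y ->
  [~ z * x, w * y] = [~ x^-1, y^-1].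
Proof.
move=> c1 c2 c3 c4 c5 c6 c7; transitivity [~ x, y]; first by clear c6 c7; fgroup.
transitivity ([~ x, y] ^ (x^-1 * y^-1)); last by clear; fgroup.
by rewrite conj_fix //; apply: commuteM; apply: commuteV.
Qed.

(* The pairs acting in the same way on the centralizer of the normal closure of
   [p] and on the normal closure modulo its center. *)
Definition lin_sub p (k : G * G) :=
  (forall g, ncent p (p ^ (g * k.1) * (p ^ (g * k.2))^-1)) /\
  (forall z, ncent p z -> z ^ k.1 = z ^ k.2).

(** The class [v] of [(p, p^-1)] has commuting conjugates: in class 2 the commutator is bilinear, so
    inverting both arguments does not change it, and both coordinates of the commutator of two
    conjugates agree. The common value centralizes the normal closure by [good_ncent]. *)
Lemma linearization p : good p -> R3 p^-1 ->
  exists (Q : groupType) (rep : G * G -> Q -> Prop) (d : G -> Q) (v : Q),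
  [/\ [/\ forall q, exists k, rep k q, forall k q q', rep k q -> rep k q' -> q = q',
      forall k, rep k 1 -> k.1 = k.2 /\ ncent p k.1,
      forall k l q q', rep k q -> rep l q' -> rep (k * l) (q * q') &
      forall k q, rep k q -> rep k^-1 q^-1],
    forall g, rep (g, g) (d g), rep (p, p^-1) v, rep 1 1 &
    forall q q' : Q, commute (v ^ q) (v ^ q')].
Proof.
move=> gp RpV; have [Rp _ _ _] := gp.
pose N (k : G * G) := k.1 = k.2 /\ ncent p k.1.
have NK k : N k -> lin_sub p k.
  case: k => k1 k2 [/= <- _]; split=> //= g; rewrite mulgV; exact: ncent1.
have [] := @subquotient (G * G)%type (lin_sub p) N NK.
- split.
  + by apply: NK; split => //; apply: ncent1.
  + move=> [x1 x2] [y1 y2] [h1 h2] [h3 h4]; split=> /= [g|z hz]; last by rewrite !conjgM h2 // h4 //; apply: ncentJ.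
    have -> : p ^ (g * (x1 * y1)) * (p ^ (g * (x2 * y2)))^-1 =
       (p ^ (g * x1) * (p ^ (g * x2))^-1) ^ y1 * (p ^ (g * x2 * y1) * (p ^ (g * x2 * y2))^-1) by clear; fgroup.
    by apply: ncentM; [apply: ncentJ|]; [exact: h1|exact: h3].
  + move=> [x1 x2] [h1 h2]; split=> /= [g|z hz].
      have -> : p ^ (g * x1^-1) * (p ^ (g * x2^-1))^-1 =
        ((p ^ (g * x1^-1 * x1) * (p ^ (g * x1^-1 * x2))^-1)^-1) ^ x2^-1 by clear; fgroup.
      by apply: ncentJ; apply: ncentV; exact: h1.
    have := h2 _ (ncentJ x1^-1 hz); rewrite /= -[LHS]conjgM mulVg conjg1 => {2}->.
    by clear; fgroup.
- split.
  + by split => //; apply: ncent1.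
  + by move=> [x1 x2] [y1 y2] [/= <- h1] [/= <- h2]; split => //; apply: ncentM.
  + by move=> [x1 x2] [/= <- h1]; split => //; apply: ncentV.
- move=> [x1 x2] [k1 k2] [/= <- h1] [_ h2]; split => //=; last by apply: ncentJ.
  exact: h2.
move=> Q [rep [[r1 r2 r3 r4] [r5 r6 r7]]].
have hd0 g : exists q, rep (g, g) q.
  by apply: r1; split=> //= h; rewrite mulgV; apply: ncent1.
have [d hd] := choice hd0.
have pp : nclosure p p by apply: nclosure_id.
have [v hv] : exists v, rep (p, p^-1) v.
  apply: r1; split=> /= [g|z hz].
    have -> : p ^ (g * p) * (p ^ (g * p^-1))^-1 = [~ p * p, (p ^ g)^-1] ^ p^-1.
      by clear; fgroup.
    apply: ncentJ; apply: good_nclosure_comm => //; first exact: nclosureM.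
    by apply: nclosureV; apply: nclosure_conj.
  have zp : commute z p by apply: ncent_nclosure pp.
  by rewrite !conj_fix //; apply: commuteV.
exists Q, rep, d, v; split=> //.
- split=> //; move=> x /r4 [h1 h2] //.
- by apply/r4; split=> //; apply: ncent1.
move=> q q'; have [[k1 k2] hk] := r2 q; have [[l1 l2] hl] := r2 q'.
have [k_1 k_2] := r7 _ _ hk; have [l_1 l_2] := r7 _ _ hl; rewrite /= in k_1 k_2 l_1 l_2.
apply: comm_commute.
have hc := r5 _ _ _ _ (r6 _ _ hk) (r5 _ _ _ _ hv hk).
have hc' := r5 _ _ _ _ (r6 _ _ hl) (r5 _ _ _ _ hv hl).
move/r3: (r5 _ _ _ _ (r6 _ _ hc) (r5 _ _ _ _ (r6 _ _ hc') (r5 _ _ _ _ hc hc'))); apply.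
apply/r4; split.
  change ([~ p ^ k1, p ^ l1] = [~ p^-1 ^ k2, p^-1 ^ l2]).
  have z1 : ncent p (p ^ k1 * (p ^ k2)^-1) by have := k_1 1; rewrite !mul1g.
  have z2 : ncent p (p ^ l1 * (p ^ l2)^-1) by have := l_1 1; rewrite !mul1g.
  have e1 : p ^ k1 = p ^ k1 * (p ^ k2)^-1 * p ^ k2 by clear; fgroup.
  have e2 : p ^ l1 = p ^ l1 * (p ^ l2)^-1 * p ^ l2 by clear; fgroup.
  rewrite e1 e2 !conjVg.
  apply: comm_central_mod; try exact: z1; try exact: z2; try exact: good_ncent.
  by apply: commuteM; [|apply: commuteV]; exact: z1.
change (ncent p [~ p ^ k1, p ^ l1]); exact: good_ncent.
Qed.
End Linearization.

(** * Commutators of two right 3-Engel elements *)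

Section Good.

Variable G : groupType.
Implicit Types a b p x y z g h : G.

Lemma good_xi_conj p x : good p -> commute [~ p, x, x] (p ^ x).
Proof.
by move=> [Rp _ _ h4]; have := commute_J2 x (h4 x); rewrite (conj_fix (Rp x)).
Qed.

Lemma good_xi_comm p x : good p -> commute [~ p, x, x] [~ p, x].
Proof.
move=> gp; have [_ _ _ h4] := gp; have -> : [~ p, x] = p^-1 * p ^ x by [].
by apply: commuteM; [apply: commuteV; exact: h4|exact: good_xi_conj].
Qed.

Lemma good_inv_engel1 p x : good p -> [~ p^-1, x] = [~ p, p ^ x]^-1 * [~ p, x]^-1.
Proof.
move=> [_ _ h3 _]; have tp : commute [~ p, p ^ x] p by have := h3 x 1; rewrite conjg1.
transitivity ([~ p, p ^ x]^-1 * (p * [~ p, p ^ x] * (p ^ x)^-1)); last by clear; fgroup.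
transitivity (p * (p ^ x)^-1); first by clear; fgroup.
by move: [~ p, p ^ x] tp; clear => t tp; fgroup.
Qed.

(** The oddness on which the passage to pairs relies: the correction [[~ p, p ^ x]] of
    [good_inv_engel1] disappears because it commutes with [x]. *)
Lemma good_inv_engel2 p x : good p -> [~ p^-1, x, x] = [~ p, x, x]^-1.
Proof.
move=> gp; have [_ h2 _ _] := gp; have tx := h2 x; have h5 := good_xi_comm x gp.
rewrite good_inv_engel1 //; move: [~ p, p ^ x] [~ p, x] tx h5; clear => t c tx h5.
have -> : [~ t^-1 * c^-1, x] = (([~ c, x])^-1) ^ c^-1 by clear h5; fgroup.
by rewrite conj_fix //; apply: commuteV; apply/commute_sym/commuteV/commute_sym.
Qed.

Lemma rep_comm (H Q : groupType) (rep : H -> Q -> Prop) :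
  (forall k l q q', rep k q -> rep l q' -> rep (k * l) (q * q')) ->
  (forall k q, rep k q -> rep k^-1 q^-1) ->
  forall k l q q', rep k q -> rep l q' -> rep [~ k, l] [~ q, q'].
Proof.
move=> M I k l q q' hk hl; rewrite /commg /conjg.
by apply: (M); [exact: I|apply: (M); [exact: I|exact: M]].
Qed.

(* The linear part of [p]: relations between commutators of [v] with elements of
   the image of [d] hold for [p] and for [p^-1] up to the same element
   centralizing the normal closure of [p]. *)
Lemma linearization_module p : good p -> R3 p^-1 ->
  exists (Q : groupType) (rep : G * G -> Q -> Prop) (d : G -> Q) (v : Q),
  [/\ [/\ abelian_normal (nclosure v), forall u, nclosure v u -> R3 u & nclosure v v],
     [/\ forall g h, d [~ g, h] = [~ d g, d h], forall b, R3 b -> R3 (d b) &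
         forall g h, commute g h -> commute (d g) (d h)],
     [/\ forall k, rep k 1 -> k.1 = k.2 /\ ncent p k.1,
      forall k l q q', rep k q -> rep l q' -> rep (k * l) (q * q'),
      forall k q, rep k q -> rep k^-1 q^-1 &
      forall k l q q', rep k q -> rep l q' -> rep [~ k, l] [~ q, q']],
     [/\ forall q, exists k, rep k q, forall k q q', rep k q -> rep k q' -> q = q' & rep 1 1] &
     (forall g, rep (g, g) (d g)) /\ rep (p, p^-1) v].
Proof.
move=> gp RpV; have [Q [rep [d [v [[r1 r2 r3 r4 r5] hd hv r6 vC]]]]] := linearization gp RpV.
have [Rp _ _ _] := gp; have rC := rep_comm r4 r5.
have eng q g h : rep (g, h) q -> R3 g -> R3 h -> R3 q.
  move=> hq Rg Rh q'; have [[k1 k2] hk] := r1 q'.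
  have c1 := rC _ _ _ _ (rC _ _ _ _ hq hk) hk.
  have h1 := r4 _ _ _ _ c1 hk; have h2 := r4 _ _ _ _ hk c1.
  apply: (r2 _ _ _ h1); suff -> : [~ (g, h), (k1, k2), (k1, k2)] * (k1, k2) =
    (k1, k2) * [~ (g, h), (k1, k2), (k1, k2)] :> G * G by [].
  exact: (f_equal2 pair (Rg k1) (Rh k2)).
have Rv : R3 v by exact: (eng _ _ _ hv Rp RpV).
exists Q, rep, d, v; split=> //.
- split; [exact: nclosure_abelian|by move=> u; apply: nclosure_R3|exact: nclosure_id].
- split=> [g h|b Rb|g h gh].
  + by apply: (r2 _ _ _ (hd _)); exact: (rC _ _ _ _ (hd g) (hd h)).
  + exact: (eng _ _ _ (hd b) Rb Rb).
  + apply: (r2 _ _ _ (r4 _ _ _ _ (hd g) (hd h))).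
    suff -> : ((g, g) * (h, h) = (h, h) * (g, g) :> G * G)%g by apply: r4.
    exact: (f_equal2 pair gh gh).
Qed.

Notation gam := (lower_central_term G).
Hypothesis TF : forall x, gam 5 x -> x * x = 1 -> x = 1.

(* First the eighth power vanishes, by oddness of the commutator in [a]. *)
Lemma good_comm a b x : good a -> R3 a^-1 -> good b ->
  [~ [~ a, x, x], [~ b, x]] = 1.
Proof.
move=> ga RaV gb; have [Rb _ _ _] := gb.
have [Q [rep [d [v [[VP VR Vv] [dC dR dc] [r1 r2 r3 r4] [_ _ r0] [hd hv]]]]]] :=
  linearization_module ga RaV.
set c := [~ b, x]; set e := [~ c, x]; set xi := [~ a, x, x].
have ec : commute e c by apply: good_xi_comm.
have ex : commute e x by apply: Rb.
have hm := @module_comm Q _ VP VR (d b) (d x) v (dR _ Rb).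
rewrite -!dC -/c -/e in hm; have [m1 m2 m3 m4] := hm (dc _ _ ec) Vv.
have hxi : rep [~ (a, a^-1), (x, x), (x, x)] [~ v, d x, d x] by apply: (r4); [apply: (r4)|].
have hla := r4 _ _ _ _ hxi (hd c).
set la := [~ xi, c].
(* In the quotient [m1] makes this fourth power trivial, so the fourth power of the pair lies on the
   diagonal. *)
have la4 : la ^+ 4 = [~ [~ a^-1, x, x], c] ^+ 4.
  have := r2 _ _ _ _ hla (r2 _ _ _ _ hla (r2 _ _ _ _ hla hla)).
  by rewrite [X in rep _ X](_ : _ = 1); [move/r1 => []|exact: m1].
have hpsi : rep [~ (a, a^-1), (e, e), (x, x)] [~ v, d e, d x] by apply: (r4); [apply: (r4)|].
have la_psi : ncent a (la * [~ a, e, x] ^+ 3).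
  have := r2 _ _ _ _ hla (r2 _ _ _ _ hpsi (r2 _ _ _ _ hpsi hpsi)).
  by rewrite [X in rep _ X](_ : _ = 1); [move/r1 => []|exact: m2].
have xi_e : ncent a [~ xi, e].
  have := r4 _ _ _ _ hxi (hd e).
  have -> : [~ v, d x, d x, d e] = 1.
    rewrite -m3; have := dc _ _ ex; clear -VP Vv; move: (d e) (d x) => e' x' h.
    by gmod [:: v] [:: e'; x'].
  by move=> /r1[].
have gxi : nclosure a xi by apply: nclosureR; apply: nclosureR; apply: nclosure_id.
have xi_ae : commute xi (a ^ e).
  have -> : xi = xi ^ e * [~ xi, e]^-1 by clear; fgroup.
  apply: commute_sym; apply: commuteM.
    by apply: commute_sym; apply: commute_J2; have [_ _ _ h4] := ga; exact: h4.
  by apply: commuteV; apply: commute_sym; exact: xi_e.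
have xi_x : commute xi x by case: ga => h _ _ _; apply: h.
have xi_a : commute xi a by have [_ _ _ h4] := ga; exact: h4.
have xi_psi : commute xi [~ a, e, x].
  have h1 : commute xi [~ a, e] by apply: commuteM; [apply: commuteV|].
  by apply: commuteM; [apply: commuteV|rewrite -(conj_fix xi_x); apply: commute_J2].
(* Needed to turn [[~ xi^-1, c]] into [la^-1]. *)
have xi_la : commute xi la.
  have -> : la = (la * [~ a, e, x] ^+ 3) * [~ a, e, x] ^- 3 by clear; fgroup.
  apply: commuteM; last by apply: commuteV; apply: commuteX.
  by apply: commute_sym; apply: ncent_nclosure gxi.
have g5 : gam 5 la.
  apply: (@lct_comm G 3 2) => //; last exact: lct_comm1.
  by apply: lct_comm1; apply: lct_comm1.
apply: (TF8 TF g5).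
have -> : la ^+ 8 = la ^+ 4 * la ^+ 4 by clear; fgroup.
rewrite {2}la4 good_inv_engel2 // -/xi.
have -> : [~ xi^-1, c] = la^-1.
  have h : commute la^-1 xi^-1 by apply: commuteV; apply/commute_sym/commuteV.
  by rewrite -[RHS](conj_fix h) /la; clear; fgroup.
by clear; fgroup.
Qed.

End Good.

Section NormalClosureWords.

Variables (G : groupType) (v : G).
Hypothesis VP : abelian_normal (nclosure v).

Lemma nclosure_comm2 g h : (forall q, [~ v ^ q, g, h] = 1) ->
  forall u, nclosure v u -> [~ u, g, h] = 1.
Proof.
move=> H; apply: nclosure_ind => // [|x y Vx Vy h1 h2|x Vx h1].
- by rewrite !comm1g.
- transitivity ([~ x, g, h] * [~ y, g, h]); last by rewrite h1 h2 mul1g.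
  by clear h1 h2; gmod [:: x; y] [:: g; h].
- transitivity [~ x, g, h]^-1; last by rewrite h1 invg1.
  by clear h1; gmod [:: x] [:: g; h].
Qed.

Lemma nclosure_comm3 g h k : (forall q, [~ v ^ q, g, h, k] = 1) ->
  forall u, nclosure v u -> [~ u, g, h, k] = 1.
Proof.
move=> H; apply: nclosure_ind => // [|x y Vx Vy h1 h2|x Vx h1].
- by rewrite !comm1g.
- transitivity ([~ x, g, h, k] * [~ y, g, h, k]); last by rewrite h1 h2 mul1g.
  by clear h1 h2; gmod [:: x; y] [:: g; h; k].
- transitivity [~ x, g, h, k]^-1; last by rewrite h1 invg1.
  by clear h1; gmod [:: x] [:: g; h; k].
Qed.

End NormalClosureWords.

(** * Bilinear calculus in a normal closure of class two *)

Section ClassTwo.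

Variables (G : groupType) (b : G).
Hypothesis gb : good b.
Implicit Types g h u x y z : G.
Local Notation B := (nclosure b).
Local Notation Z := (ncent b).

Lemma cl2_comm x y : B x -> B y -> Z [~ x, y]. Proof. exact: good_nclosure_comm. Qed.

Lemma cl2Ml x y z : B x -> B y -> B z -> [~ x * y, z] = [~ x, z] * [~ y, z].
Proof.
move=> Bx By Bz; have h : commute [~ x, z] y by apply: ncent_nclosure (By); apply: cl2_comm.
by rewrite -[in RHS](conj_fix h); clear; fgroup.
Qed.

Lemma cl2Mr x y z : B x -> B y -> B z -> [~ x, y * z] = [~ x, y] * [~ x, z].
Proof.
move=> Bx By Bz; have h : commute [~ x, y] z by apply: ncent_nclosure (Bz); apply: cl2_comm.
have h' : commute [~ x, y] [~ x, z].
  by apply: commuteR => //; apply: ncent_nclosure (Bx); apply: cl2_comm.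
by rewrite h' -[in RHS](conj_fix h); clear; fgroup.
Qed.

Lemma cl2Vl x y : B x -> B y -> [~ x^-1, y] = [~ x, y]^-1.
Proof.
move=> Bx By; apply: comm_invl; apply: ncent_nclosure (Bx); exact: cl2_comm.
Qed.

Lemma cl2_ncent z y : Z z -> B y -> [~ z, y] = 1.
Proof. by move=> Zz By; apply: commute_comm; apply: ncent_nclosure (By). Qed.

(* Commutators with elements of the normal closure only depend on the class
   modulo the centralizer. *)
Lemma cl2_ncentM u z y : B u -> Z z -> B y -> [~ u * z, y] = [~ u, y].
Proof.
move=> Bu Zz By; have h : commute [~ u, y] z.
  by apply: commute_sym; apply: ncent_nclosure Zz _; apply: nclosureR.
have -> : [~ u * z, y] = [~ u, y] ^ z * [~ z, y] by clear; fgroup.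
by rewrite (cl2_ncent Zz By) mulg1 conj_fix.
Qed.

Lemma cl2_R x g : Z x -> Z [~ x, g].
Proof. by move=> h; apply: ncentM; [apply: ncentV|apply: ncentJ]. Qed.

(** The failure of u |-> [u, g] to be additive is a commutator inside the closure, and commutators
    with [n] do not see it. *)
Lemma cl2_engelM x y g n : B x -> B y -> B n ->
  [~ [~ x * y, g], n] = [~ [~ x, g], n] * [~ [~ y, g], n] /\
  [~ [~ x * y, g, g], n] = [~ [~ x, g, g], n] * [~ [~ y, g, g], n].
Proof.
move=> Bx By Bn; have Bx1 := nclosureR g Bx; have By1 := nclosureR g By.
have Bx2 := nclosureR g Bx1; have By2 := nclosureR g By1.
have e1 : [~ x * y, g] = [~ x, g] * [~ y, g] * [~ [~ x, g], y] ^ [~ y, g] by clear; fgroup.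
have Z1 : Z ([~ [~ x, g], y] ^ [~ y, g]) by apply: ncentJ; apply: cl2_comm.
have B12 := nclosureM Bx1 By1; have B22 := nclosureM Bx2 By2.
split; first by rewrite e1 (cl2_ncentM B12 Z1 Bn) cl2Ml.
move: ([~ [~ x, g], y] ^ [~ y, g]) e1 Z1 => z -> Zz.
have e2 : [~ [~ x, g] * [~ y, g] * z, g] =
    [~ x, g, g] * [~ y, g, g] * ([~ [~ x, g, g], [~ y, g]] ^ [~ y, g, g] *
     [~ [~ [~ x, g] * [~ y, g], g], z] * [~ z, g]) by clear; fgroup.
have Zr : Z ([~ [~ x, g, g], [~ y, g]] ^ [~ y, g, g] *
     [~ [~ [~ x, g] * [~ y, g], g], z] * [~ z, g]).
  apply: ncentM; last exact: cl2_R.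
  apply: ncentM; first by apply: ncentJ; apply: cl2_comm.
  have -> : [~ [~ [~ x, g] * [~ y, g], g], z] = [~ z, [~ [~ x, g] * [~ y, g], g]]^-1 by clear; fgroup.
  by rewrite cl2_ncent ?invg1 //; [exact: ncent1|exact: nclosureR].
by rewrite e2 (cl2_ncentM B22 Zr Bn) cl2Ml.
Qed.

(* The condition that [y] be right 3-Engel at [n * x], to first order in [n]. *)
Lemma cl2_polar_R3 y n x : R3 y -> B y -> B n ->
  [~ [~ y, x, x], n] * [~ [~ y, x], n, x] * [~ y, n, x, x] = 1.
Proof.
move=> Ry By Bn; have By1 := nclosureR x By; have By2 := nclosureR x By1.
have y2x : commute [~ y, x, x] x := Ry x.
have h := commute_comm (Ry (n * x)).
have Zq : Z [~ y, n] by apply: cl2_comm.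
have Bq : B [~ y, n] by apply: nclosureR.
have Zq1 : Z [~ [~ y, x], n] by apply: cl2_comm.
have Bq1 : B [~ [~ y, x], n] by apply: nclosureR.
have Zq2 : Z [~ [~ y, x, x], n] by apply: cl2_comm.
have e1 : [~ y, n * x] = [~ y, x] * [~ y, n] ^ x by clear; fgroup.
have e2 : [~ y, n * x, n * x] = [~ y, x, x] * ([~ y, n, x] * [~ [~ y, x], n]) ^ x.
  rewrite e1; have Zz : Z ([~ y, n] ^ x) by apply: ncentJ.
  have -> : [~ [~ y, x] * [~ y, n] ^ x, n * x] =
     [~ y, x, x] ^ ([~ y, n] ^ x) * [~ [~ y, n] ^ x, x] * [~ [~ y, x] * [~ y, n] ^ x, n] ^ x.
    by clear; fgroup.
  rewrite (cl2_ncentM By1 Zz Bn) conj_fix; first by clear; fgroup.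
  by apply: commute_sym; apply: ncent_nclosure (By2).
set s0 := [~ y, n, x] * [~ [~ y, x], n] in e2.
have Zs0 : Z s0 by apply: ncentM => //; apply: cl2_R.
have Bs0 : B s0 by apply: nclosureM => //; apply: nclosureR.
have e3 : [~ y, n * x, n * x, n * x] = ([~ s0, x] * [~ [~ y, x, x], n]) ^ x.
  rewrite e2; have Zz : Z (s0 ^ x) by apply: ncentJ.
  have -> : [~ [~ y, x, x] * s0 ^ x, n * x] =
     [~ y, x, x, x] ^ (s0 ^ x) * [~ s0 ^ x, x] * [~ [~ y, x, x] * s0 ^ x, n] ^ x.
    by clear; fgroup.
  by rewrite (cl2_ncentM By2 Zz Bn) (commute_comm y2x) conj1g; clear; fgroup.
rewrite e3 in h; have {}h : [~ s0, x] * [~ [~ y, x, x], n] = 1.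
  by apply: (conjg_inj x); rewrite h conj1g.
have c1 : commute [~ s0, x] [~ [~ y, x, x], n].
  by apply: ncent_nclosure (cl2_R x Zs0) _; apply: nclosureR.
rewrite c1 in h; rewrite -h -mulgA; congr (_ * _).
have Z2 := cl2_R x Zq; have B2 := nclosureR x Bq.
have c2 : commute [~ y, n, x, x] [~ [~ y, x], n].
  by apply: ncent_nclosure (Bq1); apply: cl2_R.
have c3 : commute [~ y, n, x, x] [~ [~ y, x], n, x].
  by apply: ncent_nclosure (nclosureR x Bq1); apply: cl2_R.
have -> : [~ s0, x] = [~ y, n, x, x] ^ [~ [~ y, x], n] * [~ [~ y, x], n, x].
  by rewrite /s0; clear; fgroup.
by rewrite (conj_fix c2) c3.
Qed.

(* The case of an arbitrary element of the normal closure follows by linearity. *)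
Lemma cl2_polar y n x : B y -> B n ->
  [~ [~ y, x, x], n] * [~ [~ y, x], n, x] * [~ y, n, x, x] = 1.
Proof.
move=> By Bn; move: y By; have [Rb _ _ _] := gb.
pose F y := [~ [~ y, x, x], n] * [~ [~ y, x], n, x] * [~ y, n, x, x].
have FM y z : B y -> B z -> F (y * z) = F y * F z.
  move=> By Bz; have [e1 e2] := @cl2_engelM y z x n By Bz Bn.
  rewrite /F e1 e2 cl2Ml //.
  have By1 := nclosureR x By; have By2 := nclosureR x By1.
  have Bz1 := nclosureR x Bz; have Bz2 := nclosureR x Bz1.
  pose W u := Z u /\ B u.
  have VW : abelian_normal W.
    split; first by split; [exact: ncent1|exact: nclosure1].
    - by move=> u u' [? ?] [? ?]; split; [exact: ncentM|exact: nclosureM].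
    - by move=> u [? ?]; split; [exact: ncentV|exact: nclosureV].
    - by move=> u g [? ?]; split; [exact: ncentJ|exact: nclosureJ].
    - by move=> u u' [Zu _] [_ Bu']; apply: ncent_nclosure (Bu').
  have w u : B u -> W [~ u, n] by move=> Bu; split; [exact: cl2_comm|exact: nclosureR].
  have w1 := w _ By; have w2 := w _ By1; have w3 := w _ By2.
  have w4 := w _ Bz; have w5 := w _ Bz1; have w6 := w _ Bz2.
  move: [~ y, n] [~ [~ y, x], n] [~ [~ y, x, x], n] [~ z, n] [~ [~ z, x], n] [~ [~ z, x, x], n]
    w1 w2 w3 w4 w5 w6; clear -VW => a1 a2 a3 a4 a5 a6 w1 w2 w3 w4 w5 w6.
  by gmod [:: a1; a2; a3; a4; a5; a6] [:: x].
have F1 : F 1 = 1 by rewrite /F !comm1g !mulg1.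
apply: nclosure_ind => [|h|y z By Bz|y By h].
- exact: F1.
- by apply: cl2_polar_R3 => //; [exact: R3_conj|exact: nclosure_conj].
- by move=> h1 h2; rewrite -/(F _) FM // -/(F y) -/(F z); rewrite /F h1 h2 mul1g.
- have h' : F y = 1 := h; have := FM y y^-1 By (nclosureV By).
  by rewrite mulgV F1 h' mul1g => /esym.
Qed.

End ClassTwo.

(** * The commutator of the second kind, with the entry from [a] repeated *)

Section SecondCommutator.

Variable G : groupType.
Implicit Types a b p x y z g h n : G.
Notation gam := (lower_central_term G).
Hypothesis TF : forall x, gam 5 x -> x * x = 1 -> x = 1.

Lemma cl2_center b : good b -> abelian_normal (fun u => ncent b u /\ nclosure b u).
Proof.
split; first by split; [exact: ncent1|exact: nclosure1].
- by move=> u u' [? ?] [? ?]; split; [exact: ncentM|exact: nclosureM].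
- by move=> u [? ?]; split; [exact: ncentV|exact: nclosureV].
- by move=> u g [? ?]; split; [exact: ncentJ|exact: nclosureJ].
- by move=> u u' [Zu _] [_ Bu']; apply: ncent_nclosure Bu'.
Qed.

Lemma cl2MM b x y z w : good b -> nclosure b x -> nclosure b y -> nclosure b z ->
  nclosure b w -> [~ x * y, z * w] = [~ x, z] * [~ x, w] * [~ y, z] * [~ y, w].
Proof.
move=> gb Bx By Bz Bw; have Bzw := nclosureM Bz Bw.
by rewrite (cl2Ml gb Bx By Bzw) (cl2Mr gb Bx Bz Bw) (cl2Mr gb By Bz Bw); clear; fgroup.
Qed.

(** Let [aij] be the commutator of [y = b ^ h], bracketed i times with [x], and [n], bracketed j
    times with [x]. Additively, [cl2_polar] for (y, n) and (n, y) gives 3 a20 + 3 a11 + 3 a21 = 0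
    and a20 + 3 a11 + 2 a21 = 0. Bracketing the second with [x] gives 4 a21 = 0, and the difference
    is 2 a20 + a21 = 0; both elements have weight 5. *)
Lemma cl2_xi_comm b h x n : good b -> nclosure b n -> gam 2 n -> ncent b [~ n, x, x] ->
  [~ [~ b ^ h, x, x], n] = 1.
Proof.
move=> gb Bn gn Zn2; have [Rb _ _ _] := good_conj h gb.
have yx2 : commute [~ b ^ h, x, x] x := Rb x.
set y := b ^ h in Rb yx2 *.
have By : nclosure b y by apply: nclosure_conj.
have By1 := nclosureR x By; have By2 := nclosureR x By1; have Bn1 := nclosureR x Bn.
have L1 := cl2_polar gb x By Bn; have L2 := cl2_polar gb x Bn By.
rewrite (cl2_ncent Zn2 By) mul1g in L2.
have sw (u w : G) : [~ u, w] = [~ w, u]^-1 by clear; fgroup.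
rewrite [X in [~ X, _] * _]sw [X in _ * [~ X, _, _]]sw in L2.
have W u w : nclosure b u -> nclosure b w -> ncent b [~ u, w] /\ nclosure b [~ u, w].
  by move=> Bu Bw; split; [exact: cl2_comm|exact: nclosureR].
have JM g (u w : G) : [~ u, w] ^ g = [~ u * [~ u, g], w * [~ w, g]] by clear; fgroup.
have nz u : nclosure b u -> [~ u, [~ n, x] * [~ n, x, x]] = [~ u, [~ n, x]].
  by move=> Bu; rewrite sw (cl2_ncentM Bn1 Zn2 Bu) -sw.
have q00 : [~ y, n] ^ x = [~ y, n] * [~ y, [~ n, x]] * [~ [~ y, x], n] * [~ [~ y, x], [~ n, x]].
  by rewrite JM (cl2MM gb).
have q10 : [~ [~ y, x], n] ^ x = [~ [~ y, x], n] * [~ [~ y, x], [~ n, x]] *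
    [~ [~ y, x, x], n] * [~ [~ y, x, x], [~ n, x]].
  by rewrite JM (cl2MM gb).
have q20 : [~ [~ y, x, x], n] ^ x = [~ [~ y, x, x], n] * [~ [~ y, x, x], [~ n, x]].
  by rewrite JM (commute_comm yx2) mulg1 (cl2Mr gb By2 Bn Bn1).
have q01 : [~ y, [~ n, x]] ^ x = [~ y, [~ n, x]] * [~ [~ y, x], [~ n, x]].
  by rewrite JM (nz _ (nclosureM By By1)) (cl2Ml gb By By1 Bn1).
have q11 : [~ [~ y, x], [~ n, x]] ^ x = [~ [~ y, x], [~ n, x]] * [~ [~ y, x, x], [~ n, x]].
  by rewrite JM (nz _ (nclosureM By1 By2)) (cl2Ml gb By1 By2 Bn1).
have q21 : [~ [~ y, x, x], [~ n, x]] ^ x = [~ [~ y, x, x], [~ n, x]].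
  by rewrite JM (commute_comm yx2) mulg1 nz.
have gy2 : gam 3 [~ y, x, x] by apply: lct_comm1; apply: lct_comm1.
have g21 : gam 5 [~ [~ y, x, x], [~ n, x]].
  by apply: (@lct_comm G 3 2) => //; apply: lct_comm1.
have g20 : gam 5 [~ [~ y, x, x], n] by apply: (@lct_comm G 3 2).
have VW := cl2_center gb.
have w1 := W _ _ By Bn; have w2 := W _ _ By1 Bn; have w3 := W _ _ By2 Bn.
have w4 := W _ _ By Bn1; have w5 := W _ _ By1 Bn1; have w6 := W _ _ By2 Bn1.
move: [~ y, n] [~ [~ y, x], n] [~ [~ y, x, x], n] [~ y, [~ n, x]] [~ [~ y, x], [~ n, x]]
  [~ [~ y, x, x], [~ n, x]] w1 w2 w3 w4 w5 w6 q00 q10 q20 q01 q11 q21 L1 L2 g21 g20.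
clear -VW TF => a00 a10 a20 a01 a11 a21 w1 w2 w3 w4 w5 w6 q00 q10 q20 q01 q11 q21 L1 L2 g21 g20.
have e4 : a21 ^+ 4 = 1.
  transitivity [~ [~ a01^-1, x] * [~ a00^-1, x, x], x]^-1; last by rewrite L2 comm1g invg1.
  by clear L1 L2; gmod [:: a00; a10; a20; a01; a11; a21] [:: x].
have e1 := TF4 TF g21 e4.
apply: TF => //; transitivity ((a20 * [~ a10, x] * [~ a00, x, x]) *
    ([~ a01^-1, x] * [~ a00^-1, x, x]) * a21^-1).
  by clear L1 L2 e4 e1; gmod [:: a00; a10; a20; a01; a11; a21] [:: x].
by rewrite L1 L2 e1 invg1 !mulg1.
Qed.

(** Use [good_comm] at [x * c]: there [[~ a, x * c, x * c]] is still [e], while [[~ b, x * c]] is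
    [[~ b, c]] times a conjugate of [[~ b, x]] already known to commute with [e]. *)
Lemma good_comm_mixed a b x : good a -> R3 a^-1 -> good b ->
  commute [~ a, x, x] [~ b, [~ a, x]].
Proof.
move=> ga RaV gb; have [Ra h2 h3 h4] := ga.
set c := [~ a, x]; set e := [~ c, x].
have h1 := good_comm TF x ga RaV gb; have h := good_comm TF (x * c) ga RaV gb.
have ec : commute e c by apply: good_xi_comm.
have ta : commute [~ a, a ^ x] a by have := h3 x 1; rewrite conjg1.
have tc : commute [~ a, a ^ x] c by apply: commuteM; [apply: commuteV|].
have eac : [~ a, x * c] = [~ a, a ^ x] * c.
  transitivity ([~ a, a ^ x] * c ^ c); first by rewrite /c; clear; fgroup.
  by rewrite (conj_fix (commute_refl c)).
have e2 : [~ a, x * c, x * c] = e.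
  rewrite eac; transitivity (c^-1 * [~ [~ a, a ^ x], x * c] * c * e ^ c).
    by rewrite /e; clear; clearbody c; move: ([~ a, a ^ x]) => t; fgroup.
  have txc : commute [~ a, a ^ x] (x * c) by apply: commuteM.
  by rewrite (commute_comm txc) mulg1 mulVg mul1g (conj_fix ec).
rewrite e2 in h.
have {}h : commute e ([~ b, c] * [~ b, x] ^ c).
  by apply: comm_commute; rewrite -h; congr [~ _, _]; clear; clearbody c; fgroup.
have hb : commute e ([~ b, x] ^ c).
  by rewrite -(conj_fix ec); apply: commute_J2; apply: comm_commute.
have -> : [~ b, c] = [~ b, c] * [~ b, x] ^ c * ([~ b, x] ^ c)^-1 by clear; fgroup.
by apply: commuteM => //; apply: commuteV.
Qed.

Lemma good_second a b x (c := [~ a, x]) (e := [~ c, x]) :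
  good a -> R3 a^-1 -> good b -> good b^-1 ->
  [/\ [~ b, x, c, c] = [~ b^-1, x, c, c] /\ ncent b [~ b, x, c, c],
     ncent b [~ b, c, x, x], ncent b ([~ b, e] * [~ b, c, x] * [~ b, a, x, x]),
     ncent b [~ b, c, c, x] &
     ncent b ([~ b, x, c] * ([~ b, c, x] * [~ b, e]^-1)^-1)].
Proof.
move=> ga RaV gb gbV; have [Ra _ _ _] := ga; have [RbV _ _ _] := gbV.
have [Rb _ _ _] := gb.
have [Q [rep [d [v [[VP VR Vv] [dC dR dc] [r1 r2 r3 r4] [rs rf r0] [hd hv]]]]]] :=
  linearization_module gb RbV.
have ec : commute (d e) (d c) by apply: dc; apply: good_xi_comm.
have eq1 q : rep (1, 1) q -> q = 1 by move=> h; exact: rf h r0.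
have rv q g h : exists k1 k2, rep ([~ b ^ k1, g, h], [~ b^-1 ^ k2, g, h]) [~ v ^ q, d g, d h].
  have [[k1 k2] hk] := rs q; exists k1, k2.
  exact: (r4 _ _ _ _ (r4 _ _ _ _ (r2 _ _ _ _ (r3 _ _ hk) (r2 _ _ _ _ hv hk)) (hd g)) (hd h)).
have xe0 u : nclosure v u -> [~ u, d x, d e] = 1.
  apply: (nclosure_comm2 VP) => q; have [k1 [k2 hk]] := rv q x e; apply: eq1.
  suff [e1 e2] : [~ b ^ k1, x, e] = 1 /\ [~ b^-1 ^ k2, x, e] = 1 by rewrite -{1}e1 -e2.
  by split; apply/commute_comm/commute_sym/comm_commute/(good_comm TF) => //; apply: good_conj.
have ce0 u : nclosure v u -> [~ u, d c, d e] = 1.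
  apply: (nclosure_comm2 VP) => q; have [k1 [k2 hk]] := rv q c e; apply: eq1.
  suff [e1 e2] : [~ b ^ k1, c, e] = 1 /\ [~ b^-1 ^ k2, c, e] = 1 by rewrite -{1}e1 -e2.
  by split; apply/commute_comm/commute_sym/good_comm_mixed => //; apply: good_conj.
have xxc0 u : nclosure v u -> [~ u, d x, d x, d c] = 1.
  apply: (nclosure_comm3 VP) => q; have [k1 [k2 hk]] := rv q x x; apply: eq1.
  have {}hk := r4 _ _ _ _ hk (hd c).
  suff [e1 e2] : [~ b ^ k1, x, x, c] = 1 /\ [~ b^-1 ^ k2, x, x, c] = 1 by rewrite -{1}e1 -e2.
  split; apply: (good_comm TF) => //; try exact: good_conj.
    by rewrite -conjVg; apply: R3_conj.
  by rewrite -conjVg invgK; apply: R3_conj.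
rewrite /e /c !dC in ec xe0 ce0 xxc0.
have s1 := second_xcc VP VR (dR _ Ra) ec xe0 xxc0 ce0 Vv.
have s2 := second_cxx VP VR (dR _ Ra) ec xe0 Vv.
have s3 := second_lin VP (dR _ Ra) xe0 Vv.
have s4 := second_ccx VP VR (dR _ Ra) ec xe0 xxc0 ce0 Vv.
have s5 := second_xc VP VR (dR _ Ra) ec xe0 ce0 Vv.
rewrite -!dC -/c -/e in s1 s2 s3 s4 s5.
have k1 g : rep [~ (b, b^-1), (g, g)] [~ v, d g] by apply: (r4).
have k2 g h : rep [~ (b, b^-1), (g, g), (h, h)] [~ v, d g, d h] by apply: (r4).
have k3 g h k : rep [~ (b, b^-1), (g, g), (h, h), (k, k)] [~ v, d g, d h, d k] by apply: (r4).
have t1 := k3 x c c; have t2 := k3 c x x; have t4 := k3 c c x.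
have t3 := r2 _ _ _ _ (r2 _ _ _ _ (k1 e) (k2 c x)) (k3 a x x).
have t5 := r2 _ _ _ _ (k2 x c) (r3 _ _ (r2 _ _ _ _ (k2 c x) (r3 _ _ (k1 e)))).
rewrite s1 in t1; rewrite s2 in t2; rewrite s4 in t4; rewrite s3 in t3; rewrite s5 mulgV in t5.
have [t1a t1b] := r1 _ t1; have [_ t2b] := r1 _ t2; have [_ t3b] := r1 _ t3.
by have [_ t4b] := r1 _ t4; have [_ t5b] := r1 _ t5; split.
Qed.

(** Modulo the centralizer [N] of the intersection of the two normal closures, both closures become
    abelian, as [second_cube] requires. *)
Lemma good_cube a b x (c := [~ a, x]) (e := [~ c, x]) u :
  good a -> R3 a^-1 -> good b -> R3 b^-1 -> nclosure a u -> nclosure b u ->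
  commute ([~ b, e] ^+ 2 * [~ b, c, x] ^+ 6) u.
Proof.
move=> ga RaV gb RbV Au Bu; have [Ra _ _ _] := ga; have [Rb _ _ _] := gb.
pose N (z : G) := forall u, nclosure a u -> nclosure b u -> commute z u.
have N1 : N 1 by move=> w _ _; apply: commute_sym; apply: commute1.
have NM z w : N z -> N w -> N (z * w).
  by move=> h h' v Av Bv; apply/commute_sym/commuteM; apply: commute_sym; [apply: h|apply: h'].
have NV z : N z -> N z^-1.
  by move=> h v Av Bv; apply/commute_sym/commuteV/commute_sym; apply: h.
have NJ z k : N z -> True -> N (z ^ k).
  move=> h _ v Av Bv; rewrite -[v](conjgKV k); apply: commute_J2.
  by apply: h; apply: nclosureJ.
have [Q [rep [[q1 q2 q3 q4] [q5 q6 _]]]] := @subquotient G (fun _ => True) N (fun _ _ => I)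
  (And3 I (fun _ _ _ _ => I) (fun _ _ => I)) (And3 N1 NM NV) NJ.
have qC := rep_comm q5 q6.
have hd0 g : exists q, rep g q by apply: q1.
have [d hd] := choice hd0.
have dE g q : rep g q -> d g = q by move=> h; exact: q3 (hd g) h.
have dR g h : d [~ g, h] = [~ d g, d h] by apply: dE; apply: qC.
have dM g h : d (g * h) = d g * d h by apply: dE; apply: (q5).
have dV g : d g^-1 = (d g)^-1 by apply: dE; apply: (q6).
have dJ g h : d (g ^ h) = d g ^ d h by rewrite /conjg !dM dV.
have ds q : exists g, q = d g by have [g hg] := q2 q; exists g; rewrite (dE _ _ hg).
have dc g h : commute g h -> commute (d g) (d h) by rewrite /commute -!dM => ->.
have d1 : d 1 = 1 by apply: dE; apply/q4.
have dR3 p : R3 p -> R3 (d p) by move=> Rp q; have [g ->] := ds q; rewrite -!dR; apply: dc.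
have dab p : (forall z, ncent p z -> N z) -> good p ->
    forall q q', commute (d p ^ q) (d p ^ q').
  move=> hN gp q q'; have [g ->] := ds q; have [h ->] := ds q'.
  rewrite -!dJ; apply: comm_commute; rewrite -dR; apply: dE; apply/q4; apply: hN.
  exact: good_ncent.
have abA : abelian_normal (nclosure (d a)).
  by apply: nclosure_abelian; apply: dab => // z Zz w Aw _; apply: ncent_nclosure Aw.
have cB : forall q q', commute (d b ^ q) (d b ^ q').
  by apply: dab => // z Zz w _ Bw; apply: ncent_nclosure Bw.
have abB := nclosure_abelian cB.
have VR w : nclosure (d b) w -> R3 w by apply: nclosure_R3 => //; apply: dR3.
have ec : commute (d e) (d c) by apply: dc; apply: good_xi_comm.
have xe0 w : nclosure (d b) w -> [~ w, d x, d e] = 1.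
  apply: (nclosure_comm2 abB) => q; have [g ->] := ds q; rewrite -dJ -!dR -d1; congr d.
  by apply/commute_comm/commute_sym/comm_commute/(good_comm TF) => //; apply: good_conj.
have ce0 w : nclosure (d b) w -> [~ w, d c, d e] = 1.
  apply: (nclosure_comm2 abB) => q; have [g ->] := ds q; rewrite -dJ -!dR -d1; congr d.
  by apply/commute_comm/commute_sym/good_comm_mixed => //; apply: good_conj.
have xxc0 w : nclosure (d b) w -> [~ w, d x, d x, d c] = 1.
  apply: (nclosure_comm3 abB) => q; have [g ->] := ds q; rewrite -dJ -!dR -d1; congr d.
  by apply: (good_comm TF) => //; [apply: good_conj|rewrite -conjVg; apply: R3_conj].
rewrite /e /c !dR in ec xe0 ce0 xxc0.
have ia : nclosure (d a) (d a) by apply: nclosure_id.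
have ib : nclosure (d b) (d b) by apply: nclosure_id.
have := second_cube abB VR (dR3 _ Ra) ec xe0 abA ia ib.
rewrite -!dR -/c -/e => h; suff : N ([~ b, e] ^+ 2 * [~ b, c, x] ^+ 6) by apply.
apply/q4; rewrite -h.
have dX g (n : nat) : rep (g ^+ n) (d g ^+ n).
  by elim: n => [|n IH]; [apply/q4|rewrite !expgS; apply: (q5)].
by apply: (q5).
Qed.

Lemma nclosureX b x k : nclosure b x -> nclosure b (x ^+ k).
Proof.
by move=> Bx; elim: k => [|k IH]; [exact: nclosure1|rewrite expgS; apply: nclosureM].
Qed.

Lemma cl2Xl b x z k : good b -> nclosure b x -> nclosure b z -> [~ x ^+ k, z] = [~ x, z] ^+ k.
Proof.
move=> gb Bx Bz; elim: k => [|k IH]; first by rewrite !expg0 comm1g.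
by rewrite !expgS (cl2Ml gb Bx (nclosureX k Bx) Bz) IH.
Qed.

(** By [good_second] the element [th] is the same for [b] and [b^-1]. Expanding the expression for
    [b^-1] gives [th^-1] with a correction from [[~ b, be]], and that correction is a square of
    [[~ mu, m]] up to sign; [om2] makes it trivial. *)
Lemma good_comm2 a b x : good a -> R3 a^-1 -> good b -> good b^-1 ->
  [~ [~ b, x], [~ a, x], [~ a, x]] = 1.
Proof.
move=> ga RaV gb gbV; have [_ _ _ hb4] := gb.
have [[t1 Zth] t2 t3 t4 t5] := good_second x ga RaV gb gbV.
have cube u := good_cube x ga RaV gb (let: And4 h _ _ _ := gbV in h) (u := u).
set c := [~ a, x] in t1 Zth t2 t3 t4 t5 cube *.
set e := [~ c, x] in t3 t5 cube.
set be := [~ b, x] in t1 Zth t5 *.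
have Aa : nclosure a a by apply: nclosure_id. have Bb : nclosure b b by apply: nclosure_id.
have Ac : nclosure a c by apply: nclosureR.
have AR u w : nclosure a w -> nclosure a [~ u, w].
  move=> Aw; have -> : [~ u, w] = [~ w, u]^-1 by clear; fgroup.
  by apply: nclosureV; apply: nclosureR.
have Bbe : nclosure b be by apply: nclosureR.
set m := [~ b, c] in t2 t3 t4 t5 cube; set mu := [~ be, c] in t1 Zth t5 *.
set n := [~ b, e] in t3 t5 cube.
have Am : nclosure a m by apply: AR. have Amu : nclosure a mu by apply: AR.
have Bm : nclosure b m by apply: nclosureR. have Bmu : nclosure b mu by apply: nclosureR.
have Bn : nclosure b n by apply: nclosureR.
have Bm1 : nclosure b [~ m, x] by apply: nclosureR.
have Bm2 : nclosure b [~ m, c] by apply: nclosureR.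
have gm : gam 2 m by apply: lct_comm1.
have p1 : [~ [~ b, x, x], m] = 1.
  by have := cl2_xi_comm 1 gb Bm gm t2; rewrite conjg1.
have p2 := cl2_xi_comm a gb Bm gm t2.
have p3 : [~ [~ b, a, x, x], m] = 1.
  have Bba : nclosure b (b ^ a) by apply: nclosure_conj.
  have [_] := cl2_engelM gb x (nclosureV Bb) Bba Bm.
  rewrite p2 good_inv_engel2 // mulg1 -[b^-1 * b ^ a]/([~ b, a]) => ->.
  by apply: commute_comm; apply/commute_sym/commuteV/commute_sym/comm_commute.
have e1 : [~ n, m] * [~ [~ m, x], m] = 1.
  have Bk : nclosure b [~ b, a, x, x] by do !apply: nclosureR.
  have := cl2_ncent t3 Bm; rewrite (cl2Ml gb) ?(cl2Ml gb Bn) ?p3 ?mulg1 //.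
  exact: nclosureM.
have e2 : [~ mu, m] = [~ [~ m, x], m] * [~ n, m]^-1.
  have Bu : nclosure b ([~ m, x] * n^-1) by apply: nclosureM => //; apply: nclosureV.
  have -> : mu = [~ m, x] * n^-1 * (mu * ([~ m, x] * n^-1)^-1).
    have := ncent_nclosure t5 Bu; move: ([~ m, x] * n^-1); clear; clearbody mu => u h.
    by rewrite -h; fgroup.
  by rewrite (cl2_ncentM Bu t5 Bm) (cl2Ml gb Bm1 (nclosureV Bn) Bm) (cl2Vl gb Bn Bm).
have e3 : [~ n, m] ^+ 2 * [~ [~ m, x], m] ^+ 6 = 1.
  rewrite -(cl2Xl 2 gb Bn Bm) -(cl2Xl 6 gb Bm1 Bm).
  rewrite -(cl2Ml gb (nclosureX 2 Bn) (nclosureX 6 Bm1) Bm).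
  by apply: commute_comm; apply: cube.
(* Additively, [e1] makes [[~ [~ m, x], m]] the negative of [[~ n, m]], so [[~ mu, m]] is -2
   [[~ n, m]] by [e2], and [e3] says that 4 [[~ n, m]] vanishes. *)
have om2 : [~ mu, m] * [~ mu, m] = 1.
  have e4 : [~ [~ m, x], m] = [~ n, m]^-1.
    by rewrite -[RHS]mulg1 -e1 mulKg.
  rewrite e4 in e2 e3; rewrite e2 -[RHS]e3; clear; fgroup.
have m2mu : [~ [~ m, c], mu] = 1.
  by apply: commute_comm; apply: ncent_nclosure Amu; apply: good_nclosure_comm.
have m2be : [~ [~ m, c], be] = 1.
  have h1 : commute [~ m, c] b by apply: hb4.
  have h2 : commute [~ m, c] (b ^ x).
    have -> : [~ m, c] = [~ m, c] ^ x * [~ [~ m, c], x]^-1 by clear; fgroup.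
    apply/commute_sym; apply: commuteM; apply: commute_sym; first exact: commute_J2.
    by apply/commute_sym/commuteV/commute_sym; apply: t4.
  by apply: commute_comm; apply: commuteM; [apply: commuteV|].
set th := [~ mu, c] in t1 Zth *.
have Bth : nclosure b th by apply: nclosureR.
have Bt : nclosure b [~ b, be] by apply: nclosureR.
have Zt : ncent b [~ b, be] by apply: good_nclosure_comm.
have ncomm u w : ncent b u -> nclosure b w -> commute u w by apply: ncent_nclosure.
have JM g u w : [~ u, w] ^ g = [~ u * [~ u, g], w * [~ w, g]] by clear; fgroup.
have ncr u w z : nclosure b u -> nclosure b w -> ncent b z -> [~ u, w * z] = [~ u, w].
  move=> Bu Bw Zz; have sw (u1 u2 : G) : [~ u1, u2] = [~ u2, u1]^-1 by clear; fgroup.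
  by rewrite sw (cl2_ncentM Bw Zz Bu) -sw.
have q0 : [~ b, be] ^ c = [~ b, be] * [~ b, mu] * [~ m, be] * [~ m, mu].
  by rewrite JM -/m -/mu (cl2MM gb Bb Bm Bbe Bmu).
have q1 : [~ b, mu] ^ c = [~ b, mu] * [~ m, mu].
  by rewrite JM -/m -/th ncr // ?(cl2Ml gb Bb Bm Bmu) //; exact: nclosureM.
have q2 : [~ m, be] ^ c = [~ m, be] * [~ m, mu].
  by rewrite JM -/mu (cl2MM gb Bm Bm2 Bbe Bmu) m2be m2mu !mulg1.
have q3 : [~ m, mu] ^ c = [~ m, mu].
  by rewrite JM -/th ncr // ?(cl2Ml gb Bm Bm2 Bmu) ?m2mu ?mulg1 //; exact: nclosureM.
have tcc : [~ b, be, c, c] = [~ m, mu] * [~ m, mu].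
  have VW := cl2_center gb.
  have W u w : nclosure b u -> nclosure b w -> ncent b [~ u, w] /\ nclosure b [~ u, w].
    by move=> Bu Bw; split; [exact: good_nclosure_comm|exact: nclosureR].
  have w0 := W _ _ Bb Bbe; have w1 := W _ _ Bb Bmu; have w2 := W _ _ Bm Bbe; have w3 := W _ _ Bm Bmu.
  move: [~ b, be] [~ b, mu] [~ m, be] [~ m, mu] q0 q1 q2 q3 w0 w1 w2 w3.
  clear -VW; clearbody c => a0 a1 a2 a3 q0 q1 q2 q3 w0 w1 w2 w3.
  by gmod [:: a0; a1; a2; a3] [:: c].
have tVcc : [~ [~ b, be]^-1, c, c] = ([~ m, mu] * [~ m, mu])^-1.
  have Z1 := cl2_R c Zt; have B1 := nclosureR c Bt.
  by rewrite (comm_invl (ncomm _ _ Z1 Bt)) (comm_invl (ncomm _ _ (cl2_R c Z1) B1)) tcc.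
have S1 : [~ mu^-1, be^-1] = [~ be, mu]^-1.
  rewrite (cl2Vl gb Bmu (nclosureV Bbe)).
  have -> : [~ mu, be^-1] = [~ be^-1, mu]^-1 by clear; fgroup.
  by rewrite (cl2Vl gb Bbe Bmu) invgK.
have S2 : [~ be, mu] ^ c = [~ be, mu].
  rewrite JM -/mu -/th ncr //; last exact: nclosureM.
  have mm : [~ mu, mu] = 1 by clear; clearbody mu; fgroup.
  by rewrite (cl2Ml gb Bbe Bmu Bmu) mm mulg1.
have eb : [~ b^-1, x] = [~ b, be]^-1 * be^-1.
  rewrite good_inv_engel1 // -/be; congr (_^-1 * _).
  by rewrite /be; clear; fgroup.
have e5 : [~ b^-1, x, c] = [~ [~ b, be]^-1, c] * mu^-1 * [~ be, mu]^-1.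
  have ZT := cl2_R c (ncentV Zt).
  rewrite eb -S1; transitivity ([~ [~ b, be]^-1, c] ^ be^-1 * (mu^-1 * [~ mu^-1, be^-1])).
    by rewrite /mu; clear; clearbody be c; move: ([~ b, be]) => t; fgroup.
  rewrite conj_fix; last by apply: commuteV; apply: ncomm.
  by clear; clearbody mu be c; move: ([~ [~ b, be]^-1, c]) => t; fgroup.
have th2 : th * th = 1.
  have ZT := cl2_R c (ncentV Zt); have BT := nclosureR c (nclosureV Bt).
  have ZT2 := cl2_R c ZT; have BT2 := nclosureR c BT.
  have ZS : ncent b [~ be, mu] by apply: good_nclosure_comm.
  have BS : nclosure b [~ be, mu] by apply: nclosureR.
  have e6 : th = [~ [~ b, be]^-1, c, c] * th^-1.
    rewrite {1}t1 e5.
    have muc : mu ^ c = mu * th by rewrite /th; clear; fgroup.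
    have Tc : [~ [~ b, be]^-1, c] ^ c = [~ [~ b, be]^-1, c] * [~ [~ b, be]^-1, c, c] by clear; fgroup.
    have a1 := ncomm _ _ ZT Bmu; have a2 := ncomm _ _ ZT BS; have a3 := ncomm _ _ ZT BT2.
    have a4 := ncomm _ _ ZT Bth; have a5 := ncomm _ _ ZT2 Bmu; have a6 := ncomm _ _ ZT2 BS.
    have a7 := ncomm _ _ ZT2 Bth; have a8 := ncomm _ _ ZS Bmu; have a9 := ncomm _ _ ZS Bth.
    have a10 := ncomm _ _ Zth Bmu.
    move: [~ be, mu] [~ [~ b, be]^-1, c] [~ [~ b, be]^-1, c, c] S2 muc Tc a1 a2 a3 a4 a5 a6 a7 a8 a9 a10.
    clear; clearbody th; clearbody mu c => S T T2 S2 muc Tc a1 a2 a3 a4 a5 a6 a7 a8 a9 a10.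
    rewrite /commg conjMg conjMg !conjVg Tc muc S2; clear Tc muc S2.
    by fgroup.
  rewrite {1}e6 tVcc -mulgA mulVg mulg1.
  have -> : [~ m, mu] = [~ mu, m]^-1 by clear; fgroup.
  by rewrite -[RHS]om2; clear; fgroup.
apply: TF => //; apply: (@lct_le G 5 6) => //.
apply: (@lct_comm G 4 2) => //; last exact: lct_comm1.
by apply: (@lct_comm G 2 2) => //; apply: lct_comm1.
Qed.

End SecondCommutator.

Lemma lct_lift (G Q : groupType) (d : G -> Q) :
  (forall g h, d (g * h) = d g * d h) -> (forall q, exists g, q = d g) ->
  forall k q, lower_central_term Q k q -> exists2 g, lower_central_term G k g & q = d g.
Proof.
move=> dM ds.
have d1 : d 1 = 1 by apply: (mulgI (d 1)); rewrite -dM !mulg1.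
have dV g : d g^-1 = (d g)^-1 by apply: (mulgI (d g)); rewrite -dM !mulgV d1.
have dR g h : d [~ g, h] = [~ d g, d h] by rewrite /commg /conjg !dM !dV.
elim=> [|[|k] IH] q hq; [by have [g ->] := ds q; exists g|by have [g ->] := ds q; exists g|].
apply: (lctS hq (H := [set q | exists2 g, lower_central_term G k.+2 g & q = d g]%classic)).
  apply/is_subgroupP; split=> /=.
  - by exists 1; [exact: lct1|].
  - by move=> x y [g hg ->] [h hh ->]; exists (g * h); [exact: lctM|].
  - by move=> x [g hg ->]; exists g^-1; [exact: lctV|].
move=> x y hx; have [g hg ->] := IH _ hx; have [h ->] := ds y.
by exists [~ g, h]; [exact: lct_comm1|].
Qed.

(** * Passage to the quotient and closure under division *)

Section RightEngelSubgroup.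

Variable G : groupType.
Implicit Types a b p x y z g h : G.
Notation gam := (lower_central_term G).
Hypothesis TF : forall x, gam 5 x -> x * x = 1 -> x = 1.

(* The quotient by the central elements of exponent dividing 4 has normal
   closures of class 2 and loses nothing of [gam 5]. *)
Lemma R3_quotient : exists (Q : groupType) (d : G -> Q),
  [/\ forall g h, d [~ g, h] = [~ d g, d h],
     forall q, lower_central_term Q 5 q -> q * q = 1 -> q = 1,
     forall p, R3 p -> good (d p) /\ R3 (d p)^-1,
     forall p, R3 p -> good (d p)^-1 &
     forall g, gam 5 g -> d g = 1 -> g = 1].
Proof.
pose N z := central z /\ z ^+ 4 = 1.
have N1 : N 1 by split; [exact: central_1|clear; fgroup].
have NM z w : N z -> N w -> N (z * w).
  move=> [cz z4] [cw w4]; split; first by move=> k; apply/commute_sym/commuteM; apply: commute_sym.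
  transitivity (z ^+ 4 * w ^+ 4); last by rewrite z4 w4 mulg1.
  by have := cz w; clear; move=> h; fgroup.
have NV z : N z -> N z^-1.
  move=> [cz z4]; split; first by move=> k; apply/commute_sym/commuteV/commute_sym.
  by rewrite -[RHS]invg1 -z4; clear; fgroup.
have NJ z k : N z -> True -> N (z ^ k).
  by move=> [cz z4] _; rewrite (conj_fix (cz k)).
have [Q [rep [[q1 q2 q3 q4] [q5 q6 _]]]] := @subquotient G (fun _ => True) N (fun _ _ => I)
  (And3 I (fun _ _ _ _ => I) (fun _ _ => I)) (And3 N1 NM NV) NJ.
have qC := rep_comm q5 q6.
have hd0 g : exists q, rep g q by apply: q1.
have [d hd] := choice hd0.
have dE g q : rep g q -> d g = q by move=> h; exact: q3 (hd g) h.
have dR g h : d [~ g, h] = [~ d g, d h] by apply: dE; apply: qC.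
have dM g h : d (g * h) = d g * d h by apply: dE; apply: (q5).
have dV g : d g^-1 = (d g)^-1 by apply: dE; apply: (q6).
have dJ g h : d (g ^ h) = d g ^ d h by rewrite /conjg !dM dV.
have ds q : exists g, q = d g by have [g hg] := q2 q; exists g; rewrite (dE _ _ hg).
have dN g : N g -> d g = 1 by move=> h; apply: dE; apply/q4.
have dK g : d g = 1 -> N g by move=> h; apply/q4; rewrite -h.
have dgood p : R3 p -> good (d p).
  move=> Rp; have w4 g : N (cjw p g).
    by split; [exact: cjw_central|have [[_ _ _ _ ->]] := cj_facts TF g Rp].
  split=> [q|q|q q'|q]; have [g ->] := ds q.
  - by rewrite -!dR /commute -!dM; congr d; apply: Rp.
  - by rewrite -dJ -dR; apply: comm_commute; rewrite -dR; apply: dN; exact: w4.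
  - have [h ->] := ds q'; rewrite -!dJ -dR; apply: comm_commute; rewrite -dR; apply: dN.
    by rewrite cjc_comm //; apply: NM.
  - rewrite -!dR; apply: comm_commute; rewrite -dR; apply: dN.
    by have [_ [_ _ ->]] := R3_base TF g Rp; apply: NV; exact: w4.
exists Q, d; split=> //.
- move=> q hq qq; have [g g5 eg] := lct_lift dM ds hq.
  (* The square of [g] lies in the kernel, which has exponent 4; hence [g] has exponent 8. *)
  rewrite eg -dM in qq; have [_ g8] := dK _ qq.
  rewrite eg; apply: dN; suff -> : g = 1 by [].
  by apply: (TF8 TF g5); rewrite -g8; clear; fgroup.
- by move=> p Rp; split; [exact: dgood|rewrite -dV; have [] := dgood _ (R3_inv TF Rp)].
- by move=> p Rp; rewrite -dV; apply: dgood; exact: R3_inv.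
- by move=> g g5 /dK[_ g4]; apply: (TF4 TF).
Qed.

Lemma R3_xi_comm a x : R3 a -> commute [~ a, x, x] [~ a, x].
Proof.
move=> Ra; have [Q [d [dR TQ dg _ dK]]] := R3_quotient; have [ga _] := dg _ Ra.
apply: comm_commute; apply: dK.
  apply: (@lct_comm G 3 2) => //; last exact: lct_comm1.
  by apply: lct_comm1; apply: lct_comm1.
by rewrite !dR; apply: commute_comm; apply: good_xi_comm.
Qed.

Lemma R3_comm a b x : R3 a -> R3 b ->
  commute [~ a, x, x] [~ b, x] /\ commute [~ [~ b, x], [~ a, x]] [~ a, x].
Proof.
move=> Ra Rb; have [Q [d [dR TQ dg dgV dK]]] := R3_quotient.
have [ga RaV] := dg _ Ra; have [gb _] := dg _ Rb; have gbV := dgV _ Rb.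
split; apply: comm_commute; apply: dK.
- apply: (@lct_comm G 3 2) => //; last exact: lct_comm1.
  by apply: lct_comm1; apply: lct_comm1.
- by rewrite !dR; apply: good_comm.
- apply: (@lct_le G 5 6) => //; apply: (@lct_comm G 4 2) => //; last exact: lct_comm1.
  by apply: (@lct_comm G 2 2) => //; apply: lct_comm1.
- by rewrite !dR; apply: good_comm2.
Qed.

Lemma R3_div a b : R3 a -> R3 b -> R3 (a * b^-1).
Proof.
move=> Ra Rb x; have [e_be mu_c] := R3_comm x Ra Rb; have [f_c mu_be] := R3_comm x Rb Ra.
have ex := Ra x; have fx := Rb x.
apply: (@commute_J2V _ _ _ b).
have -> : [~ a * b^-1, x, x] ^ b = [~ [~ a, x] * x^-1, x * [~ b, x]^-1] ^ (x * [~ b, x]^-1).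
  by clear; fgroup.
have -> : x ^ b = (x * [~ b, x]^-1) ^ (x * [~ b, x]^-1) by clear; fgroup.
apply: commute_J2.
set c := [~ a, x] in e_be mu_c f_c mu_be ex *; set be := [~ b, x] in e_be mu_c f_c mu_be fx *.
have cx : c ^ x = c * [~ c, x] by clear; clearbody c; fgroup.
have bex : be ^ x = be * [~ be, x] by clear; clearbody be; fgroup.
have bec : be ^ c = be * [~ be, c] by clear; clearbody be c; fgroup.
have {}mu_be : commute [~ be, c] be.
  by have -> : [~ be, c] = [~ c, be]^-1; [clear; clearbody be c; fgroup|apply/commute_sym/commuteV/commute_sym].
have ec : commute [~ c, x] c := R3_xi_comm x Ra.
have fbe : commute [~ be, x] be := R3_xi_comm x Rb.
have ef : commute [~ c, x] [~ be, x] by apply: commuteR.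
have emu : commute [~ c, x] [~ be, c] by apply: commuteR.
have fmu : commute [~ be, x] [~ be, c] by apply: commuteR.
(* Conjugation by [x] multiplies the two entries by [[~ be, x]] and [[~ c, x]], which commute with
   both entries and with each other. *)
have mux : commute [~ be, c] x.
  apply: commute_conj; rewrite conjRg cx bex.
  move: [~ c, x] [~ be, x] ec fbe ef e_be f_c; clear; clearbody c be => e f ec fbe ef e_be f_c.
  by fgroup.
move: [~ c, x] [~ be, x] [~ be, c] cx bex bec ec fbe ef emu fmu mux mu_c mu_be ex fx e_be f_c.
clear; clearbody c be => e f mu cx bex bec ec fbe ef emu fmu mux mu_c mu_be ex fx e_be f_c.
have cxV : c ^ x^-1 = c * e^-1 by apply: (conj_inv_tail cx).
have bexV : be ^ x^-1 = be * f^-1 by apply: (conj_inv_tail bex).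
have becV : be ^ c^-1 = be * mu^-1 by apply: (conj_inv_tail bec).
by gcol [:: x; c; be; e; f; mu].
Qed.

End RightEngelSubgroup.

Lemma torsion_free2 (G : groupType)
  (hG : ~ (exists2 x : G, lower_central_term G 5 x & has_order x 2)) :
  forall x : G, lower_central_term G 5 x -> x * x = 1 -> x = 1.
Proof.
move=> x gx xx; apply/eqP; apply: contraPT isT => /eqP nx _; apply: hG.
exists x => //; split=> // -[|[|m]] // _; rewrite expg1; exact: nx.
Qed.

Lemma right_engel3P (G : groupType) (p : G) : right_engel G 3 p <-> R3 p.
Proof.
by split=> h g; [apply: comm_commute; exact: h|apply: commute_comm; exact: h].
Qed.

Theorem theorem2p2 (G : groupType)
  (hG : ~ (exists2 x : G, lower_central_term G 5 x & has_order x 2)) :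
  is_subgroup (right_engel G 3).
Proof.
have TF := torsion_free2 hG.
have R1 : R3 (1 : G) by move=> g; rewrite !comm1g; apply/commute_sym/commute1.
apply/is_subgroupP; split=> [|x y|x].
- exact/right_engel3P.
- move=> /right_engel3P Rx /right_engel3P Ry; apply/right_engel3P.
  by rewrite -[y]invgK; apply: R3_div => //; apply: R3_inv.
- by move=> /right_engel3P Rx; apply/right_engel3P; apply: R3_inv.
Qed.
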